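(* Fix $p\in[2,\infty)$, and let $\{k_n\}_{n\in\mathbb N}$ be an increasing sequence of positive integers with $k_n\le n$ such that $\lim_{n\to\infty}k_n=\infty$ and $\lim_{n\to\infty}k_n/n=0$. For each $n\in\mathbb N$, let $Y^{(n)}$ be uniformly distributed on $\mathbb B_p^n=\{x\in\mathbb R^n:\sum_{i=1}^n|x_i|^p\le n\}$. Then for $\sigma$-a.e. (deterministic) sequence $a=\{a^{(n)}\}_{n\in\mathbb N}\in\mathbb V$, the sequence $$\left\{\left\|n^{-1/2}(a^{(n)})^{\mathsf T}Y^{(n)}\right\|_2\right\}_{n\in\mathbb N}$$ satisfies a large deviation principle in $\mathbb R_+$ with speed $n$ and good rate function $$\mathbb I_p(r)=\sup_{t_1,t_2\in\mathbb R}\left\{t_1r+t_2-\mathbb E\left[\overline\Lambda_p(t_1g_0,t_2)\right]\right\}.$$ Furthermore, $\mathbb I_p$ is convex.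
   Context: Notation: $\mathbb R_+=[0,\infty)$. ''Increasing'' means $k_{n+1}\ge k_n$ for all $n$. For $k\le n$, $\mathbb V_{n,k}=\{A\in\mathbb R^{n\times k}:A^{\mathsf T}A=I_k\}$ is the Stiefel manifold; $\sigma_n$ is the Haar (invariant) probability measure on $\mathbb V_{n,k_n}$; $\mathbb V=\prod_n\mathbb V_{n,k_n}$; and $\sigma$ is any probability measure on $\mathbb V$ whose $n$-th marginal is $\sigma_n$ for every $n$. $\|\cdot\|_2$ is the Euclidean norm. Let $Z_p$ be a real random variable with density $f_p(x)=\frac{1}{2p^{1/p}\Gamma(1+1/p)}\exp(-|x|^p/p)$, let $\overline\Lambda_p(t_1,t_2)=\log\mathbb E[\exp(t_1Z_p+t_2|Z_p|^p)]\in\mathbb R\cup\{\infty\}$, and let $g_0$ be a standard Gaussian random variable. Large deviation principle (LDP): random variables $Z^{(n)}$ in a topological space $\mathcal T$ satisfy an LDP with speed $s_n$ and rate function $J:\mathcal T\to[0,\infty]$ if for every Borel set $B$, $-\inf_{B^\circ}J\le\liminf_n\frac1{s_n}\log\mathbb P(Z^{(n)}\in B)\le\limsup_n\frac1{s_n}\log\mathbb P(Z^{(n)}\in B)\le-\inf_{\overline B}J$. The rate function $J$ is good if all sets $\{J\le\alpha\}$, $\alpha\in[0,\infty)$, are compact. *)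

(* Defs.v *)
From HB Require Import structures.
From mathcomp Require Import all_boot all_order all_algebra.
From mathcomp Require Import all_classical all_reals all_analysis.
Import Order.TTheory GRing.Theory Num.Theory.
Import numFieldNormedType.Exports.

Set Implicit Arguments.
Unset Strict Implicit.
Unset Printing Implicit Defensive.

Local Open Scope classical_set_scope.
Local Open Scope ring_scope.

Definition borel (T : ptopologicalType) : measurableType _ :=
  g_sigma_algebraType (@open T).

Section product_sigma_algebra.
Context (d : nat -> measure_display) (T : forall n, measurableType (d n)).

Definition cylinders : set (set (forall n, T n)) :=
  \bigcup_n preimage_set_system setT (fun x : forall n, T n => x n) measurable.

Definition prodm : measurableType _ := g_sigma_algebraType cylinders.
End product_sigma_algebra.

Section stiefel.
Variable R : realType.

(* [set_type] carries the subspace topology. The proof of [k <= n] is an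
   argument because measurable types are pointed: it makes the manifold
   inhabited. *)
Definition stiefel (n k : nat) (kn : (k <= n)%N) : Type :=
  set_type [set A : 'M[R]_(n, k) | A^T *m A = 1%:M].

Lemma stiefel_point_subproof n k (kn : (k <= n)%N) :
  (pid_mx k : 'M[R]_(n, k)) \in [set A : 'M[R]_(n, k) | A^T *m A = 1%:M].
Proof. by rewrite inE /= tr_pid_mx pid_mx_id // pid_mx_1. Qed.

HB.instance Definition _ n k (kn : (k <= n)%N) :=
  Topological.copy (stiefel kn)
    (set_type [set A : 'M[R]_(n, k) | A^T *m A = 1%:M]).
HB.instance Definition _ n k (kn : (k <= n)%N) :=
  isPointed.Build (stiefel kn)
    (exist _ (pid_mx k : 'M[R]_(n, k)) (stiefel_point_subproof kn)).

Definition stiefel_mx n k (kn : (k <= n)%N) (A : stiefel kn) : 'M[R]_(n, k) :=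
  set_val A.
Arguments stiefel_mx {n k} kn A.

Lemma stiefel_mul_subproof n k (kn : (k <= n)%N)
    (O : stiefel (leqnn n)) (A : stiefel kn) :
  (stiefel_mx (leqnn n) O *m stiefel_mx kn A) \in
    [set A : 'M[R]_(n, k) | A^T *m A = 1%:M].
Proof.
rewrite inE /= trmx_mul mulmxA -(mulmxA (stiefel_mx kn A)^T).
have /= OO := set_mem (valP O); have /= AA := set_mem (valP A).
by rewrite [X in _ *m X *m _]OO mulmx1.
Qed.

Definition stiefel_mul n k (kn : (k <= n)%N)
    (O : stiefel (leqnn n)) (A : stiefel kn) : stiefel kn :=
  exist _ (stiefel_mx (leqnn n) O *m stiefel_mx kn A) (stiefel_mul_subproof O A).

(* The orthogonal group O(n) is [stiefel (leqnn n)]. *)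
Definition is_haar n k (kn : (k <= n)%N)
    (mu : probability (borel (stiefel kn)) R) : Prop :=
  forall (O : stiefel (leqnn n)) (B : set (borel (stiefel kn))),
    measurable B -> mu (stiefel_mul O @^-1` B) = mu B.

(* Sequences are indexed from 0: the entry of index [n] is the one attached to
   the dimension [n.+1], so [k n] is k_{n+1}. *)
Definition stiefel_prod (k : nat -> nat) (kn : forall n, (k n <= n.+1)%N) :
    measurableType _ :=
  prodm (fun n => borel (stiefel (kn n))).

Definition has_marginals (k : nat -> nat) (kn : forall n, (k n <= n.+1)%N)
    (sigma : probability (stiefel_prod kn) R)
    (mu : forall n, probability (borel (stiefel (kn n))) R) : Prop :=
  forall n (B : set (borel (stiefel (kn n)))), measurable B ->
    sigma [set a : stiefel_prod kn | B (a n)] = mu n B.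
End stiefel.
Arguments stiefel_mx {R n k} kn A.

Section uniform_ball.
Variable R : realType.

(* Lebesgue measure of R^n on Borel sets, by integrating sections. *)
Fixpoint volume (n : nat) : set 'cV[R]_n -> \bar R :=
  if n is m.+1 then
    fun A => (\int[lebesgue_measure]_x
      volume [set v : 'cV[R]_m | A (col_mx (x%:M : 'cV[R]_1) v)])%E
  else fun A => (\1_A (0 : 'cV[R]_0))%:E.

Definition lp_ball (p : R) (n : nat) : set 'cV[R]_n :=
  [set x | \sum_i `|x i ord0| `^ p <= n%:R].

Definition uniform_on n (K : set 'cV[R]_n) d (Omega : measurableType d)
    (P : probability Omega R) (Y : {RV P >-> borel 'cV[R]_n}) : Prop :=
  forall A : set (borel 'cV[R]_n), measurable A ->
    P (Y @^-1` A) = (fine (volume (A `&` K)) / fine (volume K))%:E.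
End uniform_ball.
Arguments lp_ball {R} p n _.

Section euclidean_norm.
Variable R : realType.

Definition Rplus : topologicalType := set_type [set x : R | 0 <= x].

Lemma norm2_subproof k (v : 'cV[R]_k) :
  Num.sqrt (\sum_i v i ord0 ^+ 2) \in [set x : R | 0 <= x].
Proof. by rewrite inE /= sqrtr_ge0. Qed.

Definition norm2 k (v : 'cV[R]_k) : Rplus :=
  exist _ (Num.sqrt (\sum_i v i ord0 ^+ 2)) (norm2_subproof v).
End euclidean_norm.

Section large_deviations.
Local Open Scope ereal_scope.
Context (R : realType) (T : topologicalType).

Definition LDP (d : nat -> measure_display)
    (Omega : forall n, measurableType (d n))
    (P : forall n, probability (Omega n) R) (Z : forall n, Omega n -> T)
    (s : nat -> R) (J : T -> \bar R) : Prop :=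
  (forall n (B : set T), <<s @open T >> B -> measurable (Z n @^-1` B)) /\
  forall B : set T, <<s @open T >> B ->
    let u n := ((s n)^-1)%:E * lne (P n (Z n @^-1` B)) in
    [/\ - ereal_inf (J @` B°) <= limn_einf u,
        limn_einf u <= limn_esup u &
        limn_esup u <= - ereal_inf (J @` closure B)].

Definition good_rate_function (J : T -> \bar R) : Prop :=
  (forall x, 0 <= J x) /\
  forall alpha : R, (0 <= alpha)%R -> compact [set x | J x <= alpha%:E].
End large_deviations.

Section rate_function.
Variable R : realType.

Definition Gamma (z : R) : R :=
  \int[lebesgue_measure]_(x in `]0, +oo[) (x `^ (z - 1) * expR (- x)).

Definition density_p (p x : R) : R :=
  (2 * p `^ p^-1 * Gamma (1 + p^-1))^-1 * expR (- (`|x| `^ p / p)).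

Definition has_density_p (p : R) d (Omega : measurableType d)
    (P : probability Omega R) (Z : {RV P >-> R}) : Prop :=
  forall A : set R, measurable A ->
    distribution P Z A = (\int[lebesgue_measure]_(x in A) (density_p p x)%:E)%E.

Definition standard_gaussian d (Omega : measurableType d)
    (P : probability Omega R) (g : {RV P >-> R}) : Prop :=
  forall A : set R, measurable A -> distribution P g A = normal_prob 0 1 A.

Definition Lambda (p : R) d (Omega : measurableType d)
    (P : probability Omega R) (Z : {RV P >-> R}) (t1 t2 : R) : \bar R :=
  lne 'E_P[fun w => expR (t1 * Z w + t2 * `|Z w| `^ p)].

(* E[Lambda_p(t1 g0, t2)] is [+oo] for t2 >= 1/p, and the bracket is then
   [-oo]. *)
Definition rate (p : R) d (Omega : measurableType d)
    (P : probability Omega R) (Z : {RV P >-> R})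
    d' (Omega' : measurableType d') (P' : probability Omega' R)
    (g0 : {RV P' >-> R}) (r : R) : \bar R :=
  ereal_sup [set ((t.1 * r + t.2)%:E -
      \int[P']_w Lambda p Z (t.1 * g0 w) t.2)%E | t in [set: R * R]].

Definition convex_on (D : set R) (f : R -> \bar R) : Prop :=
  forall x y t : R, D x -> D y -> 0 <= t <= 1 ->
    (f (t * x + (1 - t) * y)%R <= t%:E * f x + (1 - t)%:E * f y)%E.
End rate_function.

(* Main.v *)
Require Import Defs.
From HB Require Import structures.
From mathcomp Require Import all_boot all_order all_algebra.
From mathcomp Require Import all_classical all_reals all_analysis.
From mathcomp Require Import measurable_realfun ring lra.
Import Order.TTheory GRing.Theory Num.Theory.
Import numFieldNormedType.Exports.
Set Implicit Arguments.
Unset Strict Implicit.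
Unset Printing Implicit Defensive.
Local Open Scope classical_set_scope.
Local Open Scope ring_scope.

(** Write [L s = log E exp(s Z_p)], [phi s = E L(s g_0)] and
    [c0 = \int exp(-|x|^p/p) dx].  With [t1 = s e^l] and [t2 = (1 - e^(pl))/p], which
    exhausts [t2 < 1/p], the bracket in [I_p r] is [1/p + obj r s l], where
    [obj r s l = s e^l r - e^(pl)/p + l - phi s]; for [t2 >= 1/p] it is [-oo].

    For a unit vector [w] of [R^k], [sqrt n *: (a *m w)] is uniform on the sphere of
    radius [sqrt n]; comparing it with a standard Gaussian vector [G] having almost the
    same direction shows that [n^-1 \sum_i L(s sqrt n (a w)_i)] is within [e] of
    [phi s] off an event of probability [O(q^n)].  Since [k_n / n -> 0], the unit sphere
    of [R^(k_n)] has nets of cardinality [exp(o(n))], so by Borel-Cantelli almost every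
    [a] satisfies this eventually for all [w] in the net and, by monotonicity, all [s].

    Fix such an [a] and let [u = sqrt n *: (a *m w)].  The weight
    [exp(s e^l <u, y> - e^(pl) |y|_p^p / p)] has total mass
    [(c0 e^-l)^n exp(\sum_i L(s u_i))].  Markov's inequality and a union bound over the
    net give the upper bound for [P(norm >= r)].  At a maximizer of [obj rho] with
    [rho < r], the first order conditions say that under the weight [<u, y>/n] and
    [|y|_p^p/n] concentrate near [rho] and [1]; as [norm >= <u, y>/n], this gives the
    lower bound for [P(norm > rho)].  Finally [I_p] is convex, vanishes only at [0],
    hence increases strictly where it is finite, and [P(|norm - r| < d)] is of the order
    of [P(norm > r - d)]. *)

(** * Borel measurability and affine changes of variable *)

(** With [t1 = s e^l], the substitution [x -> e^l x] leaves only the one-variable function [L], so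
    every normalization is expressed through averages of [L (s u_i)]. The hypothesis [2 <= p] enters
    through [x^2 - 1 <= |x|^p]: it makes [L] at most quadratic, hence [L (s g)] has exponential
    moments of small order for Gaussian [g], and these give the rate [q^n]. The frame and the
    Gaussian vector are coupled through their angle alone: both laws are invariant under rotations,
    so conditioning the product measure on a small angle changes neither marginal. No derivative of
    [phi] is taken. Maximality bounds [phi] from below on one side of the maximizer, a bound on
    second differences reflects this to the other side, and the resulting quadratic majorant, whose
    slope is dictated by the maximizer, is all that concentration under the weight requires. The
    maximizer is taken at [rho < r] because finiteness of the supremum at [r] is what confines [s]
    to a bounded set there. *)

Definition image_measure d1 d2 (T1 : measurableType d1) (T2 : measurableType d2) (R : realType)
  (m : {measure set T1 -> \bar R}) (f : T1 -> T2) (mf : measurable_fun setT f) : {measure set T2 -> \bar R}.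
Proof.
unshelve refine (pushforward m f : {measure set T2 -> \bar R}); exact: mf.
Defined.

(** The scaled image measure agrees with Lebesgue measure on half-open intervals, and uniqueness
    does the rest; a negative [a] only exchanges the kinds of endpoints. *)
Lemma lebesgue_affine (R : realType) (a b : R) (A : set (R)) : a != 0 -> measurable A ->
  lebesgue_measure A = (`|a|%:E * lebesgue_measure ((fun x => (a * x + b)%R) @^-1` A))%E.
Proof.
move=> a0 mA.
have mh : measurable_fun [set: measurableTypeR R] (fun x => a * x + b : measurableTypeR R).
  by apply: measurable_funD => //; apply: measurable_funM.
pose nu : {measure set (measurableTypeR R) -> \bar R} := mscale (NngNum (normr_ge0 a)) (image_measure (@lebesgue_measure R) mh).
rewrite (@lebesgue_measure_unique R nu) //.
move=> X /= [[u v]] /= uv <-; rewrite /nu /= /mscale /= /pushforward.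
have [ap|an] := ltP 0 a.
  have -> : (fun x => a * x + b) @^-1` `]u, v]%classic = `](u - b) / a, (v - b) / a]%classic.
    apply/seteqP; split => x /=; rewrite !in_itv /= ltr_pdivrMr// ler_pdivlMr// (mulrC x) ltrBlDr lerBrDr //.
  rewrite !lebesgue_measure_itv /= !lte_fin ltr_pM2r ?invr_gt0// ltrD2r; case: ifP => _; rewrite ?mule0 // -!EFinD -EFinM gtr0_norm//; congr EFin.
  field. exact: a0.
have {}an : a < 0 by rewrite lt_neqAle a0.
have -> : (fun x => a * x + b) @^-1` `]u, v]%classic = `[(v - b) / a, (u - b) / a[%classic.
  apply/seteqP; split => x /=; rewrite !in_itv /= ltr_ndivlMr// ler_ndivrMr// (mulrC x) ltrBlDr lerBrDr andbC //.
rewrite !lebesgue_measure_itv /= !lte_fin ltr_nM2r ?invr_lt0// ltrD2r; case: ifP => _; rewrite ?mule0 // -!EFinD -EFinM ltr0_norm//; congr EFin.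
field. exact: a0.
Qed.

Lemma ge0_integral_affine (R : realType) (a b : R) (f : R -> \bar R) : a != 0 ->
  measurable_fun setT f -> (forall x, 0 <= f x)%E ->
  (\int[lebesgue_measure]_x f (a * x + b)%R = (`|a|^-1)%:E * \int[lebesgue_measure]_x f x)%E.
Proof.
move=> a0 mf f0.
have mh : measurable_fun [set: measurableTypeR R] (fun x => a * x + b : measurableTypeR R).
  by apply: measurable_funD => //; apply: measurable_funM.
pose nu : {measure set (measurableTypeR R) -> \bar R} := mscale (NngNum (normr_ge0 a)) (image_measure (@lebesgue_measure R) mh).
have -> : (\int[lebesgue_measure]_x f x = \int[nu]_x f x)%E.
  apply: eq_measure_integral => A mA _; rewrite /= (lebesgue_affine b a0 mA) //.
rewrite /nu ge0_integral_mscale//= ge0_integral_pushforward//= preimage_setT muleA -EFinM mulVf ?normr_eq0// mul1e //.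
Qed.

Lemma borel_open (T : ptopologicalType) (U : set T) : open U -> measurable (U : set (borel T)).
Proof. by move=> oU; apply: sub_sigma_algebra. Qed.

Lemma borel_measurable_fun d (X : measurableType d) (T : ptopologicalType) (f : X -> T) :
  (forall U : set T, open U -> measurable (f @^-1` U)) ->
  measurable_fun setT (f : X -> borel T).
Proof.
move=> h; apply: (@measurability _ _ _ (borel T) setT f (@open T)) => //.
by move=> _ [U oU <-]; rewrite setTI; exact: h.
Qed.

Lemma continuous_borel_real (R : realType) (T : ptopologicalType) (f : T -> R) : continuous f ->
  measurable_fun setT (f : borel T -> R).
Proof.
move=> /continuousP cf; apply: (@measurability _ _ (borel T) (measurableTypeR R) setT f _ (RGenOpens.measurableE R)).
move=> _ [U [a [b ->]] <-]; rewrite setTI; apply: borel_open; apply: cf; exact: interval_open.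
Qed.

(** An open set is a countable union of sup-norm balls with rational centres and radii [1 / m.+1],
    and the preimage of such a ball is a finite intersection of conditions on coordinates. *)
Lemma measurable_cV (R : realType) d (X : measurableType d) n (f : X -> 'cV[R]_n) :
  (forall i, measurable_fun setT (fun x => f x i ord0)) ->
  measurable_fun setT (f : X -> borel 'cV[R]_n).
Proof.
move=> mf; apply: borel_measurable_fun => U oU.
pose B (q : 'cV[rat]_n) (m : nat) : set 'cV[R]_n := ball (map_mx ratr q : 'cV[R]_n) (m.+1%:R^-1).
(* Enumeration of the balls contained in [U]; codes that denote no such ball give the empty set. *)
pose F k : set 'cV[R]_n := if unpickle k is Some (q, m) then if `[< B q m `<=` U >] then B q m else set0 else set0.
have -> : U = \bigcup_k F k.
  apply/seteqP; split => [y Uy|y [k _]]; last first.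
    rewrite /F; case: unpickle => [[q m]|//]; by case: asboolP => // h /h.
  have /nbhs_ballP [e /= e0 he] : nbhs y U by exact: open_nbhs_nbhs.
  have [m hm] : exists m : nat, m.+1%:R^-1 < e / 2.
    by have [m] := ltr_add_invr (divr_gt0 e0 (@ltr0Sn R 1)); rewrite add0r; exists m.
  have hq i : exists q : rat, `|ratr q - y i ord0| < m.+1%:R^-1.
    have : 0 < m.+1%:R^-1 :> R by rewrite invr_gt0.
    move: (m.+1%:R^-1) => r r0; have [|q] := @rat_in_itvoo R (y i ord0 - r) (y i ord0 + r); first lra.
    by rewrite in_itv /= => /andP[h1 h2]; exists q; rewrite ltr_norml; apply/andP; split; lra.
  pose q : 'cV[rat]_n := \col_i projT1 (cid (hq i)).
  have qy : B q m y.
    split; first by rewrite invr_gt0.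
    by move=> i j; rewrite (ord1 j) !mxE /ball /=; exact: (projT2 (cid (hq i))).
  exists (pickle (q, m)) => //; rewrite /F pickleK; case: asboolP => // h; exfalso; apply: h.
  move=> z Bz; apply: he; apply: (@le_ball _ _ _ (m.+1%:R^-1 + m.+1%:R^-1)); first by move: hm; move: (m.+1%:R^-1) => r hm; lra.
  by apply: ball_triangle Bz; exact: ball_sym.
rewrite preimage_bigcup; apply: bigcupT_measurable => k; rewrite /F.
case: unpickle => [[q m]|]; last by rewrite preimage_set0.
case: asboolP => _; last by rewrite preimage_set0.
have -> : f @^-1` B q m = \big[setI/setT]_(i < n) ((fun x => f x i ord0) @^-1` ball (ratr (q i ord0) : R) m.+1%:R^-1).
  rewrite -bigcap_seq; apply/seteqP; split => x /=.
    by move=> [_ h] i _ /=; have := h i ord0; rewrite mxE.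
  move=> h; split; first by rewrite invr_gt0.
  by move=> i j; rewrite (ord1 j) mxE; apply: h; rewrite /= mem_index_enum.
apply: bigsetI_measurable => i _; rewrite -[X in measurable X]setTI; apply: mf => //.
exact: measurable_ball.
Qed.

Lemma measurable_ler (R : realType) d (X : measurableType d) (f g : X -> R) :
  measurable_fun setT f -> measurable_fun setT g -> measurable [set x | f x <= g x].
Proof.
move=> mf mg; have := measurable_funB mg mf; move=> /(_ measurableT `[0, +oo[%classic (measurable_itv _)).
rewrite setTI (_ : _ @^-1` _ = [set x | f x <= g x])//.
by apply/seteqP; split => x /=; rewrite in_itv /= andbT subr_ge0.
Qed.

Lemma measurable_ltr (R : realType) d (X : measurableType d) (f g : X -> R) :
  measurable_fun setT f -> measurable_fun setT g -> measurable [set x | f x < g x].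
Proof.
move=> mf mg; have := measurable_funB mg mf; move=> /(_ measurableT `]0, +oo[%classic (measurable_itv _)).
rewrite setTI (_ : _ @^-1` _ = [set x | f x < g x])//.
by apply/seteqP; split => x /=; rewrite in_itv /= andbT subr_gt0.
Qed.

(** * Lebesgue measure on column vectors *)

Section vol.
Variable R : realType.

(** The section map in the recursion of [volume], uncurried, so that the measure in dimension [n.+1]
    is an image of a product measure. *)
Definition cons_cv n (x : R * 'cV[R]_n) : 'cV[R]_n.+1 := col_mx (x.1%:M : 'cV_1) x.2.

Lemma cons_cv0 n (x : R) (v : 'cV[R]_n) : cons_cv (x, v) ord0 ord0 = x.
Proof.
rewrite /cons_cv mxE; case: splitP => j //= h.
by rewrite (ord1 j) mxE eqxx.
Qed.

Lemma cons_cvS n (x : R) (v : 'cV[R]_n) i : cons_cv (x, v) (lift ord0 i) ord0 = v i ord0.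
Proof.
rewrite /cons_cv mxE; case: splitP => j //=; first by rewrite (ord1 j).
rewrite /bump leq0n !add1n => -[] /val_inj ->; congr (v _ _).
Qed.

Lemma measurable_coord d (X : measurableType d) n (f : X -> borel 'cV[R]_n) i :
  measurable_fun setT f -> measurable_fun setT (fun x => (f x : 'cV_n) i ord0).
Proof.
move=> mf; apply: (measurableT_comp (f := fun v : borel 'cV[R]_n => v i ord0)) => //.
by apply: continuous_borel_real; exact: coord_continuous.
Qed.

Lemma measurable_cons_cv n :
  measurable_fun setT (@cons_cv n : measurableTypeR R * borel 'cV[R]_n -> borel 'cV[R]_n.+1).
Proof.
apply: measurable_cV => i; case: (unliftP ord0 i) => [j|] ->.
  under eq_fun do rewrite [X in cons_cv X]surjective_pairing cons_cvS.
  exact: measurable_coord.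
by under eq_fun do rewrite [X in cons_cv X]surjective_pairing cons_cv0; exact: measurable_fst.
Qed.

Definition cube n (N : nat) : set 'cV[R]_n := [set y | forall i, `|y i ord0| <= N%:R].

Lemma measurable_cube n N : measurable (@cube n N : set (borel 'cV[R]_n)).
Proof.
have -> : @cube n N = \big[setI/setT]_(i < n) ((fun y : borel 'cV[R]_n => y i ord0) @^-1` `[- N%:R, N%:R]).
  rewrite -bigcap_seq; apply/seteqP; split => y /= h i; first by move=> _; rewrite /= in_itv /= -ler_norml; exact: h.
  by have := h i; rewrite /= in_itv /= -ler_norml mem_index_enum; apply.
apply: bigsetI_measurable => i _; rewrite -[X in measurable X]setTI.
by apply: (@measurable_coord _ (borel 'cV[R]_n) n id) => //; exact: measurable_id.
Qed.

(** [volume] is a mere set function; on Borel sets it is the image of a product measure, by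
    induction. Finiteness on cubes is carried along because cubes exhaust the space, and the next
    product needs a sigma-finite factor. *)
Lemma volume_measure n : exists mu : {sigma_finite_measure set (borel 'cV[R]_n) -> \bar R},
  (forall A, measurable A -> mu A = volume A) /\ (forall N, (mu (@cube n N) < +oo)%E).
Proof.
elim: n => [|n [mu [muE muB]]].
  exists (dirac (0 : borel 'cV[R]_0)); split => [//|N].
  by rewrite /= /dirac /= ltry.
pose nu := image_measure (@lebesgue_measure R \x mu)%E (@measurable_cons_cv n).
have nuE A : measurable A -> nu A = volume A.
  move=> mA; rewrite /nu /= /pushforward /product_measure1 /=.
  apply: eq_integral => x _ /=.
  rewrite muE; last by apply: measurable_xsection; rewrite -[X in measurable X]setTI; exact: measurable_cons_cv.
  by congr volume; apply/seteqP; split => v; rewrite /xsection /= inE.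
have nuB N : (nu (@cube n.+1 N) < +oo)%E.
  rewrite /nu /= /pushforward /product_measure1 /=.
  apply: (@le_lt_trans _ _ (\int[lebesgue_measure]_x ((\1_`[- N%:R, N%:R] x)%:E * mu (@cube n N)))%E).
    apply: ge0_le_integral => //=.
    - apply: measurable_fun_xsection.
      by rewrite -[X in measurable X]setTI; apply: measurable_cons_cv => //; exact: measurable_cube.
    - by apply: emeasurable_funM => //; apply/measurable_EFinP; exact: measurable_indic.
    move=> x _; rewrite indicE; case: (boolP (x \in _)) => [xI|/negP xI].
      rewrite mul1e; apply: le_measure; rewrite ?inE.
      + by apply: measurable_xsection; rewrite -[X in measurable X]setTI; apply: measurable_cons_cv => //; exact: measurable_cube.
      + exact: measurable_cube.
      by move=> v; rewrite /xsection /= inE => h i; have := h (lift ord0 i); rewrite cons_cvS.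
    rewrite mul0e [X in mu X](_ : _ = set0) ?measure0//; apply/seteqP; split => v //.
    rewrite /xsection /= inE => h; apply: xI; have := h ord0; rewrite cons_cv0 => ?.
    by rewrite inE /= in_itv /= -ler_norml.
  rewrite ge0_integralZr//=; last by apply/measurable_EFinP; exact: measurable_indic.
  have -> : (\int[lebesgue_measure]_x (\1_`[(- N%:R)%R, N%:R%R] x)%:E = lebesgue_measure (`[(- N%:R)%R, N%:R%R]%classic : set R))%E.
    by rewrite integral_indic// setIT.
  rewrite lebesgue_measure_itv /=; case: ifP => _; last by rewrite mul0e.
  by rewrite lte_mul_pinfty// lee_fin opprK addr_ge0.
have nus : sigma_finite setT nu.
  exists (@cube n.+1); last by move=> i; split; [exact: measurable_cube|exact: nuB].
  apply/esym; rewrite -subTset => y _; have [m hm] : exists m : nat, forall i, `|y i ord0| <= m%:R.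
    exists (\max_(i < n.+1) Num.trunc `|y i ord0|).+1 => i.
    apply: ltW; apply: lt_le_trans (truncnS_gt _) _.
    by rewrite ler_nat ltnS; apply: (leq_bigmax i).
  by exists m.
pose nu' : {sigma_finite_measure set (borel 'cV[R]_n.+1) -> \bar R} :=
  HB.pack (nu : set (borel 'cV[R]_n.+1) -> \bar R) (Measure.class nu) (Measure_isSigmaFinite.Build _ _ _ _ nus).
by exists nu'; split.
Qed.
End vol.

Section vol_theory.
Variable R : realType.

Definition volm n : {sigma_finite_measure set (borel 'cV[R]_n) -> \bar R} :=
  projT1 (cid (volume_measure R n)).

Lemma volmE n (A : set (borel 'cV[R]_n)) : measurable A -> volm n A = volume A.
Proof. by move=> mA; have [h _] := projT2 (cid (volume_measure R n)); exact: h. Qed.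

Lemma ge0_integral_volmS n (f : borel 'cV[R]_n.+1 -> \bar R) :
  measurable_fun setT f -> (forall y, 0 <= f y)%E ->
  (\int[volm n.+1]_y f y =
   \int[lebesgue_measure]_x \int[volm n]_v f (cons_cv (x, v)))%E.
Proof.
move=> mf f0.
rewrite (@eq_measure_integral _ _ _ _ (image_measure (@lebesgue_measure R \x volm n)%E (@measurable_cons_cv R n))); last first.
  move=> A mA _; transitivity (volume A); first exact: volmE.
  rewrite /= /pushforward /product_measure1 /=.
  apply: eq_integral => x _ /=; symmetry.
  transitivity (volume (xsection (@cons_cv R n @^-1` A) x)).
    apply: volmE; apply: (@measurable_xsection _ _ (measurableTypeR R) (borel 'cV[R]_n)).
    by rewrite -[X in measurable X]setTI; exact: measurable_cons_cv.
  by congr volume; apply/seteqP; split => v; rewrite /xsection /= inE.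
rewrite ge0_integral_pushforward//=; last exact: measurable_cons_cv.
rewrite preimage_setT fubini_tonelli1//.
exact: (measurableT_comp mf (@measurable_cons_cv R n)).
Qed.

Lemma integral_volm0 (f : borel 'cV[R]_0 -> \bar R) : measurable_fun setT f ->
  (forall y, 0 <= f y)%E -> (\int[volm 0]_y f y = f 0%R)%E.
Proof.
move=> mf f0; rewrite (@eq_measure_integral _ _ _ _ (dirac (0 : borel 'cV[R]_0))).
  by rewrite integral_dirac// diracT mul1e.
by move=> A mA _; exact: volmE.
Qed.

Lemma measurable_prod_coord n (h : 'I_n -> R -> R) : (forall i, measurable_fun setT (h i)) ->
  measurable_fun setT (fun y : borel 'cV[R]_n => \prod_i h i (y i ord0)).
Proof.
move=> mh; apply: measurable_prod => i _; apply: measurableT_comp => //.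
exact: (measurable_coord _ (@measurable_id _ (borel 'cV[R]_n) setT)).
Qed.

Lemma integral_volm_prod n (h : 'I_n -> R -> R) (c : 'I_n -> R) :
  (forall i, measurable_fun setT (h i)) -> (forall i x, 0 <= h i x) ->
  (forall i, \int[lebesgue_measure]_x (h i x)%:E = (c i)%:E)%E ->
  (\int[volm n]_y (\prod_i h i (y i ord0))%:E = (\prod_i c i)%:E)%E.
Proof.
elim: n h c => [|n IH] h c mh h0 hc.
  rewrite integral_volm0 ?big_ord0//; first by apply/measurable_EFinP; exact: measurable_prod_coord.
  by move=> y; rewrite big_ord0.
have hp m (g : 'I_m -> R -> R) y : (forall i x, 0 <= g i x) -> 0 <= \prod_i g i ((y : 'cV[R]_m) i ord0).
  by move=> g0; apply: prodr_ge0.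
rewrite ge0_integral_volmS; last 2 first.
  by apply/measurable_EFinP; exact: measurable_prod_coord.
  by move=> y; rewrite lee_fin hp.
under eq_integral => x _.
  under eq_integral => v _.
    rewrite big_ord_recl /= cons_cv0.
    under eq_bigr do rewrite cons_cvS.
    rewrite EFinM.
    over.
  rewrite ge0_integralZl//; last 3 first.
    by apply/measurable_EFinP; apply: (measurable_prod_coord (h := fun i => h (lift ord0 i))) => i; exact: mh.
    by move=> v _; rewrite lee_fin (hp _ (fun i => h (lift ord0 i))).
    by rewrite lee_fin.
  rewrite (IH (fun i => h (lift ord0 i)) (fun i => c (lift ord0 i))) //.
  over.
rewrite /= ge0_integralZr//=.
- by rewrite hc -EFinM big_ord_recl.
- by apply/measurable_EFinP; exact: mh.
- by move=> x _; rewrite lee_fin.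
- rewrite lee_fin; apply: prodr_ge0 => i _; rewrite -lee_fin -hc integral_ge0// => x _.
  by rewrite lee_fin.
Qed.

Lemma measurable_addcV n (v : 'cV[R]_n) :
  measurable_fun setT (fun y : borel 'cV[R]_n => (y : 'cV_n) + v : borel 'cV[R]_n).
Proof.
apply: measurable_cV => i; under eq_fun do rewrite mxE.
by apply: measurable_funD => //; exact: (measurable_coord _ (@measurable_id _ (borel 'cV[R]_n) setT)).
Qed.

Lemma measurable_mulmxcV d (X : measurableType d) m n (O : 'M[R]_(m, n)) (f : X -> borel 'cV[R]_n) :
  measurable_fun setT f ->
  measurable_fun setT (fun y => O *m (f y : 'cV_n) : borel 'cV[R]_m).
Proof.
move=> mf; apply: measurable_cV => i; under eq_fun do rewrite mxE.
apply: measurable_sum => j; apply: measurable_funM => //.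
exact: measurable_coord.
Qed.

Lemma measurable_cons_cvr n x :
  measurable_fun setT (fun u : borel 'cV[R]_n => cons_cv (x, u : 'cV_n) : borel 'cV[R]_n.+1).
Proof.
apply: measurable_cV => i; case: (unliftP ord0 i) => [j|] ->.
  under eq_fun do rewrite cons_cvS.
  exact: (measurable_coord _ (@measurable_id _ (borel 'cV[R]_n) setT)).
by under eq_fun do rewrite cons_cv0; exact: measurable_cst.
Qed.

Lemma ge0_integral_volm_translate n (f : borel 'cV[R]_n -> \bar R) (v : 'cV[R]_n) :
  measurable_fun setT f -> (forall y, 0 <= f y)%E ->
  (\int[volm n]_y f ((y : 'cV_n) + v)%R = \int[volm n]_y f y)%E.
Proof.
elim: n f v => [|n IH] f v mf f0.
  by apply: eq_integral => y _; congr f; apply/matrixP => -[].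
have mft : measurable_fun setT (fun y : borel 'cV[R]_n.+1 => f ((y : 'cV_n.+1) + v)).
  exact: (measurableT_comp mf (measurable_addcV v)).
rewrite (ge0_integral_volmS mft)// (ge0_integral_volmS mf)//.
have mfc x : measurable_fun setT (fun u : borel 'cV[R]_n => f (cons_cv (x, u : 'cV_n))).
  apply: (measurableT_comp mf).
  exact: measurable_cons_cvr.
have vE : v = cons_cv (v ord0 ord0, \col_i v (lift ord0 i) ord0).
  apply/matrixP => i j; rewrite (ord1 j); case: (unliftP ord0 i) => [k|] ->.
    by rewrite cons_cvS mxE.
  by rewrite cons_cv0.
under eq_integral => x _.
  under eq_integral => u _.
    (* The factor [1] puts the first coordinate in the form expected by the affine change of
       variable. *)
    rewrite (_ : (cons_cv (x, u : 'cV_n) + v)%R = cons_cv ((1 * x + v ord0 ord0)%R, (u : 'cV_n) + \col_i v (lift ord0 i) ord0)%R); last first.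
      rewrite [in LHS]vE; apply/matrixP => i j; rewrite (ord1 j) mxE.
      case: (unliftP ord0 i) => [k|] ->; first by rewrite !cons_cvS [RHS]mxE.
      by rewrite !cons_cv0 mul1r.
    over.
  rewrite (IH (fun u => f (cons_cv ((1 * x + v ord0 ord0)%R, u)))) //.
  over.
rewrite /= (@ge0_integral_affine R 1 (v ord0 ord0) (fun x => \int[volm n]_u f (cons_cv (x, u : 'cV_n))))%E ?oner_eq0//.
- by rewrite normr1 invr1 mul1e.
- apply: (@measurable_fun_fubini_tonelli_F _ _ (measurableTypeR R) (borel 'cV[R]_n) R (volm n) (fun xu => f (cons_cv xu))) => //.
  exact: (measurableT_comp mf (@measurable_cons_cv R n)).
- by move=> x; apply: integral_ge0.
Qed.
End vol_theory.

(** * Rotation invariance of Lebesgue measure *)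

Section rotation.
Variable R : realType.

Definition sqn n (y : 'cV[R]_n) : R := \sum_i y i ord0 ^+ 2.

Lemma sqn_ge0 n (y : 'cV[R]_n) : 0 <= sqn y.
Proof. by apply: sumr_ge0 => i _; exact: sqr_ge0. Qed.

Lemma sqnE n (y : 'cV[R]_n) : sqn y = (y^T *m y) ord0 ord0.
Proof. by rewrite mxE; apply: eq_bigr => i _; rewrite mxE expr2. Qed.

Lemma sqn_isometry m n (O : 'M[R]_(m, n)) (y : 'cV[R]_n) : O^T *m O = 1%:M -> sqn (O *m y) = sqn y.
Proof. by move=> OO; rewrite !sqnE trmx_mul mulmxA -(mulmxA y^T) OO mulmx1. Qed.

Lemma sqnN n (y : 'cV[R]_n) : sqn (- y) = sqn y.
Proof. by apply: eq_bigr => i _; rewrite mxE sqrrN. Qed.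

Lemma measurable_sqn d (X : measurableType d) n (f : X -> borel 'cV[R]_n) :
  measurable_fun setT f -> measurable_fun setT (fun x => sqn (f x : 'cV_n)).
Proof.
move=> mf; apply: measurable_sum => i; apply: measurable_funX.
exact: measurable_coord.
Qed.

Definition gaussd n (y : 'cV[R]_n) : R := \prod_i normal_pdf 0 1 (y i ord0).

Lemma gaussdE n (y : 'cV[R]_n) : gaussd y = normal_peak 1 ^+ n * expR (- (sqn y / 2)).
Proof.
rewrite /gaussd (eq_bigr (fun i => normal_peak 1 * expR (- (y i ord0 ^+ 2 / 2)))); last first.
  move=> i _; rewrite normal_pdfE ?oner_eq0// /normal_fun subr0 expr1n.
  by rewrite mulNr.
rewrite big_split /= prodr_const card_ord -expR_sum; congr (_ * expR _).
by rewrite sumrN mulr_suml.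
Qed.

Lemma gaussd_ge0 n (y : 'cV[R]_n) : 0 <= gaussd y.
Proof. by apply: prodr_ge0 => i _; exact: normal_pdf_ge0. Qed.

Lemma measurable_gaussd n : measurable_fun setT (@gaussd n : borel 'cV[R]_n -> R).
Proof. by apply: (measurable_prod_coord (h := fun _ => normal_pdf 0 1)) => _; exact: measurable_normal_pdf. Qed.

Lemma integral_gaussd n : (\int[volm R n]_y (@gaussd n y)%:E = 1)%E.
Proof.
rewrite (@integral_volm_prod R n (fun _ => normal_pdf 0 1) (fun _ => 1)).
- by rewrite big1.
- by move=> _; exact: measurable_normal_pdf.
- by move=> _ x; exact: normal_pdf_ge0.
- by move=> _; exact: integral_normal_pdf.
Qed.

Lemma ge0_integral_volm_rotate n (f : borel 'cV[R]_n -> \bar R) (O : 'M[R]_n) :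
  O^T *m O = 1%:M -> measurable_fun setT f -> (forall y, 0 <= f y)%E ->
  (\int[volm R n]_y f (O *m y) = \int[volm R n]_y f y)%E.
Proof.
(* The integral of [f x * gaussd (O y - x)] over [x] and [y], in both orders: in [y] the
   Gaussian has mass 1, and after [x -> x + O y] it is [f (x + O y) * gaussd x]. *)
move=> OO mf f0; have OO' := mulmx1C OO.
have mO : measurable_fun setT (fun y : borel 'cV[R]_n => O *m (y : 'cV_n) : borel 'cV[R]_n).
  by apply: measurable_mulmxcV; exact: measurable_id.
have mOp1 : measurable_fun setT (fun z : borel 'cV[R]_n * borel 'cV[R]_n => O *m (z.2 : 'cV_n) - z.1 : borel 'cV[R]_n).
  apply: measurable_cV => i; under eq_fun do rewrite mxE [X in _ + X]mxE.
  apply: measurable_funB; last exact: (measurable_coord _ (measurable_fst)).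
  have h : measurable_fun setT (fun z : borel 'cV[R]_n * borel 'cV[R]_n => O *m (z.2 : 'cV_n) : borel 'cV[R]_n).
    exact: (measurableT_comp mO measurable_snd).
  exact: (measurable_coord i h).
have mOp2 : measurable_fun setT (fun z : borel 'cV[R]_n * borel 'cV[R]_n => (z.2 : 'cV_n) + O *m (z.1 : 'cV_n) : borel 'cV[R]_n).
  apply: measurable_cV => i; under eq_fun do rewrite mxE.
  apply: measurable_funD; first exact: (measurable_coord _ (measurable_snd)).
  have h : measurable_fun setT (fun z : borel 'cV[R]_n * borel 'cV[R]_n => O *m (z.1 : 'cV_n) : borel 'cV[R]_n).
    exact: (measurableT_comp mO measurable_fst).
  exact: (measurable_coord i h).
have mg : measurable_fun setT (fun y : borel 'cV[R]_n => (@gaussd n y)%:E).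
  by apply/measurable_EFinP; exact: measurable_gaussd.
have g0 (y : 'cV[R]_n) : (0 <= (gaussd y)%:E)%E by rewrite lee_fin gaussd_ge0.
have mfO : measurable_fun setT (fun y : borel 'cV[R]_n => f (O *m y)).
  exact: (measurableT_comp mf mO).
have mgt (v : 'cV[R]_n) : measurable_fun setT (fun y : borel 'cV[R]_n => (gaussd ((y : 'cV_n) + v))%:E).
  exact: (measurableT_comp mg (measurable_addcV v)).
symmetry; transitivity (\int[volm R n]_x \int[volm R n]_y (f x * (gaussd (O *m y - x))%:E))%E.
  apply: eq_integral => x _.
  under eq_integral => y _.
    rewrite (_ : gaussd (O *m y - x) = gaussd (y - O^T *m x)); last first.
      rewrite !gaussdE; congr (_ * expR (- (_ / 2))).
      by rewrite -[RHS](sqn_isometry _ OO) mulmxBr mulmxA OO' mul1mx.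
    over.
  rewrite ge0_integralZl//.
  rewrite (ge0_integral_volm_translate (f := fun y : borel 'cV[R]_n => (@gaussd n y)%:E))//.
  by rewrite integral_gaussd mule1.
rewrite (fubini_tonelli (fun z : borel 'cV[R]_n * borel 'cV[R]_n => f z.1 * (gaussd (O *m (z.2 : 'cV_n) - (z.1 : 'cV_n)))%:E)%E); first last.
  by move=> z; apply: mule_ge0.
  apply: emeasurable_funM; first exact: (measurableT_comp mf measurable_fst).
  exact: (measurableT_comp mg mOp1).
transitivity (\int[volm R n]_y \int[volm R n]_x (f ((x : 'cV_n) + O *m y)%R * (@gaussd n x)%:E))%E.
  apply: eq_integral => y _ /=.
  rewrite -(ge0_integral_volm_translate (f := fun x => f x * (gaussd (O *m y - x))%:E)%E (O *m y)).
  - apply: eq_integral => x _; congr (_ * _%:E)%E.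
    by rewrite !gaussdE -(sqnN (O *m _ - _)) opprB addrK.
  - apply: emeasurable_funM => //.
    exact: (measurableT_comp mg (measurableT_comp mOp1 (measurable_pair2 (y : borel 'cV[R]_n)))).
  - by move=> x; apply: mule_ge0.
rewrite (fubini_tonelli (fun z : borel 'cV[R]_n * borel 'cV[R]_n => f ((z.2 : 'cV_n) + O *m (z.1 : 'cV_n))%R * (@gaussd n z.2)%:E)%E); first last.
  by move=> z; apply: mule_ge0.
  apply: emeasurable_funM; first exact: (measurableT_comp mf mOp2).
  exact: (measurableT_comp mg measurable_snd).
under eq_integral => x _ /=.
  rewrite ge0_integralZr//; last first.
    exact: (measurableT_comp mf (measurableT_comp mOp2 (measurable_pair2 (x : borel 'cV[R]_n)))).
  rewrite (_ : \int[volm R n]_y _ = \int[volm R n]_y f (O *m y))%E; last first.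
    rewrite -[RHS](ge0_integral_volm_translate (f := fun y : borel 'cV[R]_n => f (O *m y)) (O^T *m x))//.
    by apply: eq_integral => y _; rewrite mulmxDr mulmxA OO' mul1mx addrC.
  over.
rewrite /= ge0_integralZl//; last exact: integral_ge0.
by rewrite integral_gaussd mule1.
Qed.
End rotation.

(** * Haar measure on the Stiefel manifold compared with the Gaussian measure *)

Section euclid.
Variable R : realType.

Definition dot n (u v : 'cV[R]_n) : R := \sum_i u i ord0 * v i ord0.
Definition enorm n (u : 'cV[R]_n) : R := Num.sqrt (sqn u).

Lemma dotE n (u v : 'cV[R]_n) : dot u v = (u^T *m v) ord0 ord0.
Proof. by rewrite mxE; apply: eq_bigr => i _; rewrite mxE. Qed.

Lemma dotC n (u v : 'cV[R]_n) : dot u v = dot v u.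
Proof. by apply: eq_bigr => i _; rewrite mulrC. Qed.

Lemma dotDr n (u v w : 'cV[R]_n) : dot u (v + w) = dot u v + dot u w.
Proof. by rewrite -big_split; apply: eq_bigr => i _; rewrite mxE mulrDr. Qed.

Lemma dotZr n (u v : 'cV[R]_n) c : dot u (c *: v) = c * dot u v.
Proof. by rewrite mulr_sumr; apply: eq_bigr => i _; rewrite mxE mulrCA. Qed.

Lemma dotBr n (u v w : 'cV[R]_n) : dot u (v - w) = dot u v - dot u w.
Proof. by rewrite -scaleN1r dotDr dotZr mulN1r. Qed.

Lemma dotuu n (u : 'cV[R]_n) : dot u u = sqn u.
Proof. by apply: eq_bigr => i _; rewrite expr2. Qed.

Lemma dot_mulmx m n (A : 'M[R]_(m, n)) (u : 'cV[R]_m) (v : 'cV[R]_n) :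
  dot (A^T *m u) v = dot u (A *m v).
Proof. by rewrite !dotE trmx_mul trmxK mulmxA. Qed.

Lemma sqnD n (u v : 'cV[R]_n) : sqn (u + v) = sqn u + 2 * dot u v + sqn v.
Proof.
by rewrite -!dotuu dotDr !(dotC (u + v)) !dotDr (dotC v u); ring.
Qed.

Lemma sqnZ n (u : 'cV[R]_n) c : sqn (c *: u) = c ^+ 2 * sqn u.
Proof. by rewrite -!dotuu dotZr dotC dotZr; ring. Qed.

Lemma sqnB n (u v : 'cV[R]_n) : sqn (u - v) = sqn u - 2 * dot u v + sqn v.
Proof. by rewrite -scaleN1r sqnD dotZr sqnZ; ring. Qed.

Lemma sqn_eq0 n (u : 'cV[R]_n) : (sqn u == 0) = (u == 0).
Proof.
apply/eqP/eqP => [|->]; last by rewrite /sqn big1// => i _; rewrite mxE expr0n.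
move/eqP; rewrite psumr_eq0 => [/allP h|i _]; last exact: sqr_ge0.
apply/matrixP => i j; rewrite (ord1 j) mxE; apply/eqP; rewrite -sqrf_eq0.
by apply: h; rewrite mem_index_enum.
Qed.

Lemma enorm_ge0 n (u : 'cV[R]_n) : 0 <= enorm u. Proof. exact: sqrtr_ge0. Qed.

Lemma enorm_sqr n (u : 'cV[R]_n) : enorm u ^+ 2 = sqn u.
Proof. by rewrite sqr_sqrtr// sqn_ge0. Qed.

Lemma enormZ n (u : 'cV[R]_n) c : enorm (c *: u) = `|c| * enorm u.
Proof. by rewrite /enorm sqnZ sqrtrM ?sqr_ge0// sqrtr_sqr. Qed.

Lemma enormN n (u : 'cV[R]_n) : enorm (- u) = enorm u.
Proof. by rewrite /enorm sqnN. Qed.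

Lemma cauchy_schwarz n (u v : 'cV[R]_n) : dot u v <= enorm u * enorm v.
Proof.
have [->|v0] := eqVneq v 0.
  by rewrite -[X in dot u X](scale0r 0) dotZr mul0r mulr_ge0 ?enorm_ge0.
have sv : 0 < sqn v by rewrite lt_neqAle sqn_ge0 eq_sym sqn_eq0 v0.
rewrite /enorm -sqrtrM ?sqn_ge0//; apply: le_trans (ler_norm _) _.
rewrite -sqrtr_sqr ler_wsqrtr//.
have := sqn_ge0 (sqn v *: u - dot u v *: v).
rewrite sqnB !sqnZ dotZr (dotC (_ *: _)) dotZr (dotC v u) => h.
rewrite -subr_ge0 -(pmulr_rge0 _ sv); apply: le_trans h _.
by rewrite le_eqVlt; apply/orP; left; apply/eqP; ring.
Qed.

Lemma ler_enormD n (u v : 'cV[R]_n) : enorm (u + v) <= enorm u + enorm v.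
Proof.
rewrite -(@ler_pXn2r _ 2) ?nnegrE ?addr_ge0 ?enorm_ge0// enorm_sqr sqnD sqrrD !enorm_sqr.
by rewrite lerD2r lerD2l mulr_natl lerMn2r /= cauchy_schwarz.
Qed.

(** The reflection in the hyperplane orthogonal to [u - v] exchanges two vectors of equal norm. It
    makes the orthogonal group transitive on spheres. *)
Lemma householder n (u v : 'cV[R]_n) : sqn u = sqn v ->
  exists2 O : 'M[R]_n, O^T *m O = 1%:M & O *m u = v.
Proof.
move=> uv; have [->|neq] := eqVneq u v; first by exists 1%:M; rewrite ?trmx1 ?mul1mx.
pose w := u - v; pose c := sqn w.
have c0 : c != 0 by rewrite /c sqn_eq0 subr_eq0.
have ww : w^T *m w = c%:M by rewrite [LHS]mx11_scalar -sqnE.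
have wu : w^T *m u = (c / 2)%:M.
  rewrite [LHS]mx11_scalar -dotE; congr _%:M.
  by rewrite /c /w sqnB dotC dotBr dotuu -uv; field.
exists (1%:M - (2 / c) *: (w *m w^T)).
  rewrite (_ : (_ - _)^T = 1%:M - (2 / c) *: (w *m w^T)); last first.
    have: (w *m w^T)^T = w *m w^T by rewrite trmx_mul trmxK.
    move: (w *m w^T) => P PT; apply/matrixP => i j; rewrite -{2}PT !mxE eq_sym //.
  have : (w *m w^T) *m (w *m w^T) = c *: (w *m w^T).
    by rewrite mulmxA -(mulmxA w) ww mul_mx_scalar scalemxAl.
  move: (w *m w^T) => P PP.
  rewrite mulmxBl !mulmxBr mulmx1 mul1mx mulmx1 -scalemxAl -scalemxAr PP !scalerA.
  rewrite (_ : 2 / c * _ * c = 2 / c + 2 / c); last by field; exact: c0.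
  by rewrite scalerDl opprB addrK subrK.
rewrite mulmxBl mul1mx -scalemxAl -mulmxA wu mul_mx_scalar scalerA.
rewrite (_ : 2 / c * _ = 1) ?scale1r ?subKr//.
by move: c c0 {ww wu} => c' c0; field.
Qed.
End euclid.

(** * Integration against densities *)

Section density.
Context d (T : measurableType d) (R : realType).
Variables (mu nu : {measure set T -> \bar R}) (g : T -> R).
Hypotheses (mg : measurable_fun setT g) (g0 : forall x, 0 <= g x).
Hypothesis nuE : forall A, measurable A -> nu A = (\int[mu]_(x in A) (g x)%:E)%E.
Import HBNNSimple.

Lemma ge0_integral_density (f : T -> \bar R) : measurable_fun setT f -> (forall x, 0 <= f x)%E ->
  (\int[nu]_x f x = \int[mu]_x (f x * (g x)%:E))%E.
Proof.
move=> mf f0; pose f_ := nnsfun_approx measurableT mf.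
have mgE : measurable_fun setT (fun x => (g x)%:E) by exact/measurable_EFinP.
have hT m : (\int[nu]_x (f_ m x)%:E = \int[mu]_x ((f_ m x)%:E * (g x)%:E))%E.
  under [LHS]eq_integral do rewrite fimfunE -fsumEFin//.
  rewrite [LHS]ge0_integral_fsum//; last 2 first.
  - by move=> r; apply/measurable_EFinP; apply: measurableT_comp.
  - by move=> r x _; rewrite EFinM nnfun_muleindic_ge0.
  under [RHS]eq_integral => x _.
    rewrite fimfunE -fsumEFin// muleC ge0_mule_fsumr; last first.
      by move=> r; rewrite EFinM nnfun_muleindic_ge0.
    over.
  rewrite [RHS]ge0_integral_fsum//; last 2 first.
  - by move=> r; apply: emeasurable_funM => //; apply/measurable_EFinP; apply: measurableT_comp.
  - by move=> r x _; rewrite mule_ge0 ?lee_fin// -lee_fin EFinM nnfun_muleindic_ge0.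
  apply: eq_fsbigr => r _.
  have mr : measurable (f_ m @^-1` [set r]) by exact: measurable_sfunP.
  have [r0|r0] := ltP r 0.
    rewrite preimage_nnfun0// indic0.
    by under [RHS]eq_integral do rewrite mulr0 mule0; under eq_integral do rewrite mulr0; rewrite !integral0.
  under eq_integral do rewrite EFinM; rewrite ge0_integralZl//; last first.
    by apply/measurable_EFinP; exact: measurable_indic.
  under [RHS]eq_integral do rewrite EFinM muleCA; rewrite ge0_integralZl//; last 2 first.
    by apply: emeasurable_funM => //; apply/measurable_EFinP; exact: measurable_indic.
    by move=> x _; rewrite mule_ge0// lee_fin.
  congr (_ * _)%E; rewrite integral_indic// setIT nuE// integral_mkcond.
  apply: eq_integral => x _; rewrite patchE indicE; case: ifP => _; rewrite ?mule1 ?mule0//.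
transitivity (limn (fun m => \int[nu]_x (f_ m x)%:E))%E.
  rewrite -monotone_convergence//.
  - by apply: eq_integral => y _; apply/esym/cvg_lim => //; apply: cvg_nnsfun_approx.
  - by move=> m; exact/measurable_EFinP/measurable_funP.
  - by move=> m y _; rewrite lee_fin.
  - by move=> y _ m k mn; rewrite lee_fin; exact/lefP/nd_nnsfun_approx.
rewrite [X in limn X](_ : _ = (fun m => \int[mu]_x ((f_ m x)%:E * (g x)%:E))%E); last exact/funext.
rewrite -monotone_convergence//.
- apply: eq_integral => y _; apply/cvg_lim => //.
  have fy : (f_ k y)%:E @[k --> \oo] --> f y by apply: cvg_nnsfun_approx.
  apply: cvgeZr => //; exact: fy.
- by move=> m; apply: emeasurable_funM => //; exact/measurable_EFinP/measurable_funP.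
- by move=> m y _; rewrite mule_ge0// lee_fin.
- by move=> y _ m k mn; rewrite lee_pmul// lee_fin//; exact/lefP/nd_nnsfun_approx.
Qed.
End density.

Section rv_density.
Context d (T : measurableType d) (R : realType) (P : probability T R) (X : {RV P >-> R}).
Variables (g : R -> R).
Hypotheses (mg : measurable_fun setT g) (g0 : forall x, 0 <= g x).
Hypothesis XE : forall A : set R, measurable A -> distribution P X A = (\int[lebesgue_measure]_(x in A) (g x)%:E)%E.

Lemma ge0_integral_rv_density (f : R -> \bar R) : measurable_fun setT f -> (forall x, 0 <= f x)%E ->
  (\int[P]_w f (X w) = \int[lebesgue_measure]_x (f x * (g x)%:E))%E.
Proof.
move=> mf f0.
have mX : measurable_fun setT (X : T -> measurableTypeR R) by move=> mT A mA; exact: (@measurable_funPT _ _ _ _ X mT A mA).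
rewrite -(@ge0_integral_density _ (measurableTypeR R) R lebesgue_measure (image_measure P mX) g)//.
by rewrite ge0_integral_pushforward// preimage_setT.
Qed.
End rv_density.

(** * Exponential moments and Chernoff bounds for the Gaussian measure *)

Section gauss.
Variable R : realType.
Local Notation gamma := (normal_prob (0 : R) 1).

Lemma ge0_integral_normal (f : R -> \bar R) : measurable_fun setT f -> (forall x, 0 <= f x)%E ->
  (\int[gamma]_x f x = \int[lebesgue_measure]_x (f x * (normal_pdf 0 1 x)%:E))%E.
Proof.
move=> mf f0; apply: ge0_integral_density => //.
- exact: measurable_normal_pdf.
- by move=> x; exact: normal_pdf_ge0.
Qed.

(** Multiplying the standard density by [expR (x ^+ 2 / 4)] gives a multiple of the normal density
    of variance 2. This function is the common integrable majorant below. *)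
Lemma normal_integral_expR_sqr : exists2 K : R, 0 < K &
  (\int[gamma]_x (expR (x ^+ 2 / 4))%:E = K%:E)%E.
Proof.
pose s : R := Num.sqrt 2; have s0 : s != 0 by rewrite gt_eqF// sqrtr_gt0.
have p0 : 0 < normal_peak (1:R) by rewrite normal_peak_gt0// oner_eq0.
have ps0 : 0 < normal_peak s by rewrite normal_peak_gt0.
exists (normal_peak 1 / normal_peak s); first by rewrite divr_gt0.
have mE : measurable_fun setT (fun x : R => (expR (x ^+ 2 / 4))%:E).
  apply/measurable_EFinP/measurableT_comp => //.
  by apply: measurable_funM => //; exact: measurable_funX.
rewrite ge0_integral_normal//.
transitivity (\int[lebesgue_measure]_x ((normal_peak 1 / normal_peak s)%:E * (normal_pdf 0 s x)%:E))%E.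
  apply: eq_integral => x _; rewrite -!EFinM; congr EFin.
  rewrite !normal_pdfE ?oner_eq0// mulrCA [RHS](_ : _ = normal_peak 1 * normal_fun 0 s x); last by field; rewrite gt_eqF.
  congr (_ * _); rewrite /normal_fun subr0 -expRD sqr_sqrtr ?ler0n// expr1n; congr expR.
  by lra.
rewrite ge0_integralZl//.
- by rewrite integral_normal_pdf mule1.
- by apply/measurable_EFinP; exact: measurable_normal_pdf.
- by move=> x _; rewrite lee_fin normal_pdf_ge0.
- by rewrite lee_fin divr_ge0// ltW.
Qed.

Lemma normal_integrable_expR_sqr : gamma.-integrable setT (EFin \o (fun x => expR (x ^+ 2 / 4))).
Proof.
have [K K0 hK] := normal_integral_expR_sqr.
apply/integrableP; split.
  apply/measurable_EFinP/measurableT_comp => //.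
  by apply: measurable_funM => //; exact: measurable_funX.
under eq_integral do rewrite /= ger0_norm ?expR_ge0//.
by rewrite hK ltry.
Qed.

Lemma normal_integrable_le (f : R -> R) (C : R) : measurable_fun setT f ->
  (forall x, `|f x| <= C * expR (x ^+ 2 / 4)) -> gamma.-integrable setT (EFin \o f).
Proof.
move=> mf hf; apply: (@le_integrable _ (measurableTypeR R) R gamma setT measurableT (EFin \o f) (fun x => (C%:E * (expR (x ^+ 2 / 4))%:E)%E)).
- exact/measurable_EFinP.
- move=> x _; rewrite -EFinM !abse_EFin lee_fin; apply: le_trans (hf x) _; exact: ler_norm.
- by apply: integrableZl => //; exact: normal_integrable_expR_sqr.
Qed.

Lemma normal_integrable_sqr (f : R -> R) (C : R) : measurable_fun setT f ->
  (forall x, `|f x| <= C * (1 + x ^+ 2)) -> gamma.-integrable setT (EFin \o f).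
Proof.
move=> mf hf; apply: (@normal_integrable_le _ (C * 4)) => // x; apply: le_trans (hf x) _.
have C0 : 0 <= C.
  have := le_trans (normr_ge0 _) (hf 0); rewrite expr0n addr0 mulr1; exact.
rewrite -mulrA ler_wpM2l//; have := expR_ge1Dx (x ^+ 2 / 4); lra.
Qed.

(** A second order Taylor bound valid on the whole line, so that it can be integrated. *)
Lemma expR_le_quad (y : R) : expR y <= 1 + y + y ^+ 2 * expR `|y|.
Proof.
have [y0|y0] := leP 0 y.
  rewrite ger0_norm//; have e0 := expR_gt0 y; have := expR_ge1Dx (- y); rewrite expRN => h.
  have h1 : expR y - 1 <= y * expR y.
    have : (1 - y) * expR y <= 1 by rewrite -ler_pdivlMr// div1r.
    lra.
  have := ler_wpM2l y0 h1; rewrite expr2; lra.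
rewrite ltr0_norm//; set t := - y; have t0 : 0 < t by rewrite oppr_gt0.
have -> : y = - t by rewrite opprK.
have ht := expR_ge1Dx t; rewrite expRN sqrrN.
have e0 := expR_gt0 t.
have h1 : (expR t)^-1 <= (1 + t)^-1 by rewrite lef_pV2 ?posrE//; lra.
apply: le_trans h1 _; rewrite -[leLHS]mul1r ler_pdivrMr; last lra.
have : 1 * t ^+ 2 <= expR t * t ^+ 2 by rewrite ler_wpM2r ?sqr_ge0//; lra.
have : 0 <= t ^+ 2 by exact: sqr_ge0.
have : 0 <= t * (t ^+ 2 * expR t) by rewrite !mulr_ge0 ?sqr_ge0// ltW.
rewrite mulrDr !mulrDl; nra.
Qed.

(** The integral is [1 - l e + O(l^2)], since the centred part of [H] integrates to 0; a small [l]
    makes it less than 1. *)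
Lemma exists_small_mgf (H : R -> R) (C m e : R) : measurable_fun setT H ->
  (forall x, `|H x| <= C * (1 + x ^+ 2)) -> (\int[gamma]_x (H x)%:E = m%:E)%E -> 0 < e ->
  exists l c : R, [/\ 0 < l, 0 <= c < 1 &
    (\int[gamma]_x (expR (l * (H x - m - e)))%:E <= c%:E)%E].
Proof.
move=> mH hH Hm e0; have [K K0 hK] := normal_integral_expR_sqr.
have C0 : 0 <= C.
  have := le_trans (normr_ge0 _) (hH 0); rewrite expr0n addr0 mulr1; exact.
pose C' := C + `|m| + e; have C'0 : 0 < C' by rewrite ltr_wpDl// addr_ge0.
have hH' x : `|H x - m - e| <= C' * (1 + x ^+ 2).
  apply: (@le_trans _ _ (`|H x| + `|m| + e)).
    by apply: le_trans (ler_normB _ _) _; rewrite (gtr0_norm e0) lerD2r ler_normB.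
  have : 0 <= (`|m| + e) * x ^+ 2 by rewrite mulr_ge0 ?sqr_ge0// addr_ge0// ltW.
  by have := hH x; rewrite /C'; lra.
(* [y^2 / 2 <= expR y] at [y = (1 + x^2) / 8] produces the 128, and [expR (1 / 4)] is the constant
   factor of [expR ((1 + x^2) / 4)]. *)
pose K' := C' ^+ 2 * 128 * expR (1 / 4) * K.
have K'0 : 0 < K' by rewrite !mulr_gt0 ?expR_gt0// exprn_gt0.
(* The three bounds keep the exponent below [(1 + x^2) / 8], the quadratic term below [l e / 2], and
   the constant [1 - l e / 2] nonnegative. *)
pose l := Num.min (1 / (8 * C')) (Num.min (e / (2 * K')) (1 / e)).
have l0 : 0 < l by rewrite !lt_min !divr_gt0// mulr_gt0.
have l1 : l * C' <= 1 / 8.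
  apply: (@le_trans _ _ (1 / (8 * C') * C')); first by rewrite ler_wpM2r ?ge_min ?lexx// ltW.
  by rewrite le_eqVlt; apply/orP; left; apply/eqP; field; rewrite gt_eqF.
have l2 : l * K' <= e / 2.
  apply: (@le_trans _ _ (e / (2 * K') * K')); first by rewrite ler_wpM2r ?ge_min ?lexx ?orbT// ltW.
  by rewrite le_eqVlt; apply/orP; left; apply/eqP; field; rewrite gt_eqF.
have l3 : l * e <= 1.
  apply: (@le_trans _ _ (1 / e * e)); first by rewrite ler_wpM2r ?ge_min ?lexx ?orbT// ltW.
  by rewrite mul1r mulVf// gt_eqF.
exists l, (1 - l * e / 2); split => //.
  apply/andP; split; last by rewrite ltrBlDr ltrDl divr_gt0// mulr_gt0.
  by rewrite subr_ge0 ler_pdivrMr//; lra.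
have hexp x : l * `|H x - m - e| <= (1 + x ^+ 2) / 8.
  apply: (@le_trans _ _ (l * (C' * (1 + x ^+ 2)))); first by rewrite ler_wpM2l// ltW.
  rewrite mulrA [leRHS]mulrC ler_wpM2r ?addr_ge0 ?sqr_ge0//.
  by rewrite -[8^-1]mul1r.
have pt x : expR (l * (H x - m - e)) <= 1 + l * (H x - m - e) + l ^+ 2 * K' / K * expR (x ^+ 2 / 4).
  apply: le_trans (expR_le_quad _) _; rewrite lerD2l exprMn.
  have -> : l ^+ 2 * K' / K * expR (x ^+ 2 / 4) = l ^+ 2 * (C' ^+ 2 * 128 * expR ((1 + x ^+ 2) / 4)).
    by rewrite /K' mulrDl expRD; field; rewrite gt_eqF.
  rewrite -[leLHS]mulrA ler_wpM2l ?sqr_ge0//.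
  have x0 : 0 <= 1 + x ^+ 2 by rewrite addr_ge0// sqr_ge0.
  have h1 : (H x - m - e) ^+ 2 <= C' ^+ 2 * (1 + x ^+ 2) ^+ 2.
    by rewrite -exprMn -real_normK ?num_real// lerXn2r ?nnegrE// mulr_ge0// ltW.
  have h2 : expR `|l * (H x - m - e)| <= expR ((1 + x ^+ 2) / 8).
    by rewrite ler_expR normrM (gtr0_norm l0).
  have h3 : (1 + x ^+ 2) ^+ 2 <= 128 * expR ((1 + x ^+ 2) / 8).
    have := @expR_ge1Dxn R ((1 + x ^+ 2) / 8) 1 (divr_ge0 x0 _); rewrite expr_div_n => /(_ (ler0n _ _)) /= h.
    have : (2`! : nat)%:R = 2 :> R by []. move=> h2'; rewrite h2' in h.
    by set t := (1 + x ^+ 2) ^+ 2 in h *; lra.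
  apply: (@le_trans _ _ (C' ^+ 2 * (128 * expR ((1 + x ^+ 2) / 8)) * expR ((1 + x ^+ 2) / 8))).
    apply: ler_pM => //; rewrite ?sqr_ge0 ?expR_ge0//.
    by apply: le_trans h1 _; rewrite ler_wpM2l// sqr_ge0.
  rewrite -!mulrA -expRD; have -> : (1 + x ^+ 2) / 8 + (1 + x ^+ 2) / 8 = (1 + x ^+ 2) / 4 by field.
  by [].
have iH : gamma.-integrable setT (EFin \o H) by exact: normal_integrable_sqr hH.
have i1 (c : R) : gamma.-integrable setT (cst c%:E) by apply: finite_measure_integrable_cst.
have iq := normal_integrable_expR_sqr.
have iH' := integrableZl measurableT l iH.
have iq' := integrableZl measurableT (l ^+ 2 * K' / K) iq.
have iD := integrableD measurableT (i1 (1 - l * (m + e))) iH'.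
have iD2 := integrableD measurableT iD iq'.
apply: (@le_trans _ _ (\int[gamma]_x ((1 - l * (m + e))%:E + l%:E * (H x)%:E + (l ^+ 2 * K' / K)%:E * (expR (x ^+ 2 / 4))%:E)))%E.
  apply: le_integral => //.
    apply: (@normal_integrable_le _ (expR (1 / 8))).
      apply: measurableT_comp => //; apply: measurable_funM => //.
      by apply: measurable_funB => //; apply: measurable_funB.
    move=> x; rewrite ger0_norm ?expR_ge0// -expRD ler_expR.
    apply: le_trans (ler_norm _) _; rewrite normrM (gtr0_norm l0); apply: le_trans (hexp x) _.
    by have := sqr_ge0 x; lra.
  by move=> x _; rewrite -!EFinM -!EFinD lee_fin; apply: le_trans (pt x) _; rewrite lerD2r; lra.
rewrite (integralD measurableT iD iq') (integralD measurableT (i1 (1 - l * (m + e))) iH').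
rewrite integral_cst// [X in (_ * X)%E]probability_setT mule1 (integralZl _ iH)// Hm (integralZl _ iq)// hK.
rewrite -!EFinM -!EFinD lee_fin divfK ?gt_eqF//.
have : l ^+ 2 * K' <= l * (e / 2) by rewrite expr2 -mulrA ler_wpM2l// ltW.
lra.
Qed.

(** Markov's inequality with a product as test function: its Gaussian integral factorizes into [n]
    equal integrals. *)
Lemma gauss_chernoff n (h : R -> R) (c : R) (D : set (borel 'cV[R]_n)) : measurable_fun setT h ->
  (forall x, 0 <= h x) -> (\int[gamma]_x (h x)%:E <= c%:E)%E -> measurable D ->
  (forall G, D G -> 1 <= \prod_i h (G i ord0)) ->
  (\int[volm R n]_G (\1_D G * gaussd G)%:E <= (c ^+ n)%:E)%E.
Proof.
move=> mh h0 hc mD hD.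
have hI0 : (0 <= \int[gamma]_x (h x)%:E)%E by apply: integral_ge0 => x _; rewrite lee_fin.
have [c' hc'] : exists c', (\int[gamma]_x (h x)%:E = c'%:E)%E.
  by exists (fine (\int[gamma]_x (h x)%:E)); rewrite fineK// ge0_fin_numE// (le_lt_trans hc) ?ltry.
have c'c : c' <= c by rewrite -lee_fin -hc'.
have c'0 : 0 <= c' by rewrite -lee_fin -hc'.
apply: (@le_trans _ _ (\int[volm R n]_G (\prod_i (h (G i ord0) * normal_pdf 0 1 (G i ord0)))%:E)%E).
  apply: ge0_le_integral => //.
  - by move=> G _; rewrite lee_fin mulr_ge0 ?gaussd_ge0// indicE.
  - by apply/measurable_EFinP; apply: measurable_funM; [exact: measurable_indic|exact: measurable_gaussd].
  - apply/measurable_EFinP; apply: (measurable_prod_coord (h := fun _ x => h x * normal_pdf 0 1 x)) => _.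
    by apply: measurable_funM => //; exact: measurable_normal_pdf.
  move=> G _; rewrite lee_fin big_split /= -[X in _ <= _ * X]/(gaussd _) ler_wpM2r ?gaussd_ge0//.
  by rewrite indicE; case: (boolP (_ \in _)) => [/set_mem /hD//|_]; apply: prodr_ge0.
rewrite (integral_volm_prod (h := fun _ x => h x * normal_pdf 0 1 x) (c := fun _ => c')).
- by rewrite prodr_const card_ord lee_fin lerXn2r// nnegrE (le_trans c'0).
- by move=> _; apply: measurable_funM => //; exact: measurable_normal_pdf.
- by move=> _ x; rewrite mulr_ge0// normal_pdf_ge0.
- move=> _; rewrite -hc' ge0_integral_normal//; last exact/measurable_EFinP.
Qed.
End gauss.

Section origin.
Context (R : realType) (n : nat).

Lemma measurable_origin : measurable ([set 0] : set (borel 'cV[R]_n)).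
Proof.
rewrite (_ : [set 0] = [set G : borel 'cV[R]_n | sqn G <= 0]).
  by apply: measurable_ler => //; apply: measurable_sqn; exact: measurable_id.
apply/seteqP; split => G /=; first by move->; rewrite /sqn big1// => i _; rewrite mxE expr0n.
by move=> h; apply/eqP; rewrite -sqn_eq0 eq_le h sqn_ge0.
Qed.

(** The previous bound with the indicator of 0, whose mean vanishes, and [0 ^+ n = 0]. The origin
    has no direction and must be discarded in the comparison with Haar measure. *)
Lemma gaussd_origin : (0 < n)%N ->
  (\int[volm R n]_G (\1_[set (0 : 'cV[R]_n)] G * gaussd G)%:E = 0)%E.
Proof.
move=> n0; apply/eqP; rewrite eq_le; apply/andP; split; last first.
  by apply: integral_ge0 => G _; rewrite lee_fin mulr_ge0 ?gaussd_ge0// indicE.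
rewrite -[leRHS](_ : ((0 : R) ^+ n)%:E = _)%E; last by rewrite expr0n eqn0Ngt n0.
apply: (@gauss_chernoff R n \1_[set 0]) => //.
- rewrite integral_indic// setIT le_eqVlt; apply/orP; left; apply/eqP.
  apply: (@normal_prob_dominates R 0 1 [set 0]) => // A mA A0.
  apply/eqP; rewrite eq_le measure_ge0 andbT -(lebesgue_measure_set1 (0 : R)).
  by apply: le_measure; rewrite ?inE.
- exact: measurable_origin.
- by move=> G ->; rewrite big1// => i _; rewrite indicE mem_set// mxE.
Qed.
End origin.

(** * Transfer of events from Haar measure to the Gaussian measure *)

Section haar.
Variables (R : realType) (n k : nat) (kn : (k <= n)%N).
Local Notation St := (borel (stiefel R kn)).
Local Notation V := (borel 'cV[R]_n).

Lemma stiefel_isometry (a : stiefel R kn) : (stiefel_mx kn a)^T *m stiefel_mx kn a = 1%:M.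
Proof. exact: (set_mem (valP a)). Qed.

Lemma measurable_stiefel_mul (w : 'cV[R]_k) :
  measurable_fun setT (fun a : St => stiefel_mx kn a *m w : V).
Proof.
apply: measurable_cV => i; under eq_fun do rewrite mxE.
apply: measurable_sum => j; apply: measurable_funM => //.
apply: continuous_borel_real => a.
apply: (@continuous_comp _ _ _ (stiefel_mx kn) (fun M : 'M[R]_(n, k) => M i j)).
  exact: (@initial_continuous (set_type [set A : 'M[R]_(n, k) | A^T *m A = 1%:M]) 'M[R]_(n, k) set_val).
exact: coord_continuous.
Qed.

Variables (theta : 'cV[R]_k) (eta : R).
Hypotheses (theta1 : sqn theta = 1) (eta0 : 0 < eta).
Local Notation U a := (stiefel_mx kn a *m theta).

Lemma sqn_stiefel_mul (a : stiefel R kn) (w : 'cV[R]_k) : sqn (stiefel_mx kn a *m w) = sqn w.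
Proof. exact/sqn_isometry/stiefel_isometry. Qed.

(** For a unit vector [v], the direction of [G] is within [eta] of [v]. Both sides are multiplied by
    the squared norm of [G], which avoids a division, and the strict inequality excludes [G = 0]. *)
Definition aligned (v G : 'cV[R]_n) : bool :=
  sqn (G - enorm G *: v) < eta ^+ 2 * sqn G.

Lemma aligned_isometry (O : 'M[R]_n) v G : O^T *m O = 1%:M -> aligned (O *m v) (O *m G) = aligned v G.
Proof.
move=> OO; rewrite /aligned /enorm !(sqn_isometry G OO).
by rewrite scalemxAr -mulmxBr (sqn_isometry _ OO).
Qed.

Lemma alignedZ v G c : 0 < c -> aligned v (c *: G) = aligned v G.
Proof.
move=> c0; rewrite /aligned enormZ gtr0_norm// -scalerA -scalerBr !sqnZ.
by rewrite mulrCA ltr_pM2l// exprn_gt0.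
Qed.

Lemma measurable_aligned d (X : measurableType d) (f g : X -> V) :
  measurable_fun setT f -> measurable_fun setT g -> measurable [set x | aligned (f x) (g x)].
Proof.
move=> mf mg.
apply: measurable_ltr; last by apply: measurable_funM => //; exact: measurable_sqn.
apply: (measurable_sqn (f := fun x => (g x : 'cV_n) - enorm (g x : 'cV_n) *: (f x : 'cV_n) : V)).
apply: measurable_cV => i; under eq_fun do rewrite mxE [X in _ + X]mxE [X in - X]mxE.
apply: measurable_funB; first exact: measurable_coord.
apply: measurable_funM; last exact: measurable_coord.
apply: (measurableT_comp (f := @Num.sqrt R)); last exact: measurable_sqn.
by apply: continuous_measurable_fun; exact: sqrt_continuous.
Qed.

Variable mu : probability St R.
Hypotheses (mu_haar : is_haar mu) (n_gt0 : (0 < n)%N).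

Local Notation ker z := ((aligned (U z.1) (z.2 : 'cV_n))%:R : R).
Local Notation kint a := (\int[volm R n]_G ((aligned (U a) G)%:R * gaussd G)%:E)%E.

Lemma measurable_aligned_gaussd v :
  measurable_fun setT (fun G : V => ((aligned v G)%:R * gaussd G)).
Proof.
apply: measurable_funM; last exact: measurable_gaussd.
have m1 := @measurable_aligned _ V (cst v) id (measurable_cst _) (@measurable_id _ _ _).
rewrite (_ : (fun _ => _) = \1_[set G : V | aligned v G]); first exact: measurable_indic.
by apply/funext => G; rewrite indicE mem_setE.
Qed.

Lemma aligned_gaussd_ge0 v G : 0 <= (aligned v G)%:R * gaussd G.
Proof. by rewrite mulr_ge0// gaussd_ge0. Qed.

Lemma kint_const (a a' : stiefel R kn) : kint a = kint a'.
Proof.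
have [Q QQ QU] : exists2 Q : 'M[R]_n, Q^T *m Q = 1%:M & Q *m U a = U a'.
  by apply: householder; rewrite !sqn_stiefel_mul.
rewrite -[RHS](ge0_integral_volm_rotate QQ).
- apply: eq_integral => G _; rewrite -QU aligned_isometry//.
  by rewrite !gaussdE (sqn_isometry _ QQ).
- by apply/measurable_EFinP; exact: measurable_aligned_gaussd.
- by move=> G; rewrite lee_fin aligned_gaussd_ge0.
Qed.

(** Only directions matter, and some orthogonal [Q] carries one to the other; left multiplication of
    the frame by [Q] preserves [mu]. *)
Lemma haar_aligned_const (G G' : 'cV[R]_n) : 0 < sqn G -> 0 < sqn G' ->
  mu [set a | aligned (U a) G] = mu [set a | aligned (U a) G'].
Proof.
move=> G0 G'0; have eG : 0 < enorm G by rewrite sqrtr_gt0.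
have eG' : 0 < enorm G' by rewrite sqrtr_gt0.
have [Q QQ QG] : exists2 Q : 'M[R]_n, Q^T *m Q = 1%:M & Q *m ((enorm G)^-1 *: G) = (enorm G')^-1 *: G'.
  by apply: householder; rewrite !sqnZ -!enorm_sqr -!exprMn !mulVf ?gt_eqF// !expr1n.
pose Q' : stiefel R (leqnn n) := exist _ Q (mem_set QQ).
rewrite -(mu_haar Q' (B := [set a | aligned (U a) G'])); last first.
  by apply: measurable_aligned; [exact: measurable_stiefel_mul|exact: measurable_cst].
congr (mu _); apply/seteqP; split => a /=;
  rewrite [stiefel_mx kn (stiefel_mul Q' a)](_ : _ = Q *m stiefel_mx kn a)// -mulmxA -(@alignedZ _ G' (enorm G')^-1) ?invr_gt0// -QG aligned_isometry// alignedZ ?invr_gt0//.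
Qed.

(** A product set on which [aligned] holds: the integral over it factorizes, which is how the
    Gaussian mass of [aligned] is shown to be positive. *)
Lemma aligned_box (v : 'cV[R]_n) : sqn v = 1 -> exists2 d : R, 0 < d &
  forall G : 'cV[R]_n, (forall i, `|G i ord0 - v i ord0| <= d) -> aligned v G /\ sqn G <= 4.
Proof.
move=> v1; have ev : enorm v = 1 by rewrite /enorm v1 sqrtr1.
pose N : R := n%:R; have N1 : 1 <= N by rewrite ler1n.
(* Half-width [e / n] bounds the Euclidean distance to [v] by [e]; normalizing costs another [e],
   and [2 e < eta (1 - e)]. *)
pose e := Num.min 1 eta / 8.
have e0 : 0 < e by rewrite divr_gt0// lt_min ltr01.
have e1 : e <= 1 / 8 by rewrite ler_pM2r ?invr_gt0// ge_min lexx.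
have ee : e <= eta / 8 by rewrite ler_pM2r ?invr_gt0// ge_min lexx orbT.
exists (e / N) => [|G hG]; first by rewrite divr_gt0// (lt_le_trans ltr01).
have hs : sqn (G - v) <= e ^+ 2.
  apply: (@le_trans _ _ (\sum_(i < n) (e / N) ^+ 2)).
    apply: ler_sum => i _; rewrite !mxE -real_normK ?num_real// lerXn2r ?nnegrE//.
    by rewrite divr_ge0 ?ltW// (lt_le_trans ltr01).
  rewrite sumr_const card_ord -mulr_natl -/N expr_div_n.
  have -> : N * (e ^+ 2 / N ^+ 2) = e ^+ 2 / N by field; rewrite gt_eqF// (lt_le_trans ltr01).
  by rewrite ler_pdivrMr ?(lt_le_trans ltr01)// ler_peMr ?sqr_ge0.
have hd : enorm (G - v) <= e.
  by rewrite -[leRHS](ger0_norm (ltW e0)) -sqrtr_sqr ler_wsqrtr.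
have h1 : enorm G <= 1 + e by rewrite -[G](subrK v) addrC -ev; apply: le_trans (ler_enormD _ _) _; rewrite lerD2l.
have h2 : 1 - e <= enorm G.
  rewrite lerBlDr -ev -{1}[v](subrK G) addrC; apply: le_trans (ler_enormD _ _) _.
  by rewrite lerD2l -enormN opprB.
have h3 : enorm (G - enorm G *: v) <= e + e.
  have -> : G - enorm G *: v = (G - v) + (1 - enorm G) *: v by rewrite scalerBl scale1r addrA subrK.
  apply: le_trans (ler_enormD _ _) _; rewrite enormZ ev mulr1; apply: lerD => //.
  by rewrite ler_norml; apply/andP; split; lra.
have g0 := enorm_ge0 G; split; last by rewrite -enorm_sqr; nra.
rewrite /aligned -!enorm_sqr -exprMn ltrXn2r ?nnegrE ?enorm_ge0 ?mulr_ge0 ?ltW//.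
by apply: le_lt_trans h3 _; nra.
Qed.

Lemma kint_gt0 (a : stiefel R kn) : (0 < kint a)%E.
Proof.
have [d d0 hd] := aligned_box (etrans (sqn_stiefel_mul a theta) theta1).
pose B i := \1_(`[(U a) i ord0 - d, (U a) i ord0 + d]%classic) : R -> R.
(* A lower bound for the Gaussian density on the box, where [sqn y <= 4]. *)
pose m := normal_peak 1 ^+ n * expR (- 2) : R.
have m0 : 0 < m by rewrite mulr_gt0 ?expR_gt0// exprn_gt0// normal_peak_gt0 ?oner_eq0.
have : (\int[volm R n]_y (\prod_i B i (y i ord0))%:E = (\prod_(i < n) (2 * d))%:E)%E.
  apply: integral_volm_prod.
  - by move=> i; exact: measurable_indic.
  - by move=> i x; rewrite /B indicE.
  - move=> i; transitivity (lebesgue_measure (`[((U a) i ord0 - d)%R, ((U a) i ord0 + d)%R]%classic : set R)).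
      by rewrite integral_indic// setIT.
    rewrite lebesgue_measure_itv /= lte_fin ifT; last lra.
    by rewrite -EFinD; congr EFin; ring.
move=> hB; apply: (@lt_le_trans _ _ (m%:E * (\prod_(i < n) (2 * d))%:E)%E).
  by rewrite -EFinM lte_fin mulr_gt0// prodr_gt0// => i _; rewrite mulr_gt0.
have Bge0 y : 0 <= \prod_i B i ((y : 'cV[R]_n) i ord0) by apply: prodr_ge0 => i _; rewrite /B indicE.
have mB : measurable_fun setT (fun y : V => (\prod_i B i (y i ord0))%:E).
  by apply/measurable_EFinP; apply: measurable_prod_coord => i; exact: measurable_indic.
rewrite -hB -ge0_integralZl//; last 2 first.
- by move=> y _; rewrite lee_fin.
- by rewrite lee_fin ltW.
apply: ge0_le_integral => //.
- by move=> y _; rewrite -EFinM lee_fin mulr_ge0// ltW.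
- by apply: emeasurable_funM.
- by apply/measurable_EFinP; exact: measurable_aligned_gaussd.
move=> y _; rewrite -EFinM lee_fin.
have [h|h] := pselect (forall i, `|(y : 'cV_n) i ord0 - (U a) i ord0| <= d); last first.
  have [i hi] : exists i, B i (y i ord0) = 0.
    apply: contrapT => hn; apply: h => i; apply: contrapT => hi; apply: hn; exists i.
    rewrite /B indicE; case: (boolP (_ \in _)) => //; rewrite inE /= in_itv /= => hy; exfalso; apply: hi.
    by rewrite ler_distlC; case/andP: hy => *; apply/andP; split; lra.
  by rewrite (bigD1 i)//= hi mul0r mulr0 aligned_gaussd_ge0.
have [-> hs] := hd _ h; rewrite mul1r (_ : \prod_i _ = 1) ?mulr1; last first.
  apply: big1 => i _; rewrite /B indicE mem_set//= in_itv /=.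
  by have := h i; rewrite ler_norml => /andP[? ?]; apply/andP; split; lra.
rewrite gaussdE /m ler_wpM2l ?ler_expR//; last by rewrite lerN2 ler_pdivrMr//; lra.
by rewrite exprn_ge0// normal_peak_ge0.
Qed.

(* The masses of [aligned] under [mu] and under the Gaussian measure are constant in the
   other variable, by invariance, hence equal by Fubini; integrate the indicator of
   [B x setT] intersected with [aligned]. *)
Lemma haar_le_gauss (B : set St) (D : set V) : measurable B -> measurable D ->
  (forall a G, B a -> aligned (U a) G -> D G) ->
  (mu B <= \int[volm R n]_G (\1_D G * gaussd G)%:E)%E.
Proof.
move=> mB mD BD.
pose kg := fun z : St * V => (ker z * gaussd (z.2 : 'cV_n))%:E.
pose Bkg := fun z : St * V => (\1_B z.1 * (ker z * gaussd (z.2 : 'cV_n)))%:E.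
pose a0 : stiefel R kn := point.
have U01 : 0 < sqn (U a0) by rewrite sqn_stiefel_mul theta1.
pose c2 : \bar R := mu [set a | aligned (U a) (U a0)].
have mcl : measurable [set z : St * V | aligned (U z.1) (z.2 : 'cV_n)].
  apply: measurable_aligned; last exact: measurable_snd.
  exact: (measurableT_comp (measurable_stiefel_mul theta) measurable_fst).
have mclf : measurable_fun setT (fun z : St * V => ker z).
  rewrite (_ : (fun _ => _) = \1_[set z : St * V | aligned (U z.1) (z.2 : 'cV_n)]); first exact: measurable_indic.
  by apply/funext => z; rewrite indicE mem_setE.
have mg : measurable_fun setT (fun z : St * V => gaussd (z.2 : 'cV_n)).
  exact: (measurableT_comp (@measurable_gaussd R n) measurable_snd).
have mc2 (G : 'cV[R]_n) : (\int[mu]_a ((aligned (U a) G)%:R)%:E = mu [set a | aligned (U a) G])%E.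
  rewrite -(setIT [set a | aligned (U a) G]) -integral_indic//.
    by apply: eq_integral => a _; rewrite indicE mem_setE.
  by apply: measurable_aligned; [exact: measurable_stiefel_mul|exact: measurable_cst].
have mg0 : measurable_fun setT (fun G : V => (\1_[set 0%R] (G : 'cV_n) * gaussd G)%:E).
  apply/measurable_EFinP; apply: measurable_funM; last exact: measurable_gaussd.
  by apply: measurable_indic; exact: measurable_origin.
have c2_le (G : 'cV[R]_n) : (mu [set a | aligned (U a) G] <= c2)%E.
  have [G0|] := ltP 0 (sqn G); first by rewrite (haar_aligned_const G0 U01).
  move=> G0; have {}G0 : sqn G = 0 by apply/eqP; rewrite eq_le G0 sqn_ge0.
  rewrite (_ : [set a | aligned (U a) G] = set0) ?measure0 ?measure_ge0//.
  by apply/seteqP; split => a //=; rewrite /aligned G0 mulr0 ltNge sqn_ge0.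
have c2_0 : (0 <= c2)%E by exact: measure_ge0.
have c2fin : c2 \is a fin_num by apply: fin_num_measure; apply: measurable_aligned; [exact: measurable_stiefel_mul|exact: measurable_cst].
have hprod := @gaussd_origin R n n_gt0.
have msec (G : 'cV[R]_n) : measurable_fun setT (fun a : St => ((aligned (U a) G)%:R : R)%:E).
  by apply/measurable_EFinP; exact: (measurableT_comp mclf (measurable_pair2 (G : V))).
have inner (G : 'cV[R]_n) : (\int[mu]_a ((aligned (U a) G)%:R * gaussd G)%:E = (gaussd G)%:E * mu [set a | aligned (U a) G])%E.
  under eq_integral do rewrite mulrC EFinM.
  by rewrite ge0_integralZl// ?mc2// ?lee_fin ?gaussd_ge0// => a _; rewrite lee_fin.
have mF : measurable_fun setT kg.
  by apply/measurable_EFinP; apply: measurable_funM.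
have minner : measurable_fun setT (fun G : V => ((gaussd G)%:E * mu [set a | aligned (U a) G])%E).
  under eq_fun do rewrite -inner.
  apply: (measurable_fun_fubini_tonelli_G (m1 := mu) kg) => // z; rewrite lee_fin ?aligned_gaussd_ge0// mulr_ge0 ?aligned_gaussd_ge0// indicE.
have mgG : measurable_fun setT (fun G : V => (gaussd G)%:E).
  by apply/measurable_EFinP; exact: measurable_gaussd.
(* Each of the two masses equals the total mass of [aligned] under the product measure, as [mu] and
   the Gaussian measure have mass 1. *)
have kc : (c2 = kint a0)%E.
  transitivity (\int[mu]_a kint a)%E; last first.
    under eq_integral do rewrite (kint_const _ a0).
    by rewrite integral_cst// [X in (_ * X)%E]probability_setT mule1.
  rewrite (fubini_tonelli (m1 := mu) (m2 := volm R n) kg)//; last first.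
    by move=> z; rewrite lee_fin aligned_gaussd_ge0.
  under eq_integral do rewrite inner.
  (* The added term has integral 0; it restores the value [c2] at [G = 0], where [aligned] fails. *)
  transitivity (\int[volm R n]_G ((gaussd G)%:E * mu [set a | aligned (U a) G] + c2 * (\1_[set 0%R] (G : 'cV_n) * gaussd G)%:E))%E; last first.
    rewrite ge0_integralD//.
    - rewrite ge0_integralZl//; first by rewrite hprod mule0 adde0.
      by move=> G _; rewrite lee_fin mulr_ge0 ?gaussd_ge0// indicE.
    - by move=> G _; rewrite mule_ge0// lee_fin gaussd_ge0.
    - by move=> G _; rewrite mule_ge0// lee_fin mulr_ge0 ?gaussd_ge0// indicE.
    - exact: emeasurable_funM.
  transitivity (\int[volm R n]_G (c2 * (gaussd G)%:E))%E.
    by rewrite ge0_integralZl// ?integral_gaussd ?mule1// => G _; rewrite lee_fin gaussd_ge0.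
  apply: eq_integral => G _; have [G0|] := ltP 0 (sqn G).
    rewrite (haar_aligned_const G0 U01) indicE memNset ?mul0r ?mule0 ?adde0 1?muleC//.
    by move=> /= h; move: G0; rewrite lt_neqAle eq_sym sqn_eq0 h eqxx.
  move=> G0; have {}G0 : sqn G = 0 by apply/eqP; rewrite eq_le G0 sqn_ge0.
  rewrite (_ : [set a | _] = set0); last by apply/seteqP; split => a //=; rewrite /aligned G0 mulr0 ltNge sqn_ge0.
  rewrite measure0 mule0 add0e indicE mem_set ?mul1r//=.
  by apply/eqP; rewrite -sqn_eq0 G0.
have kfin : kint a0 \is a fin_num by rewrite -kc.
(* Multiplied by the common positive mass, the left side becomes the double integral over [B] and
   [aligned]. In the other order it is at most the mass of [D] times [c2], as [B] and [aligned]
   force [D]. *)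
rewrite -(@lee_pmul2r _ (kint a0)) ?kint_gt0//.
have mF2 : measurable_fun setT Bkg.
  apply/measurable_EFinP; apply: measurable_funM; last by apply/measurable_EFinP.
  by apply: (measurableT_comp (f := \1_B : St -> R)) => //; exact: measurable_indic.
have -> : (mu B * kint a0 = \int[mu]_a \int[volm R n]_G (\1_B a * ((aligned (U a) G)%:R * gaussd G))%:E)%E.
  transitivity (\int[mu]_a ((\1_B a)%:E * kint a0))%E.
    rewrite ge0_integralZr//; last 2 first.
    - by apply/measurable_EFinP; exact: measurable_indic.
    - by apply: integral_ge0 => G _; rewrite lee_fin aligned_gaussd_ge0.
    by rewrite integral_indic// setIT.
  apply: eq_integral => a _; rewrite (kint_const a0 a).
  under [RHS]eq_integral do rewrite EFinM.
  rewrite ge0_integralZl//.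
  - by apply/measurable_EFinP; exact: measurable_aligned_gaussd.
  - by move=> G _; rewrite lee_fin aligned_gaussd_ge0.
rewrite (fubini_tonelli (m1 := mu) (m2 := volm R n) Bkg)//; last first.
  by move=> z; rewrite lee_fin mulr_ge0 ?aligned_gaussd_ge0// indicE.
have mDg : measurable_fun setT (fun G : V => (\1_D G * gaussd G)%:E).
  by apply/measurable_EFinP; apply: measurable_funM; [exact: measurable_indic|exact: measurable_gaussd].
have Dg0 (G : V) : (0 <= (\1_D G * gaussd G)%:E)%E.
  by rewrite lee_fin mulr_ge0 ?gaussd_ge0// indicE.
rewrite -kc -ge0_integralZr//.
apply: ge0_le_integral => //.
- by move=> G _; apply: integral_ge0 => a _; rewrite lee_fin mulr_ge0 ?aligned_gaussd_ge0// indicE.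
- apply: (measurable_fun_fubini_tonelli_G (m1 := mu) Bkg) => // z; rewrite lee_fin ?aligned_gaussd_ge0// mulr_ge0 ?aligned_gaussd_ge0// indicE.
- exact: emeasurable_funM.
move=> G _; apply: (@le_trans _ _ (\int[mu]_a ((\1_D G * gaussd G)%:E * ((aligned (U a) G)%:R)%:E)))%E.
  apply: ge0_le_integral => //.
  - by move=> a _; rewrite lee_fin mulr_ge0 ?aligned_gaussd_ge0// indicE.
  - exact: (measurableT_comp mF2 (measurable_pair2 (G : V))).
  - exact: emeasurable_funM.
  move=> a _; rewrite -EFinM lee_fin.
  have [Ba|nB] := pselect (B a); last first.
    by rewrite [X in X * _]indicE memNset// mul0r !mulr_ge0 ?gaussd_ge0// indicE.
  case: (boolP (aligned (U a) G)) => cl; last by rewrite mul0r !mulr0.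
  by rewrite [\1_D _]indicE mem_set ?mulr1 ?mul1r; [rewrite indicE mem_set// mul1r | exact: BD cl].
rewrite ge0_integralZl// mc2.
by apply: lee_wpmul2l => //; exact: c2_le.
Qed.
End haar.

(** * The logarithmic moment generating function *)

Section mgf.
Context (R : realType) (p : R) (hp : 2 <= p).
Context d (T : measurableType d) (P : probability T R) (Z : {RV P >-> R}).
Hypothesis Zd : has_density_p p Z.

Let p0 : 0 < p. Proof. by apply: lt_le_trans hp. Qed.

Definition dens_cst : R := 2 * p `^ p^-1 * Gamma (1 + p^-1).
Local Notation c0 := dens_cst.

Lemma measurable_powR_norm : measurable_fun setT (fun x : R => `|x| `^ p).
Proof. by apply: (measurableT_comp (measurable_powR p)); exact: normr_measurable. Qed.

Lemma measurable_expR_powR : measurable_fun setT (fun x : R => expR (- (`|x| `^ p / p))).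
Proof.
apply: measurableT_comp => //; apply: measurableT_comp => //.
by apply: measurable_funM => //; exact: measurable_powR_norm.
Qed.

(** Read off from the total mass of the law of [Z] instead of the Gamma integral: a nonpositive
    constant would make the density nonpositive. *)
Lemma dens_cst_gt0 : 0 < c0.
Proof.
rewrite ltNge; apply/negP => c0le.
have := Zd measurableT; rewrite /distribution /pushforward preimage_setT probability_setT => h.
have : (\int[lebesgue_measure]_x (density_p p x)%:E <= 0)%E.
  under eq_integral do rewrite -[density_p _ _]opprK EFinN.
  rewrite integral_ge0N ?oppe_le0 => [|x _].
    apply: integral_ge0 => x _.
    by rewrite lee_fin oppr_ge0 /density_p mulr_le0_ge0 ?expR_ge0// invr_le0.
  by rewrite lee_fin oppr_ge0 /density_p mulr_le0_ge0 ?expR_ge0// invr_le0.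
by rewrite -h lee_fin ler10.
Qed.

Lemma measurable_density_p : measurable_fun setT (density_p p).
Proof. by apply: measurable_funM => //; exact: measurable_expR_powR. Qed.

Lemma density_p_ge0 x : 0 <= density_p p x.
Proof. by rewrite /density_p mulr_ge0 ?expR_ge0// invr_ge0 ltW// dens_cst_gt0. Qed.

Lemma integral_density (f : R -> R) : measurable_fun setT f -> (forall x, 0 <= f x) ->
  (\int[lebesgue_measure]_x (f x * expR (- (`|x| `^ p / p)))%:E = c0%:E * \int[P]_w (f (Z w))%:E)%E.
Proof.
move=> mf f0; rewrite (@ge0_integral_rv_density _ _ _ _ Z (density_p p) measurable_density_p density_p_ge0 Zd (EFin \o f))//; last first.
  by apply/measurable_EFinP.
rewrite -ge0_integralZl//=.
- apply: eq_integral => x _; rewrite -!EFinM /density_p -/c0; congr EFin.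
  by field; rewrite gt_eqF// dens_cst_gt0.
- by apply: emeasurable_funM; apply/measurable_EFinP => //; exact: measurable_density_p.
- by move=> x _; rewrite -EFinM lee_fin mulr_ge0// density_p_ge0.
- by rewrite lee_fin ltW// dens_cst_gt0.
Qed.

Definition mgf s : R := fine (\int[P]_w (expR (s * Z w))%:E).
Definition cgf s : R := ln (mgf s).

Lemma measurable_expR_lin (s : R) : measurable_fun setT (fun x : R => expR (s * x)).
Proof. by apply: measurableT_comp => //; exact: measurable_funM. Qed.

Lemma powR_norm_ge (x : R) : x ^+ 2 - 1 <= `|x| `^ p.
Proof.
have [x1|x1] := leP 1 `|x|.
  have : `|x| `^ 2%:R <= `|x| `^ p by rewrite ler_powR.
  rewrite powR_mulrn// real_normK ?num_real//; lra.
apply: (@le_trans _ _ 0); last exact: powR_ge0.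
by rewrite subr_le0 -real_normK ?num_real// expr_le1// ltW.
Qed.

(** By [powR_norm_ge], [-|x|^p / p <= (1 - x^2) / p]. Half of the quadratic term absorbs [s x] by
    completing the square; the other half is a Gaussian of variance [p]. *)
Lemma mgf_bound : exists C : R, forall s, (\int[P]_w (expR (s * Z w))%:E <= (C * expR (p / 2 * s ^+ 2))%:E)%E.
Proof.
pose sg := Num.sqrt p; have sg0 : sg != 0 by rewrite gt_eqF// sqrtr_gt0.
have ps0 : 0 < normal_peak sg by rewrite normal_peak_gt0.
exists (c0^-1 * (expR (p^-1) / normal_peak sg)) => s.
have c0g := dens_cst_gt0.
have -> : (\int[P]_w (expR (s * Z w))%:E = (c0^-1)%:E * \int[lebesgue_measure]_x (expR (s * x) * expR (- (`|x| `^ p / p)))%:E)%E.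
  rewrite (integral_density (f := fun x => expR (s * x))).
  - by rewrite muleA -EFinM mulVf ?mul1e// gt_eqF.
  - exact: measurable_expR_lin.
  - by move=> x; exact: expR_ge0.
rewrite -(mulrA c0^-1) [X in (_ <= X)%E]EFinM; apply: lee_wpmul2l; first by rewrite lee_fin invr_ge0 ltW.
apply: (@le_trans _ _ (\int[lebesgue_measure]_x ((expR p^-1 / normal_peak sg * expR (p / 2 * s ^+ 2))%:E * (normal_pdf 0 sg x)%:E)))%E.
  apply: ge0_le_integral => //.
  - by apply/measurable_EFinP; apply: measurable_funM; [exact: measurable_expR_lin|exact: measurable_expR_powR].
  - by apply: emeasurable_funM => //; apply/measurable_EFinP; exact: measurable_normal_pdf.
  move=> x _; rewrite -EFinM lee_fin normal_pdfE//.
  rewrite [leRHS](_ : _ = expR p^-1 * expR (p / 2 * s ^+ 2) * normal_fun 0 sg x); last by field; rewrite gt_eqF.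
  rewrite /normal_fun subr0 (sqr_sqrtr (ltW p0)) -!expRD ler_expR.
  have h1 : (x ^+ 2 - 1) / p <= `|x| `^ p / p by rewrite ler_pM2r ?invr_gt0// powR_norm_ge.
  have h2 : 0 <= (x - p * s) ^+ 2 / (2 * p) by rewrite divr_ge0 ?sqr_ge0// mulr_ge0// ltW.
  have h3 : (x - p * s) ^+ 2 / (2 * p) = x ^+ 2 / (2 * p) - s * x + p / 2 * s ^+ 2 by field; rewrite gt_eqF.
  have h4 : (x ^+ 2 - 1) / p = x ^+ 2 / (2 * p) + x ^+ 2 / (2 * p) - p^-1 by field; rewrite gt_eqF.
  have h5 : - x ^+ 2 / (p *+ 2) = - (x ^+ 2 / (2 * p)) by rewrite -mulr_natl; field; rewrite gt_eqF.
  by rewrite h5; lra.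
rewrite ge0_integralZl//.
- by rewrite integral_normal_pdf mule1.
- by apply/measurable_EFinP; exact: measurable_normal_pdf.
- by move=> x _; rewrite lee_fin normal_pdf_ge0.
- by rewrite lee_fin !mulr_ge0 ?expR_ge0// invr_ge0 ltW.
Qed.

Lemma mgfE s : (\int[P]_w (expR (s * Z w))%:E = (mgf s)%:E)%E.
Proof.
have [C hC] := mgf_bound; rewrite /mgf fineK// ge0_fin_numE.
  by apply: le_lt_trans (hC s) _; rewrite ltry.
by apply: integral_ge0 => w _; rewrite lee_fin expR_ge0.
Qed.

Lemma measurable_cgf : measurable_fun setT cgf.
Proof.
rewrite /cgf /mgf; apply: measurableT_comp => //; apply: measurableT_comp => //.
apply: (measurable_fun_fubini_tonelli_F (m2 := P) (fun z : R * T => (expR (z.1 * Z z.2))%:E)).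
  apply/measurable_EFinP; apply: measurableT_comp => //; apply: measurable_funM => //.
  exact: measurableT_comp.
by move=> z; rewrite lee_fin expR_ge0.
Qed.

Opaque mgf dens_cst.

Lemma mgfN s : mgf (- s) = mgf s.
Proof.
have c0g := dens_cst_gt0.
apply: (mulfI (lt0r_neq0 c0g)); apply: EFin_inj; rewrite !EFinM -!mgfE.
rewrite -(integral_density (f := fun x => expR (- s * x))); [|exact: measurable_expR_lin|by move=> x; exact: expR_ge0].
rewrite -(integral_density (f := fun x => expR (s * x))); [|exact: measurable_expR_lin|by move=> x; exact: expR_ge0].
rewrite -[RHS]mul1e -[in RHS](invr1 R) -[in RHS](normr1 R) -[in RHS](normrN 1).
rewrite -(@ge0_integral_affine R (-1) 0 (fun x => (expR (s * x) * expR (- (`|x| `^ p / p)))%:E)).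
- by apply: eq_integral => x _; rewrite addr0 mulN1r normrN mulrN mulNr.
- by rewrite oppr_eq0 oner_eq0.
- by apply/measurable_EFinP; apply: measurable_funM; [exact: measurable_expR_lin|exact: measurable_expR_powR].
- by move=> x; rewrite lee_fin mulr_ge0 ?expR_ge0.
Qed.

Lemma measurable_expR_rv s : measurable_fun setT (fun w => expR (s * Z w)).
Proof. by apply: measurableT_comp => //; exact: measurable_funM. Qed.
Hint Resolve measurable_expR_rv : core.

Lemma mgf0 : mgf 0 = 1.
Proof.
apply: EFin_inj; rewrite -mgfE; under eq_integral do rewrite mul0r expR0.
by rewrite integral_cst// [X in (_ * X)%E]probability_setT mule1.
Qed.

Lemma mgf_comb (a b s t : R) : 0 <= a -> 0 <= b ->
  (\int[P]_w (a * expR (s * Z w) + b * expR (t * Z w))%:E = (a * mgf s + b * mgf t)%:E)%E.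
Proof.
move=> a0 b0; under eq_integral do rewrite EFinD !EFinM.
rewrite ge0_integralD//.
- rewrite !ge0_integralZl ?mgfE// ?lee_fin//; try by move=> w _; rewrite lee_fin expR_ge0.
  + by apply/measurable_EFinP.
  + by apply/measurable_EFinP.
- by move=> w _; rewrite mule_ge0 ?lee_fin ?expR_ge0.
- by apply: emeasurable_funM => //; apply/measurable_EFinP.
- by move=> w _; rewrite mule_ge0 ?lee_fin ?expR_ge0.
- by apply: emeasurable_funM => //; apply/measurable_EFinP.
Qed.

(** By symmetry twice this mean is the mean of [x + 1 / x] with [x = expR (s Z)], which is at least
    2. *)
Lemma mgf_ge1 s : 1 <= mgf s.
Proof.
have : ((1 * mgf s + 1 * mgf (- s))%:E >= 2%:E)%E.
  rewrite -mgf_comb//.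
  have -> : (2%:E = \int[P]_w (cst 2%:E w))%E by rewrite integral_cst// [X in (_ * X)%E]probability_setT mule1.
  apply: ge0_le_integral => //.
  - by move=> w _; rewrite lee_fin.
  - by apply/measurable_EFinP; apply: measurable_funD; apply: measurable_funM.
  - move=> w _; rewrite /= lee_fin !mul1r mulNr expRN.
    have e0 := expR_gt0 (s * Z w); set x := expR _ in e0 *.
    have : 0 <= (x - 1) ^+ 2 / x by rewrite divr_ge0 ?sqr_ge0// ltW.
    have -> : (x - 1) ^+ 2 / x = x + x^-1 - 2 by field; rewrite gt_eqF.
    lra.
by rewrite lee_fin mgfN; lra.
Qed.

Lemma mgf_gt0 s : 0 < mgf s. Proof. exact: lt_le_trans (mgf_ge1 s). Qed.

Lemma expR_cgf s : expR (cgf s) = mgf s.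
Proof. by rewrite /cgf lnK// posrE mgf_gt0. Qed.

Lemma expR_cgfB x y : expR (cgf x - cgf y) = mgf x / mgf y.
Proof. by rewrite -[in RHS](expR_cgf x) -[in RHS](expR_cgf y) -expRB. Qed.

Lemma cgf_ge0 s : 0 <= cgf s. Proof. by rewrite ln_ge0// mgf_ge1. Qed.
Lemma cgfN s : cgf (- s) = cgf s. Proof. by rewrite /cgf mgfN. Qed.
Lemma cgf0 : cgf 0 = 0. Proof. by rewrite /cgf mgf0 ln1. Qed.

Opaque cgf.

Lemma cgf_bound : exists2 C, 0 <= C & forall s, cgf s <= C + p / 2 * s ^+ 2.
Proof.
have [C hC] := mgf_bound; have hC' s : mgf s <= C * expR (p / 2 * s ^+ 2) by rewrite -lee_fin -mgfE.
have C1 : 1 <= C.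
  by apply: le_trans (mgf_ge1 0) _; have := hC' 0; rewrite expr0n mulr0 expR0 mulr1.
exists (ln C) => [|s]; first exact: ln_ge0.
rewrite -ler_expR expR_cgf expRD lnK ?posrE//; exact: lt_le_trans C1.
Qed.

(** Hoelder's inequality, obtained from convexity of the exponential at the normalized exponents
    [x Z - L x] and [y Z - L y], each of exponential mean 1. *)
Lemma cgf_convex (x y l : R) : 0 <= l <= 1 -> cgf (l * x + (1 - l) * y) <= l * cgf x + (1 - l) * cgf y.
Proof.
move=> /andP[l0 l1]; have l1' : 0 <= 1 - l by rewrite subr_ge0.
have conv (u v : R) : expR (l * u + (1 - l) * v) <= l * expR u + (1 - l) * expR v.
  pose m := l * u + (1 - l) * v.
  have key w : expR m * (1 + (w - m)) <= expR w.
    by rewrite -[in leRHS](subrKC m w) [in leRHS]expRD ler_pM2l ?expR_gt0// expR_ge1Dx.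
  have := ler_wpM2l l0 (key u); have := ler_wpM2l l1' (key v); rewrite -/m.
  by move: (expR m) (expR u) (expR v) => A1 A2 A3; rewrite /m; lra.
have ex := mgf_gt0 x; have ey := mgf_gt0 y.
pose c := expR (l * cgf x + (1 - l) * cgf y).
have c0g : 0 < c by rewrite expR_gt0.
rewrite -ler_expR expR_cgf -/c -lee_fin -mgfE.
have -> : (c%:E = (c * l / mgf x * mgf x + c * (1 - l) / mgf y * mgf y)%:E)%E.
  by congr EFin; move: (mgf x) (mgf y) ex ey => A1 A2 A10 A20; field; rewrite !gt_eqF.
rewrite -mgf_comb; last 2 first.
- by rewrite divr_ge0 ?mulr_ge0// ltW.
- by rewrite divr_ge0 ?mulr_ge0// ltW.
apply: ge0_le_integral => //.
- by apply/measurable_EFinP.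
- by apply/measurable_EFinP; apply: measurable_funD; apply: measurable_funM.
move=> w _; rewrite lee_fin.
have -> : (l * x + (1 - l) * y) * Z w = (l * cgf x + (1 - l) * cgf y) + (l * (x * Z w - cgf x) + (1 - l) * (y * Z w - cgf y)).
  by move: (cgf x) (cgf y) (Z w) => A1 A2 A3; ring.
rewrite expRD -/c; apply: le_trans (ler_wpM2l (ltW c0g) (conv _ _)) _.
have e1 u v : expR (v - cgf u) = expR v / mgf u by rewrite -[in RHS]expR_cgf -expRB.
rewrite (e1 x) (e1 y).
move: (mgf x) (mgf y) (expR (x * _)) (expR (y * _)) ex ey => A1 A2 A3 A4 A10 A20.
by rewrite le_eqVlt; apply/orP; left; apply/eqP; field; rewrite !gt_eqF.
Qed.

(** With [t = a |v| / 2], the remainder of [expR_le_quad] is at most [4 (e/a)^2 t^2 expR t], and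
    [t^2 <= 2 expR t]; two such terms give 16. *)
Lemma expR_second_diff (v a : R) (e : R) : 0 < a -> `|e| <= a / 2 ->
  expR (e * v) + expR (- (e * v)) - 2 <= 16 * (e / a) ^+ 2 * (expR (a * v) + expR (- (a * v))).
Proof.
move=> a0 ea.
have h1 := expR_le_quad (e * v); have := expR_le_quad (- (e * v)); rewrite normrN sqrrN => h2.
have ha : expR `|a * v| <= expR (a * v) + expR (- (a * v)).
  by case: (leP 0 (a * v)) => h; [rewrite ger0_norm// lerDl expR_ge0 | rewrite ltr0_norm// lerDr expR_ge0].
set t := a / 2 * `|v|; have t0 : 0 <= t by rewrite mulr_ge0// divr_ge0// ltW.
have ht : t ^+ 2 <= 2 * expR t.
  have := @expR_ge1Dxn R t 1 t0; rewrite (_ : (2`!)%:R = 2 :> R)//; lra.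
have h3 : expR `|e * v| <= expR t by rewrite ler_expR normrM ler_wpM2r.
have h4 : (e * v) ^+ 2 = 4 * (e / a) ^+ 2 * t ^+ 2.
  have -> : t ^+ 2 = (a / 2) ^+ 2 * v ^+ 2 by rewrite exprMn real_normK ?num_real.
  by field; rewrite gt_eqF.
have h5 : expR `|a * v| = expR t * expR t.
  by rewrite -expRD normrM gtr0_norm// /t; congr expR; field.
have h6 : t ^+ 2 * expR `|e * v| <= 2 * expR t * expR t.
  by apply: ler_pM => //; rewrite ?sqr_ge0 ?expR_ge0.
have h7 : (e * v) ^+ 2 * expR `|e * v| <= 4 * (e / a) ^+ 2 * (2 * expR `|a * v|).
  have h8 : 0 <= 4 * (e / a) ^+ 2 by rewrite mulr_ge0// sqr_ge0.
  have := ler_wpM2l h8 h6; rewrite h4 h5.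
  by move: (4 * _) (expR _) (expR _) (t ^+ 2) => A1 A2 A3 A4; lra.
have h8 : 0 <= 8 * (e / a) ^+ 2 by rewrite mulr_ge0// sqr_ge0.
have := ler_wpM2l h8 ha; move: h1 h2 h7; rewrite -/(expR _).
move: (expR (e * v)) (expR (- (e * v))) (expR `|e * v|) (expR `|a * v|) (expR (a * v)) (expR (- (a * v))) ((e / a) ^+ 2) ((e * v) ^+ 2).
by move=> A1 A2 A3 A4 A5 A6 A7 A8; lra.
Qed.

(** The substitute for a bound on the second derivative of [L]. The estimate for the exponential is
    averaged and divided by [mgf x]; [1 + y <= expR y] passes to the logarithms. *)
Lemma cgf_second_diff (x g a e : R) : 0 < a -> `|e| <= a / 2 ->
  cgf (x + e * g) + cgf (x - e * g) - 2 * cgf x <=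
  16 * (e / a) ^+ 2 * (expR (cgf (x + a * g) - cgf x) + expR (cgf (x - a * g) - cgf x)).
Proof.
move=> a0 ea; have mx := mgf_gt0 x.
pose q := 16 * (e / a) ^+ 2; have q0 : 0 <= q by rewrite mulr_ge0// sqr_ge0.
have h1 : mgf (x + e * g) + mgf (x - e * g) <= 2 * mgf x + q * (mgf (x + a * g) + mgf (x - a * g)).
  rewrite -lee_fin (_ : mgf (x + e * g) + _ = 1 * mgf (x + e * g) + 1 * mgf (x - e * g)); last by rewrite !mul1r.
  rewrite (_ : 2 * _ + _ = (2 * mgf x + q * mgf (x + a * g)) + (q * mgf (x - a * g) + 0 * mgf x)); last by rewrite mulrDr mul0r addr0 addrA.
  have I1 := mgf_comb (x + e * g) (x - e * g) ler01 ler01.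
  have I2 := mgf_comb x (x + a * g) (ler0n R 2) q0.
  have I3 := mgf_comb (x - a * g) x q0 (lexx 0).
  rewrite -I1 EFinD -I2 -I3 -ge0_integralD//; last 4 first.
  - by move=> w _; rewrite lee_fin addr_ge0// mulr_ge0 ?expR_ge0.
  - by apply/measurable_EFinP; apply: measurable_funD; apply: measurable_funM.
  - by move=> w _; rewrite lee_fin addr_ge0// mulr_ge0 ?expR_ge0.
  - by apply/measurable_EFinP; apply: measurable_funD; apply: measurable_funM.
  apply: ge0_le_integral => //.
  - by apply/measurable_EFinP; apply: measurable_funD; apply: measurable_funM.
  - by apply: emeasurable_funD; apply/measurable_EFinP; apply: measurable_funD; apply: measurable_funM.
  move=> w _; rewrite -EFinD lee_fin.
  have := expR_second_diff (g * Z w) a0 ea; rewrite -/q => h.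
  have := ler_wpM2l (expR_ge0 (x * Z w)) h.
  have -> : (x + e * g) * Z w = x * Z w + e * (g * Z w) by ring.
  have -> : (x - e * g) * Z w = x * Z w - e * (g * Z w) by ring.
  have -> : (x + a * g) * Z w = x * Z w + a * (g * Z w) by ring.
  have -> : (x - a * g) * Z w = x * Z w - a * (g * Z w) by ring.
  rewrite !expRD; set X := expR (x * Z w).
  move: (expR (e * _)) (expR (- (e * _))) (expR (a * _)) (expR (- (a * _))) => A1 A2 A3 A4.
  by rewrite !mul1r mul0r addr0; lra.
have h2 u : cgf u - cgf x + 1 <= mgf u / mgf x by rewrite -expR_cgfB addrC expR_ge1Dx.
have := h2 (x + e * g); have := h2 (x - e * g).
rewrite (expR_cgfB (x + a * g)) (expR_cgfB (x - a * g)) -(mulrDl (mgf (x + a * g))) -/q.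
have h4 : (mgf (x + e * g) + mgf (x - e * g)) / mgf x <= 2 + q * ((mgf (x + a * g) + mgf (x - a * g)) / mgf x).
  by rewrite ler_pdivrMr// mulrDl mulrA divfK ?gt_eqF.
move: h4; rewrite (mulrDl (mgf (x + e * g))).
move: (mgf (x + e * g) / _) (mgf (x - e * g) / _) (q * _) (cgf (x + e * g)) (cgf (x - e * g)) (cgf x) => A1 A2 A3 A4 A5 A6.
by lra.
Qed.
End mgf.

(** * Nets and almost every sequence of frames *)

Lemma ge0_le_integral_setU d (T : measurableType d) (R : realType) (mu : {measure set T -> \bar R})
  (A B : set T) (f : T -> \bar R) : measurable A -> measurable B -> measurable_fun setT f -> (forall x, 0 <= f x)%E ->
  (\int[mu]_(x in A `|` B) f x <= \int[mu]_(x in A) f x + \int[mu]_(x in B) f x)%E.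
Proof.
move=> mA mB mf f0; have mBA : measurable (B `\` A) by exact: measurableD.
rewrite -[A `|` B](_ : A `|` (B `\` A) = _); last by rewrite setUDr setDv setD0.
rewrite ge0_integral_setU//.
- rewrite leeD2l//; apply: ge0_subset_integral => //; exact: measurable_funTS.
- exact: measurable_funTS.
- by apply/disj_setPS => x [? []].
Qed.

(** A strict inequality of slopes survives a quadratic error for a small step. All perturbations of
    maximizers and weights below take their step here. *)
Lemma small_step (R : realType) (x z c a : R) : x < z -> 0 <= c -> 0 < a ->
  exists2 e : R, 0 < e <= a & x * e + c * e ^+ 2 < z * e.
Proof.
move=> xz c0 a0; pose e := Num.min a ((z - x) / (2 * (c + 1))).
have e0 : 0 < e by rewrite lt_min a0 divr_gt0 ?subr_gt0// mulr_gt0// ltr_wpDl.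
exists e; first by rewrite e0 ge_min lexx.
have : e <= (z - x) / (2 * (c + 1)) by rewrite ge_min lexx orbT.
rewrite ler_pdivlMr ?mulr_gt0 ?ltr_wpDl// => h.
rewrite -subr_gt0 (_ : _ - _ = e * (z - x - c * e)); last by ring.
by rewrite mulr_gt0//; have := mulr_ge0 c0 (ltW e0); lra.
Qed.

Lemma expR_bounds (R : realType) (y : R) : `|y| <= 1 / 2 -> 1 + y <= expR y <= 1 + y + 2 * y ^+ 2.
Proof.
move=> hy; rewrite expR_ge1Dx/=; apply: le_trans (expR_le_quad y) _.
rewrite lerD2l mulrC ler_wpM2r ?sqr_ge0//.
have h : expR (- `|y|) >= 1 / 2 by have := expR_ge1Dx (- `|y|); lra.
rewrite -[leLHS]invrK -expRN -[2]invrK lef_pV2 ?posrE ?expR_gt0// ?invr_gt0//.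
by rewrite -[2^-1]mul1r.
Qed.

Lemma near_and (P Q : nat -> Prop) : (\forall n \near \oo, P n) -> (\forall n \near \oo, Q n) ->
  \forall n \near \oo, P n /\ Q n.
Proof. by apply: filterS2 => n. Qed.

Lemma dist_bounds (R : realDomainType) (x y e : R) : `|x - y| <= e -> y - e <= x /\ x <= y + e.
Proof. by rewrite ler_distl => /andP. Qed.

(** * Gaussian tails and the second moment *)

Section gauss_tail.
Variable R : realType.
Local Notation gamma := (normal_prob (0 : R) 1).

Lemma gauss_tail (H : R -> R) (C m e : R) : measurable_fun setT H ->
  (forall x, `|H x| <= C * (1 + x ^+ 2)) -> (\int[gamma]_x (H x)%:E = m%:E)%E -> 0 < e ->
  exists2 q : R, 0 <= q < 1 & forall n (D : set (borel 'cV[R]_n)), measurable D ->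
    (forall G, D G -> n%:R * (m + e) <= \sum_i H (G i ord0)) ->
    (\int[volm R n]_G (\1_D G * gaussd G)%:E <= (q ^+ n)%:E)%E.
Proof.
move=> mH hH Hm e0; have [l [q [l0 q01 hq]]] := exists_small_mgf mH hH Hm e0.
exists q => // n D mD hD; apply: (gauss_chernoff (h := fun x => expR (l * (H x - m - e)))) => //.
  apply: measurableT_comp => //; apply: measurable_funM => //.
  by apply: measurable_funB => //; apply: measurable_funB.
move=> G /hD hG; rewrite -expR_sum -expR0 ler_expR -mulr_sumr mulr_ge0 ?(ltW l0)//.
rewrite (eq_bigr (fun i => H (G i ord0) - (m + e))); last by move=> i _; rewrite opprD addrA.
by rewrite sumrB sumr_const card_ord -[X in _ - X]mulr_natl subr_ge0.
Qed.

Let pdf_sigma (s x : R) : 0 < s -> s * normal_pdf 0 s x = normal_pdf 0 1 x * expR (x ^+ 2 * (1 - s^-1 ^+ 2) / 2).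
Proof.
move=> s0; rewrite !normal_pdfE ?oner_eq0 ?gt_eqF//.
have -> : normal_peak s = normal_peak 1 / s.
  rewrite /normal_peak -mulrnAr sqrtrM ?sqr_ge0// sqrtr_sqr gtr0_norm// expr1n mul1r invfM mulrC.
  by rewrite mulrC.
rewrite [LHS](_ : _ = normal_peak 1 * normal_fun 0 s x); last by field; rewrite gt_eqF.
rewrite -(mulrA (normal_peak 1)); congr (_ * _).
rewrite /normal_fun !subr0 -expRD; congr expR; rewrite expr1n.
by field; rewrite gt_eqF.
Qed.

(* Integrating [1 + t <= expR t], with [t] the logarithm of the ratio of the densities of
   [N(0, s^2)] and [N(0, 1)]; letting [s] tend to 1 from both sides forces [m = 1]. *)
Lemma normal_sqr_bound (s : R) : 0 < s -> forall m : R, (\int[gamma]_x (x ^+ 2)%:E = m%:E)%E ->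
  1 + m * (1 - s^-1 ^+ 2) / 2 <= s.
Proof.
move=> s0 m hm; pose k := (1 - s^-1 ^+ 2) / 2.
have msq : measurable_fun setT (fun x : R => x ^+ 2) by exact: measurable_funX.
have hm' : (\int[lebesgue_measure]_x (x ^+ 2 * normal_pdf 0 1 x)%:E = m%:E)%E.
  by rewrite -hm ge0_integral_normal//; [exact/measurable_EFinP | move=> x; rewrite lee_fin sqr_ge0].
have mp (t : R) : measurable_fun setT (fun x : R => (normal_pdf 0 t x)%:E).
  by apply/measurable_EFinP; exact: measurable_normal_pdf.
have mx : measurable_fun setT (fun x : R => (x ^+ 2 * normal_pdf 0 1 x)%:E).
  by apply/measurable_EFinP; apply: measurable_funM => //; exact: measurable_normal_pdf.
have p0 (t x : R) : (0 <= (normal_pdf 0 t x)%:E)%E by rewrite lee_fin normal_pdf_ge0.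
have x0 (x : R) : (0 <= (x ^+ 2 * normal_pdf 0 1 x)%:E)%E by rewrite lee_fin mulr_ge0 ?sqr_ge0 ?normal_pdf_ge0.
have comb (a b t : R) : 0 <= a -> 0 <= b ->
    (\int[lebesgue_measure]_x (a%:E * (normal_pdf 0 t x)%:E + b%:E * (x ^+ 2 * normal_pdf 0 1 x)%:E) = (a + b * m)%:E)%E.
  move=> a0 b0; rewrite ge0_integralD//.
  - have -> : (\int[lebesgue_measure]_x (a%:E * (normal_pdf 0 t x)%:E) = a%:E)%E.
      by rewrite ge0_integralZl ?lee_fin//; [rewrite integral_normal_pdf mule1|exact: mp].
    have -> : (\int[lebesgue_measure]_x (b%:E * (x ^+ 2 * normal_pdf 0 1 x)%:E) = (b * m)%:E)%E.
      by rewrite ge0_integralZl ?lee_fin// EFinM -hm'.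
    by [].
  - by move=> x _; rewrite mule_ge0.
  - by apply: emeasurable_funM => //; exact: mp.
  - by move=> x _; rewrite mule_ge0.
  - by apply: emeasurable_funM.
have pt (x : R) : normal_pdf 0 1 x + k * (x ^+ 2 * normal_pdf 0 1 x) <= s * normal_pdf 0 s x.
  rewrite pdf_sigma//.
  have := ler_wpM2l (normal_pdf_ge0 0 1 x) (expR_ge1Dx (x ^+ 2 * (1 - s^-1 ^+ 2) / 2)).
  by rewrite /k; lra.
have -> : m * (1 - s^-1 ^+ 2) / 2 = k * m by rewrite /k; ring.
have cm (a b : R) (f g : R -> \bar R) : 0 <= a -> 0 <= b -> measurable_fun setT f -> measurable_fun setT g ->
  measurable_fun setT (fun x : R => (a%:E * f x + b%:E * g x)%E).
  by move=> a0 b0 mf mg; apply: emeasurable_funD; apply: emeasurable_funM.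
have [k0|k0] := leP 0 k.
  rewrite -[leRHS]addr0 -[X in _ <= _ + X](mul0r m) -lee_fin -(comb 1 k 1)// -(comb s 0 s) ?(ltW s0)//.
  apply: ge0_le_integral => //.
  - by move=> x _; rewrite adde_ge0// mule_ge0.
  - by apply: (@cm 1 k).
  - by apply: (@cm s 0) => //; exact: ltW.
  by move=> x _; rewrite -!EFinM -!EFinD lee_fin mul1r mul0r addr0.
suff : 1 <= s + (- k) * m by lra.
rewrite -[leLHS]addr0 -[X in _ + X <= _](mul0r m) -lee_fin -(comb 1 0 1)// -(comb s (- k) s) ?(ltW s0) ?oppr_ge0 ?(ltW k0)//.
apply: ge0_le_integral => //.
- by move=> x _; rewrite adde_ge0// mule_ge0.
- by apply: (@cm 1 0).
- by apply: (@cm s (- k)) => //; rewrite ?(ltW s0)// oppr_ge0 ltW.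
by move=> x _; rewrite -!EFinM -!EFinD lee_fin mul1r mul0r addr0; have := pt x; lra.
Qed.

Lemma normal_second_moment : (\int[gamma]_x (x ^+ 2)%:E = 1)%E.
Proof.
have i2 : gamma.-integrable setT (EFin \o (fun x : R => x ^+ 2)).
  apply: (@normal_integrable_sqr _ _ 1); first exact: measurable_funX.
  by move=> x; rewrite ger0_norm ?sqr_ge0// mul1r lerDr.
pose m := fine (\int[gamma]_x (x ^+ 2)%:E)%E.
have hm : (\int[gamma]_x (x ^+ 2)%:E = m%:E)%E.
  by rewrite /m fineK//; exact: (integrable_fin_num measurableT i2).
have m0 : 0 <= m by rewrite -lee_fin -hm; apply: integral_ge0 => x _; rewrite lee_fin sqr_ge0.
(* For [s > 1] this says [m <= 2 s^2 / (s + 1)], for [s < 1] the reverse, and the right side tends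
   to 1 with [s]. *)
have bnd (s : R) (s0 : 0 < s) : (s - 1) * (m * (s + 1) - 2 * s ^+ 2) <= 0.
  have := normal_sqr_bound s0 hm.
  have -> : 1 + m * (1 - s^-1 ^+ 2) / 2 = 1 + m * (s - 1) * (s + 1) / (2 * s ^+ 2) by field; rewrite gt_eqF.
  rewrite -lerBrDl ler_pdivrMr; last by rewrite mulr_gt0// exprn_gt0.
  by lra.
rewrite hm; congr EFin; apply/eqP; rewrite eq_le; apply/andP; split.
  rewrite leNgt; apply/negP => m1.
  pose s := 1 + Num.min ((m - 1) / 8) 1.
  have h1 : 0 < Num.min ((m - 1) / 8) 1 by rewrite lt_min ltr01 andbT divr_gt0// subr_gt0.
  have h2 : Num.min ((m - 1) / 8) 1 <= (m - 1) / 8 by rewrite ge_min lexx.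
  have h3 : Num.min ((m - 1) / 8) 1 <= 1 by rewrite ge_min lexx orbT.
  have := @bnd s; rewrite /s; move: (Num.min _ _) h1 h2 h3 => t h1 h2 h3 /(_ ltac:(lra)).
  by nra.
rewrite leNgt; apply/negP => m1.
pose t := (1 - m) / 8; have t0 : 0 < t by rewrite divr_gt0// subr_gt0.
have t1 : t <= 1 / 8 by rewrite /t; lra.
have mt : m = 1 - 8 * t by rewrite /t; field.
have := @bnd (1 - t) ltac:(lra); rewrite mt => h.
have t2 : 0 < t * t by rewrite mulr_gt0.
have : t * t * (13 - 6 * t) <= 0 by lra.
by rewrite pmulr_rle0//; lra.
Qed.
End gauss_tail.

(** * Nets of the sphere *)

Section net.
Context (R : realType).

Lemma leq_bin_exp2 m n : ('C(m, n) <= 2 ^ m)%N.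
Proof.
have := card_draws 'I_m n; rewrite card_ord => <-.
by apply: leq_trans (max_card _) _; rewrite -cardsT -powersetT card_powerset cardsT card_ord.
Qed.

(* Lattice vectors [z] with [\sum_i |z_i| <= B k], normalized: there are at most
   [2^k 'C(k + B k, k)] of them, and truncating the coordinates of a multiple of [v]
   towards 0 gives one, because [\sum_i |z_i| <= \sum_i z_i^2]. *)
Lemma sphere_net (e : R) : 0 < e < 1 -> exists C : nat, forall k : nat, (0 < k)%N ->
  exists N : seq 'cV[R]_k, [/\ (size N <= C ^ k)%N, forall w, w \in N -> sqn w = 1 &
    forall v : 'cV[R]_k, exists2 w, w \in N & (1 - e) * enorm v <= dot w v].
Proof.
move=> /andP[e0 e1]; pose B := (Num.truncn (e ^- 2)).+1; have hB : e ^- 2 <= B%:R by apply: ltW; rewrite truncnS_gt.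
(* The binomial coefficient is at most [2 ^ (k + B k)], and the signs contribute [2 ^ k]. *)
exists (2 ^ (B + 2))%N => k k0; pose n := (B * k)%N.
have K0 : 0 < k%:R :> R by rewrite ltr0n.
pose S : {set (k.-tuple 'I_n.+1) * {ffun 'I_k -> bool}} := finset.finset (fun x : (k.-tuple 'I_n.+1) * {ffun 'I_k -> bool} => (\sum_(i <- x.1) i <= n)%N).
pose u (x : (k.-tuple 'I_n.+1) * {ffun 'I_k -> bool}) : 'cV[R]_k := \col_i ((-1) ^+ (x.2 i) * (tnth x.1 i)%:R).
(* An arbitrary unit vector, the value assigned to the lattice point 0. *)
pose b : 'cV[R]_k := \col_i (i == Ordinal k0)%:R.
pose f x : 'cV[R]_k := if u x == 0 then b else (enorm (u x))^-1 *: u x.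
have bu : sqn b = 1.
  rewrite /sqn (bigD1 (Ordinal k0))//= mxE eqxx expr1n big1 ?addr0// => i /negbTE ik.
  by rewrite mxE ik expr0n.
have fu x : sqn (f x) = 1.
  rewrite /f; case: eqVneq => // ux; rewrite sqnZ -enorm_sqr -exprMn mulVf ?expr1n//.
  by rewrite -sqrf_eq0 enorm_sqr sqn_eq0.
exists [seq f x | x <- enum S]; split.
- rewrite size_map -cardE.
  have -> : S = finset.setX (finset.finset (fun t : k.-tuple 'I_n.+1 => (\sum_(i <- t) i <= n)%N)) finset.setT.
    by apply/setP => x; rewrite !finset.inE andbT.
  rewrite cardsX card_partial_ord_partitions cardsT card_ffun card_bool card_ord -expnM.
  apply: leq_trans (leq_mul (leq_bin_exp2 _ _) (leqnn _)) _.
  by rewrite -expnD leq_exp2l// mulnDl addnAC addnn -mul2n addnC.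
- by move=> w /mapP[x _ ->].
move=> v; have [->|v0] := eqVneq v 0.
  exists (f ([tuple of nseq k ord0], [ffun => false])).
    apply: map_f; rewrite mem_enum finset.inE /= big1_seq// => i /=.
    by rewrite mem_nseq => /andP[_ /eqP ->].
  have -> : (0 : 'cV[R]_k) = 0 *: 0 by rewrite scaler0.
  by rewrite dotZr enormZ normr0 !mul0r mulr0.
have vs : enorm v != 0 by rewrite -sqrf_eq0 enorm_sqr sqn_eq0.
have m0 : 0 < enorm v by rewrite lt_neqAle eq_sym vs enorm_ge0.
set m := enorm v in m0 *.
pose r := Num.sqrt k%:R : R; have r0 : 0 < r by rewrite sqrtr_gt0.
have rr : r ^+ 2 = k%:R by rewrite sqr_sqrtr// ler0n.
(* This scale makes [\sum_i y_i^2 = k / e^2 <= B k], while truncation changes each coordinate of [v]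
   by at most [e m / sqrt k], hence [v] by at most [e m]. *)
pose y i := `|v i ord0| * (r / (e * m)).
have y0 i : 0 <= y i by rewrite mulr_ge0// divr_ge0 ?mulr_ge0 ?ltW.
pose t i := Num.truncn (y i).
have t1 i : (t i)%:R <= y i by have /andP[] := truncn_itv (y0 i).
have t2 i : y i < (t i)%:R + 1 by have /andP[_] := truncn_itv (y0 i); rewrite natr1.
have sumt : (\sum_(i < k) t i <= n)%N.
  rewrite -(ler_nat R) natr_sum.
  apply: (@le_trans _ _ (\sum_(i < k) y i ^+ 2)).
    apply: ler_sum => i _; have : (t i)%:R ^+ 2 <= y i ^+ 2 by rewrite lerXn2r// nnegrE.
    move=> h; apply: le_trans h; rewrite -natrX ler_nat; case: (t i) => // j.
    by rewrite -[X in (X <= _)%N]expn1 leq_pexp2l.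
  have -> : \sum_(i < k) y i ^+ 2 = k%:R * e ^- 2.
    rewrite /y; under eq_bigr do rewrite exprMn real_normK ?num_real//.
    rewrite -mulr_suml -[\sum_i _]/(sqn v) -enorm_sqr -/m -rr; field; rewrite !gt_eqF//.
  by rewrite mulrC /n natrM ler_pM2r.
have tn i : (t i < n.+1)%N.
  by rewrite ltnS; apply: leq_trans sumt; rewrite (bigD1 i)//= leq_addr.
pose x := ([tuple Ordinal (tn i) | i < k], [ffun i => v i ord0 < 0]).
have xS : x \in S.
  by rewrite finset.inE /= big_map big_enum.
exists (f x); first by apply: map_f; rewrite mem_enum.
pose c := e * m / r; have c0 : 0 < c by rewrite divr_gt0// mulr_gt0.
have vE i : v i ord0 = (-1) ^+ (v i ord0 < 0)%R * `|v i ord0| by rewrite -numEsign.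
have yE i : `|v i ord0| = c * y i by rewrite /y /c; field; rewrite !gt_eqF.
have uE i : u x i ord0 = (-1) ^+ (v i ord0 < 0)%R * (t i)%:R by rewrite mxE tnth_mktuple ffunE.
have nu : sqn (c *: u x) <= sqn v.
  apply: ler_sum => i _; rewrite mxE uE [in leRHS]vE mulrCA !(exprMn _ ((-1) ^+ _)) !sqrr_sign !mul1r.
  have h : c * (t i)%:R <= `|v i ord0| by rewrite yE ler_pM2l.
  have ct : 0 <= c * (t i)%:R by apply: mulr_ge0 => //; exact: ltW.
  by rewrite -[leRHS]mul1r -[leLHS]mul1r; apply: ler_wpM2l => //; apply: lerXn2r h; rewrite nnegrE.
have nd : sqn (v - c *: u x) <= (e * m) ^+ 2.
  have -> : (e * m) ^+ 2 = \sum_(i < k) c ^+ 2.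
    rewrite sumr_const card_ord -mulr_natl -rr /c; field; rewrite gt_eqF//.
  apply: ler_sum => i _; have -> : (v - c *: u x) i ord0 = v i ord0 - c * u x i ord0 by rewrite !mxE.
  rewrite uE {1}vE mulrCA -mulrBr exprMn sqrr_sign mul1r.
  rewrite -ler_sqrt ?sqr_ge0// !sqrtr_sqr (gtr0_norm c0) yE -mulrBr normrM (gtr0_norm c0) ler_piMr ?(ltW c0)//.
  by rewrite ger0_norm ?subr_ge0 ?t1// lerBlDl ltW// t2.
have nu' : enorm (c *: u x) <= m by rewrite /m /enorm ler_wsqrtr.
have nd' : enorm (v - c *: u x) <= e * m.
  by rewrite -(@ler_pXn2r _ 2) ?nnegrE ?enorm_ge0 ?(ltW (mulr_gt0 e0 m0))// enorm_sqr.
(* Cauchy-Schwarz converts the error into a bound on the scalar product. Dividing by the norm of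
   [u x] then loses nothing, since truncation towards 0 gives [enorm (c *: u x) <= m]. *)
have dv : (1 - e) * m ^+ 2 <= c * dot (u x) v.
  have -> : c * dot (u x) v = m ^+ 2 - dot v (v - c *: u x).
    by rewrite dotBr dotZr dotuu -enorm_sqr -/m opprB addrC subrK dotC.
  have := cauchy_schwarz v (v - c *: u x); rewrite -/m => h1.
  have h2 := ler_wpM2l (ltW m0) nd'; rewrite mulrBl mul1r lerD2l lerN2.
  by apply: le_trans h1 (le_trans h2 _); rewrite mulrCA expr2.
have dp : 0 < dot (u x) v.
  by rewrite -(pmulr_rgt0 _ c0); apply: lt_le_trans dv; rewrite mulr_gt0 ?exprn_gt0// subr_gt0.
have un0 : u x != 0.
  apply/eqP => u0; move: dp; rewrite u0 /dot big1 ?ltxx// => i _; by rewrite mxE mul0r.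
have en0 : 0 < enorm (u x) by rewrite lt_neqAle enorm_ge0 andbT eq_sym -sqrf_eq0 enorm_sqr sqn_eq0.
rewrite /f (negbTE un0) dotC dotZr [leRHS]mulrC ler_pdivlMr// dotC.
move: nu'; rewrite enormZ (gtr0_norm c0) => nu'.
rewrite -(ler_pM2l c0); apply: le_trans dv.
rewrite (_ : c * _ = ((1 - e) * m) * (c * enorm (u x))); last by ring.
have em0 : 0 <= (1 - e) * m by apply: mulr_ge0; [rewrite subr_ge0; exact: ltW|exact: ltW].
by rewrite expr2 [leRHS]mulrA; apply: ler_wpM2l.
Qed.
End net.

Lemma borel_cantelli_geometric d (T : measurableType d) (R : realType) (mu : {measure set T -> \bar R})
  (F : nat -> set T) (c q : R) (n0 : nat) : (forall n, measurable (F n)) -> 0 <= c -> 0 <= q < 1 ->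
  (forall n, (n0 <= n)%N -> (mu (F n) <= (c * q ^+ n)%:E)%E) ->
  {ae mu, forall x, \forall n \near \oo, ~ F n x}.
Proof.
move=> mF c0 /andP[q0 q1] hF; pose G n := F (n + n0)%N.
have G0 : mu (lim_sup_set G) = 0%E.
  apply: lim_sup_set_cvg0 => [n|]; first exact: mF.
  apply: (@le_lt_trans _ _ (c / (1 - q))%:E); last by rewrite ltry.
  apply: lime_le; first by apply: is_cvg_nneseries.
  apply: nearW => N.
  apply: (@le_trans _ _ (\sum_(0 <= i < N) (c * q ^+ i)%:E)%E).
    apply: lee_sum => i _; apply: le_trans (hF _ _) _; first by rewrite leq_addl.
    by rewrite lee_fin ler_wpM2l// ler_wiXn2l// ?leq_addr// ltW.
  rewrite sumEFin lee_fin -mulr_sumr ler_wpM2l// -[leRHS]mul1r ler_pdivlMr ?subr_gt0//.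
  by rewrite big_mkord; have := subrX1 q N; have := exprn_ge0 N q0; lra.
exists (lim_sup_set G); split => //.
  apply: bigcap_measurable => // n _; apply: bigcup_measurable => m _; exact: mF.
move=> x /= hx n _ /=; apply: contrapT => hn; apply: hx; exists (n + n0)%N => // m /= nm Fm.
apply: hn; exists (m - n0)%N => /=.
  by rewrite -(leq_add2r n0) subnK//; apply: leq_trans nm; rewrite leq_addl.
by rewrite /G subnK//; apply: leq_trans nm; rewrite leq_addl.
Qed.

Lemma measure_bigsetU_le d (T : measurableType d) (R : realType) (mu : {measure set T -> \bar R})
  (I : eqType) (s : seq I) (A : I -> set T) (c : R) : (forall i, measurable (A i)) ->
  (forall i, i \in s -> (mu (A i) <= c%:E)%E) -> (mu (\big[setU/set0]_(i <- s) A i) <= ((size s)%:R * c)%:E)%E.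
Proof.
move=> mA; elim: s => [_|i s IH hs]; first by rewrite big_nil measure0 mul0r.
have mU : measurable (\big[setU/set0]_(j <- s) A j) by exact: bigsetU_measurable.
rewrite big_cons; apply: le_trans (measureU2 mu (mA i) mU) _.
rewrite /= -natr1 mulrDl mul1r addrC EFinD leeD// ?hs ?mem_head// IH// => j js.
by rewrite hs// in_cons js orbT.
Qed.

(** * Averages of an even convex function of quadratic growth *)

Section averages.
Context (R : realType) (L : R -> R) (C K : R).
Hypotheses (Lm : measurable_fun setT L) (L_ge0 : forall s, 0 <= L s)
  (LN : forall s : R, L (- s) = L s) (L0 : L 0 = 0)
  (Lconv : forall x y l : R, 0 <= l <= 1 -> L (l * x + (1 - l) * y) <= l * L x + (1 - l) * L y)
  (C_ge0 : 0 <= C) (K_ge0 : 0 <= K) (Lub : forall s, L s <= C + K * s ^+ 2)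
  (Ldiff : forall x g a e : R, 0 < a -> `|e| <= a / 2 ->
    L (x + e * g) + L (x - e * g) - 2 * L x <=
    16 * (e / a) ^+ 2 * (expR (L (x + a * g) - L x) + expR (L (x - a * g) - L x))).
Local Notation gamma := (normal_prob (0 : R) 1).

(** [u] is a convex combination of [v] and [- v], at which the even function [L] takes the same
    value. *)
Lemma L_mono (u v : R) : `|u| <= `|v| -> L u <= L v.
Proof.
have [->|v0] := eqVneq v 0; first by rewrite normr0 normr_le0 => /eqP ->.
move=> uv; have h : `|u / v| <= 1 by rewrite normrM normfV ler_pdivrMr ?normr_gt0// mul1r.
pose l := (1 + u / v) / 2.
have l01 : 0 <= l <= 1.
  by move: h; rewrite ler_norml => /andP[h1 h2]; rewrite /l; apply/andP; split; lra.
have -> : u = l * v + (1 - l) * (- v) by rewrite /l; field.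
by apply: le_trans (Lconv _ _ l01) _; rewrite LN -mulrDl addrC subrK mul1r.
Qed.

Lemma L_quad_bound s x : `|L (s * x)| <= (C + K * s ^+ 2) * (1 + x ^+ 2).
Proof.
rewrite ger0_norm//; apply: le_trans (Lub _) _.
have h1 := sqr_ge0 x; have h2 : 0 <= C * x ^+ 2 by rewrite mulr_ge0.
have h3 : 0 <= K * s ^+ 2 by rewrite mulr_ge0// sqr_ge0.
by rewrite exprMn; lra.
Qed.

Lemma L_scale_measurable s : measurable_fun setT (fun x : R => L (s * x)).
Proof. by apply: measurableT_comp => //; exact: measurable_funM. Qed.

Lemma L_integrable s : gamma.-integrable setT (EFin \o (fun x => L (s * x))).
Proof. exact: normal_integrable_sqr (L_scale_measurable s) (L_quad_bound s). Qed.

Definition phi s : R := fine (\int[gamma]_x (L (s * x))%:E).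

Lemma phiE s : (\int[gamma]_x (L (s * x))%:E = (phi s)%:E)%E.
Proof. by rewrite /phi fineK//; exact: (integrable_fin_num measurableT (L_integrable s)). Qed.

Lemma phi_ge0 s : 0 <= phi s.
Proof. by rewrite -lee_fin -phiE; apply: integral_ge0 => x _; rewrite lee_fin. Qed.

Lemma phiN s : phi (- s) = phi s.
Proof. by apply: EFin_inj; rewrite -!phiE; apply: eq_integral => x _; rewrite mulNr LN. Qed.

Lemma phi0 : phi 0 = 0.
Proof.
apply: EFin_inj; rewrite -phiE; under eq_integral do rewrite mul0r L0.
by rewrite integral0.
Qed.

Lemma phi_mono (s t : R) : 0 <= s <= t -> phi s <= phi t.
Proof.
move=> /andP[s0 st]; rewrite -lee_fin -!phiE; apply: ge0_le_integral => //.
- by move=> x _; rewrite lee_fin.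
- by apply/measurable_EFinP; exact: L_scale_measurable.
- by apply/measurable_EFinP; exact: L_scale_measurable.
move=> x _; rewrite lee_fin L_mono// !normrM ler_wpM2r// !ger0_norm//.
exact: le_trans st.
Qed.

Lemma phi_comb (a b s t : R) : (\int[gamma]_x (a%:E * (L (s * x))%:E + b%:E * (L (t * x))%:E) =
  (a * phi s + b * phi t)%:E)%E.
Proof.
have i1 := L_integrable s; have i2 := L_integrable t.
rewrite integralD//; last 2 first.
- exact: (integrableZl measurableT a i1).
- exact: (integrableZl measurableT b i2).
by rewrite (integralZl _ i1)// (integralZl _ i2)// !phiE.
Qed.

Lemma phi_convex (x y l : R) : 0 <= l <= 1 -> phi (l * x + (1 - l) * y) <= l * phi x + (1 - l) * phi y.
Proof.
move=> l01; have /andP[l0 l1] := l01; rewrite -lee_fin -phiE -phi_comb.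
apply: ge0_le_integral => //.
- by move=> z _; rewrite lee_fin.
- by apply/measurable_EFinP; exact: L_scale_measurable.
- by apply: emeasurable_funD; apply: emeasurable_funM => //; apply/measurable_EFinP; exact: L_scale_measurable.
move=> z _; rewrite -!EFinM -EFinD lee_fin.
have -> : (l * x + (1 - l) * y) * z = l * (x * z) + (1 - l) * (y * z) by ring.
exact: Lconv.
Qed.

(** The bound on second differences of [L] is integrated in the Gaussian variable. Its right side
    contains exponentials of increments of [L], integrable only if the step [a] is small enough. *)
Lemma phi_second_diff (s : R) : exists2 Q : R, 0 <= Q & exists2 a : R, 0 < a &
  forall e : R, `|e| <= a -> phi (s + e) + phi (s - e) - 2 * phi s <= Q * e ^+ 2.
Proof.
have [Kq Kq0 hKq] := @normal_integral_expR_sqr R.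
pose S : R := `|s| + 1; have S1 : 1 <= S by rewrite /S lerDr.
(* With [a = 1 / B], convexity bounds an increment by [a L ((s + 1) g)] or [a L ((s - 1) g)], hence
   by [C + g^2 / 4], because [a K S^2 <= 1 / 4]. *)
pose B : R := 4 * (K + 1) * S ^+ 2.
have B1 : 1 <= B.
  have : 1 <= S ^+ 2 by rewrite expr_ge1// (le_trans ler01).
  move=> h; have h2 : 0 <= K * S ^+ 2 by rewrite mulr_ge0// sqr_ge0.
  by rewrite /B; lra.
have B0 : 0 < B by exact: lt_le_trans B1.
pose a : R := B^-1; have a0 : 0 < a by rewrite invr_gt0.
have a1 : a <= 1 by rewrite invf_le1.
have hL (t g : R) : `|t - s| = 1 -> L (s * g + a * ((t - s) * g)) - L (s * g) <= C + g ^+ 2 / 4.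
  move=> ts; have -> : s * g + a * ((t - s) * g) = a * (t * g) + (1 - a) * (s * g) by ring.
  have h1 : L (a * (t * g) + (1 - a) * (s * g)) <= a * L (t * g) + (1 - a) * L (s * g).
    by apply: Lconv; rewrite (ltW a0) a1.
  have h2 : 0 <= a * L (s * g) by rewrite mulr_ge0// ltW.
  have tS : `|t| <= S by rewrite /S -ts -[in leLHS](subrK s t) addrC ler_normD.
  have h3 : a * L (t * g) <= a * (C + K * (S ^+ 2 * g ^+ 2)).
    rewrite ler_pM2l//; apply: le_trans (Lub _) _; rewrite lerD2l ler_wpM2l// exprMn ler_wpM2r ?sqr_ge0//.
    by rewrite -real_normK ?num_real// lerXn2r ?nnegrE// (le_trans ler01).
  have h4 : a * C <= C by rewrite -[leRHS]mul1r ler_wpM2r.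
  have h5 : a * (K * (S ^+ 2 * g ^+ 2)) <= g ^+ 2 / 4.
    have hK : a * (K * S ^+ 2) <= 1 / 4.
      rewrite /a mulrC ler_pdivrMr// /B; have := sqr_ge0 S; lra.
    have := ler_wpM2r (sqr_ge0 g) hK; lra.
  rewrite mulrDr in h3; lra.
exists (32 * a^-1 ^+ 2 * expR C * Kq).
  by rewrite mulr_ge0 ?(ltW Kq0)// mulr_ge0 ?expR_ge0// mulr_ge0// sqr_ge0.
exists (a / 2) => [|e ea]; first by rewrite divr_gt0.
have /andP[e1 e2] : - (a / 2) <= e <= a / 2 by rewrite -ler_norml.
have iA := L_integrable (s + e); have iB := L_integrable (s - e).
have iS := integrableZl measurableT (- 2) (L_integrable s).
have iAB := integrableD measurableT iA iB.
have iq := integrableZl measurableT (32 * (e / a) ^+ 2 * expR C) (normal_integrable_expR_sqr R).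
have : (\int[gamma]_x (((L ((s + e) * x))%:E + (L ((s - e) * x))%:E) + (- 2)%:E * (L (s * x))%:E) <=
  \int[gamma]_x ((32 * (e / a) ^+ 2 * expR C)%:E * (expR (x ^+ 2 / 4))%:E))%E.
  apply: le_integral => //; first exact: (integrableD measurableT iAB iS).
  move=> g _; rewrite -!EFinM -!EFinD lee_fin.
  have := Ldiff (s * g) g a0 ea.
  have -> : s * g + e * g = (s + e) * g by ring.
  have -> : s * g - e * g = (s - e) * g by ring.
  have h1 : L (s * g + a * g) - L (s * g) <= C + g ^+ 2 / 4.
    have := hL (s + 1) g; rewrite addrAC subrr add0r mul1r normr1; exact.
  have h2 : L (s * g - a * g) - L (s * g) <= C + g ^+ 2 / 4.
    have := hL (s - 1) g; rewrite addrAC subrr add0r mulN1r mulrN normrN normr1; exact.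
  rewrite -ler_expR in h1; rewrite -ler_expR in h2.
  have q0 : 0 <= 16 * (e / a) ^+ 2 by rewrite mulr_ge0// sqr_ge0.
  have h3 := ler_wpM2l q0 (lerD h1 h2); rewrite (expRD C) in h3.
  by move: h3; move: (expR _) (expR _) (expR C) (expR _) => A1 A2 A3 A4 h3 h4; lra.
rewrite (integralD measurableT iAB iS) (integralD measurableT iA iB) (integralZl _ (L_integrable s))// (integralZl _ (normal_integrable_expR_sqr R))//.
rewrite hKq [X in (X + _ + _ <= _)%E]phiE [X in (_ + X + _ <= _)%E]phiE [X in (_ + _ * X <= _)%E]phiE -!EFinM -!EFinD lee_fin => h.
have -> : phi (s + e) + phi (s - e) - 2 * phi s = phi (s + e) + phi (s - e) + - 2 * phi s by ring.
apply: le_trans h _; rewrite le_eqVlt; apply/orP; left; apply/eqP.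
by move: (expR C) => A; field; rewrite gt_eqF.
Qed.

(** Continuity of a finite convex function, in quantitative form: chords to the points at distance 1
    from [s] give the upper bound. *)
Lemma phi_cont (s e : R) : 0 < e -> exists2 dl : R, 0 < dl & forall t : R, `|t - s| <= dl -> `|phi t - phi s| <= e.
Proof.
move=> e0; pose B := phi (`|s| + 1).
have B0 : 0 <= B by exact: phi_ge0.
pose dl : R := Num.min 1 (e / (B + 1)).
have dl0 : 0 < dl by rewrite lt_min ltr01 divr_gt0//; lra.
have hub u : `|u| <= 1 -> u * 0 = 0 -> phi (s + u) <= phi s + `|u| * B.
  move=> u1 _; have u0 := normr_ge0 u.
  have [u00|un0] := eqVneq u 0; first by rewrite u00 addr0 normr0 mul0r addr0.
  pose v := s + u / `|u|.
  have hv : phi v <= B.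
    have -> : phi v = phi `|v| by case: (leP 0 v) => h; [rewrite ger0_norm | rewrite ltr0_norm// phiN].
    apply: phi_mono; rewrite normr_ge0 /v; apply: le_trans (ler_normD _ _) _.
    by rewrite lerD2l normrM normfV normr_id mulfV// normr_eq0.
  have -> : s + u = `|u| * v + (1 - `|u|) * s by rewrite /v; field; rewrite normr_eq0.
  apply: le_trans (phi_convex _ _ _) _; first by rewrite u0 u1.
  have h1 := ler_wpM2l u0 hv; have h2 : 0 <= `|u| * phi s by rewrite mulr_ge0 ?phi_ge0.
  lra.
exists dl => // t ts.
have t1 : `|t - s| <= 1 by apply: le_trans ts _; rewrite ge_min lexx.
have hB : `|t - s| * B <= e.
  have t2 : `|t - s| <= e / (B + 1) by apply: le_trans ts _; rewrite ge_min lexx orbT.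
  apply: (@le_trans _ _ (e / (B + 1) * B)); first by rewrite ler_wpM2r.
  rewrite mulrAC ler_pdivrMr; last lra.
  by rewrite ler_pM2l//; lra.
have h1 : phi t <= phi s + `|t - s| * B by have := hub (t - s) t1 (mulr0 _); rewrite addrC subrK.
have h2 : phi (s - (t - s)) <= phi s + `|t - s| * B by have := hub (- (t - s)); rewrite normrN; apply => //; rewrite mulr0.
(* [s] is the midpoint of [t] and its reflection, so the upper bound at the reflection yields the
   lower bound at [t]. *)
have h3 : phi s <= 2^-1 * phi t + (1 - 2^-1) * phi (s - (t - s)).
  have {1}-> : s = 2^-1 * t + (1 - 2^-1) * (s - (t - s)) by field.
  by apply: phi_convex; apply/andP; split; lra.
by rewrite ler_norml; apply/andP; split; lra.
Qed.
Definition avgL n (s : R) (x : 'cV[R]_n) : R := n%:R^-1 * \sum_i L (s * x i ord0).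

(* [s x = (1 - h) (s / (1 - h) y) + h (s / h (x - y))] and [L] is convex. *)
Lemma avgL_perturb n (x y : 'cV[R]_n) (s h : R) : (0 < n)%N -> 0 < h < 1 ->
  sqn (x - y) <= h ^+ 2 * n%:R -> avgL s x <= avgL (s / (1 - h)) y + h * (C + K * s ^+ 2).
Proof.
move=> n0 /andP[h0 h1] hxy; have N0 : 0 < n%:R :> R by rewrite ltr0n.
have h1' : 1 - h != 0 by rewrite gt_eqF// subr_gt0.
have pt i : L (s * x i ord0) <= L (s / (1 - h) * y i ord0) + h * C + K * s ^+ 2 / h * (x - y) i ord0 ^+ 2.
  have -> : s * x i ord0 = (1 - h) * (s / (1 - h) * y i ord0) + (1 - (1 - h)) * (s / h * (x - y) i ord0).
    rewrite !mxE; field; rewrite h1' gt_eqF//.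
  apply: le_trans (Lconv _ _ _) _; first by apply/andP; split; lra.
  have a1 : (1 - h) * L (s / (1 - h) * y i ord0) <= L (s / (1 - h) * y i ord0).
    by rewrite ler_piMl//; lra.
  have a2 : (1 - (1 - h)) * L (s / h * (x - y) i ord0) <= h * C + K * s ^+ 2 / h * (x - y) i ord0 ^+ 2.
    have -> : 1 - (1 - h) = h by ring.
    apply: le_trans (ler_wpM2l (ltW h0) (Lub _)) _.
    by rewrite le_eqVlt; apply/orP; left; apply/eqP; field; rewrite gt_eqF.
  by rewrite -addrA; apply: lerD.
rewrite /avgL ler_pdivrMl// mulrDr mulrA mulfV ?gt_eqF// mul1r.
apply: (@le_trans _ _ (\sum_i (L (s / (1 - h) * y i ord0) + h * C + K * s ^+ 2 / h * (x - y) i ord0 ^+ 2))).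
  by apply: ler_sum => i _; exact: pt.
rewrite big_split big_split /= sumr_const card_ord -mulr_sumr -addrA lerD2l -[h * C *+ n]mulr_natl.
have q0 : 0 <= K * s ^+ 2 / h by rewrite divr_ge0 ?(ltW h0)// mulr_ge0// sqr_ge0.
have := ler_wpM2l q0 hxy; rewrite -[\sum_i _]/(sqn (x - y)).
have -> : K * s ^+ 2 / h * (h ^+ 2 * n%:R) = h * (K * s ^+ 2) * n%:R by field; rewrite gt_eqF.
by lra.
Qed.

(** The error of the norm contributes [h sqrt n] and that of the direction [h |G| <= 2 h sqrt n]. *)
Lemma shell_close n (v G : 'cV[R]_n) (h : R) : (0 < n)%N -> 0 < h <= 1 -> sqn v = 1 ->
  aligned h v G -> n%:R * (1 - h) <= sqn G -> sqn G <= n%:R * (1 + h) ->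
  sqn (Num.sqrt n%:R *: v - G) <= (3 * h) ^+ 2 * n%:R.
Proof.
move=> n0 /andP[h0 h1] v1 cl lo hi; have N0 : 0 < n%:R :> R by rewrite ltr0n.
set r := Num.sqrt n%:R; have r0 : 0 < r by rewrite sqrtr_gt0.
have rr : r ^+ 2 = n%:R by rewrite sqr_sqrtr// ler0n.
have ev : enorm v = 1 by rewrite /enorm v1 sqrtr1.
have g0 := enorm_ge0 G.
have up : enorm G <= r * (1 + h).
  rewrite -(@ler_pXn2r _ 2) ?nnegrE//; last by rewrite mulr_ge0 ?(ltW r0)//; lra.
  rewrite enorm_sqr exprMn rr; apply: le_trans hi _; rewrite ler_wpM2l ?(ltW N0)//; nra.
have dn : r * (1 - h) <= enorm G.
  rewrite -(@ler_pXn2r _ 2) ?nnegrE//; last by rewrite mulr_ge0 ?(ltW r0)//; lra.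
  rewrite enorm_sqr exprMn rr; apply: le_trans lo; rewrite ler_wpM2l ?(ltW N0)//; nra.
have cl' : enorm (G - enorm G *: v) <= h * enorm G.
  rewrite -(@ler_pXn2r _ 2) ?nnegrE ?enorm_ge0// ?mulr_ge0 ?(ltW h0)//.
  by rewrite enorm_sqr exprMn enorm_sqr; apply: ltW.
have : enorm (r *: v - G) <= 3 * h * r.
  have -> : r *: v - G = (r - enorm G) *: v + - (G - enorm G *: v) by rewrite scalerBl opprB addrA subrK.
  apply: le_trans (ler_enormD _ _) _; rewrite enormN enormZ ev mulr1.
  have b1 : `|r - enorm G| <= h * r by rewrite ler_norml; apply/andP; split; lra.
  have b2 : h * enorm G <= h * (r * (1 + h)) by rewrite ler_pM2l.
  have b3 : h * (r * (1 + h)) <= h * (r * 2) by rewrite ler_pM2l// ler_pM2l//; lra.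
  by lra.
rewrite -(@ler_pXn2r _ 2) ?nnegrE ?enorm_ge0//; last by rewrite !mulr_ge0 ?(ltW h0) ?(ltW r0).
by rewrite enorm_sqr exprMn rr.
Qed.

Lemma gauss_union n (D D1 D2 : set (borel 'cV[R]_n)) (q1 q2 : R) : measurable D -> measurable D1 -> measurable D2 ->
  D `<=` D1 `|` D2 ->
  (\int[volm R n]_G (\1_D1 G * gaussd G)%:E <= q1%:E)%E ->
  (\int[volm R n]_G (\1_D2 G * gaussd G)%:E <= q2%:E)%E ->
  (\int[volm R n]_G (\1_D G * gaussd G)%:E <= (q1 + q2)%:E)%E.
Proof.
move=> mD mD1 mD2 sub h1 h2; rewrite EFinD; apply: le_trans (leeD h1 h2).
have mf (E : set (borel 'cV[R]_n)) : measurable E -> measurable_fun setT (fun G : borel 'cV[R]_n => (\1_E G * gaussd G)%:E).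
  move=> mE; apply/measurable_EFinP; apply: measurable_funM; first exact: measurable_indic.
  exact: measurable_gaussd.
have f0 (E : set (borel 'cV[R]_n)) G : (0 <= (\1_E G * gaussd G)%:E)%E.
  by rewrite lee_fin mulr_ge0 ?gaussd_ge0// indicE.
rewrite -ge0_integralD//; [|exact: mf|exact: mf].
apply: ge0_le_integral => //; [exact: mf|by apply: emeasurable_funD; exact: mf|].
move=> G _; rewrite -EFinD lee_fin -mulrDl ler_wpM2r ?gaussd_ge0// !indicE.
case: (boolP (G \in D)) => [/set_mem/sub[h|h]|_].
- by rewrite (mem_set h) lerDl.
- by rewrite (mem_set h) lerDr.
- by rewrite addr_ge0.
Qed.

(** Outside two rare events [sqn G / n] is close to its mean 1, so an aligned [G] is close to the
    random point, and [B] forces a deviation of the average of [H] at [G]. The factor 3 counts the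
    rare events. *)
Lemma haar_tail (H : R -> R) (c m e h : R) : measurable_fun setT H ->
  (forall x, `|H x| <= c * (1 + x ^+ 2)) -> (\int[gamma]_x (H x)%:E = m%:E)%E -> 0 < e -> 0 < h <= 1 ->
  exists2 q : R, 0 <= q < 1 & forall n k (kn : (k <= n)%N) (mu : probability (borel (stiefel R kn)) R) (theta : 'cV[R]_k)
    (B : set (borel (stiefel R kn))), is_haar mu -> (0 < n)%N -> sqn theta = 1 -> measurable B ->
    (forall a G, B a -> sqn (Num.sqrt n%:R *: (stiefel_mx kn a *m theta) - G) <= (3 * h) ^+ 2 * n%:R ->
       n%:R * (m + e) <= \sum_i H (G i ord0)) ->
    (mu B <= (3 * q ^+ n)%:E)%E.
Proof.
move=> mH hH Hm e0 /andP[h0 h1].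
have mS : measurable_fun setT (fun x : R => x ^+ 2) by exact: measurable_funX.
have mSN : measurable_fun setT (fun x : R => - x ^+ 2) by exact: measurableT_comp.
have S2 := @normal_second_moment R.
have [q1 /andP[q10 q11] hq1] := gauss_tail mH hH Hm e0.
have [q2 /andP[q20 q21] hq2] : exists2 q : R, 0 <= q < 1 & forall n (D : set (borel 'cV[R]_n)), measurable D ->
    (forall G, D G -> n%:R * (1 + h) <= \sum_i (G i ord0) ^+ 2) ->
    (\int[volm R n]_G (\1_D G * gaussd G)%:E <= (q ^+ n)%:E)%E.
  apply: (@gauss_tail R (fun x => x ^+ 2) 1 1 h mS) => // x.
  by rewrite ger0_norm ?sqr_ge0// mul1r lerDr.
have [q3 /andP[q30 q31] hq3] : exists2 q : R, 0 <= q < 1 & forall n (D : set (borel 'cV[R]_n)), measurable D ->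
    (forall G, D G -> n%:R * (- 1 + h) <= \sum_i - (G i ord0) ^+ 2) ->
    (\int[volm R n]_G (\1_D G * gaussd G)%:E <= (q ^+ n)%:E)%E.
  apply: (@gauss_tail R (fun x => - x ^+ 2) 1 (- 1) h mSN) => //.
    by move=> x; rewrite normrN ger0_norm ?sqr_ge0// mul1r lerDr.
  under eq_integral do rewrite EFinN.
  by rewrite integral_ge0N ?S2// => x _; rewrite lee_fin sqr_ge0.
pose q := Num.max q1 (Num.max q2 q3).
exists q; first by rewrite le_max q10 /= !gt_max q11 q21 q31.
move=> n k kn mu theta B haarmu n0 th1 mB hB.
pose D1 := [set G : borel 'cV[R]_n | n%:R * (m + e) <= \sum_i H (G i ord0)].
pose D2 := [set G : borel 'cV[R]_n | n%:R * (1 + h) <= sqn G].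
pose D3 := [set G : borel 'cV[R]_n | n%:R * (- 1 + h) <= - sqn G].
have mco i : measurable_fun setT (fun G : borel 'cV[R]_n => G i ord0).
  exact: (measurable_coord i (@measurable_id _ (borel 'cV[R]_n) setT)).
have msq : measurable_fun setT (fun G : borel 'cV[R]_n => sqn G).
  exact: (measurable_sqn (@measurable_id _ (borel 'cV[R]_n) setT)).
have mD1 : measurable D1.
  by apply: measurable_ler => //; apply: measurable_sum => i; apply: measurableT_comp.
have mD2 : measurable D2 by exact: measurable_ler.
have mD3 : measurable D3 by apply: measurable_ler => //; exact: measurableT_comp.
have mD23 : measurable (D2 `|` D3) by exact: measurableU.
apply: (@le_trans _ _ (\int[volm R n]_G (\1_(D1 `|` (D2 `|` D3)) G * gaussd G)%:E)%E).
  apply: (haar_le_gauss th1 h0 haarmu n0 mB); first exact: measurableU.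
  move=> a G Ba cl.
  have [g2|g2] := leP (n%:R * (1 + h)) (sqn G); first by right; left.
  have [g3|g3] := leP (n%:R * (- 1 + h)) (- sqn G); first by right; right.
  left; apply: (hB a) => //; apply: shell_close => //.
  - by rewrite h0.
  - by rewrite sqn_stiefel_mul.
  - by lra.
  - exact: ltW.
have le_q q' : 0 <= q' -> q' <= q -> q' ^+ n <= q ^+ n by move=> *; apply: lerXn2r; rewrite ?nnegrE// le_max q10.
have qq1 : q1 <= q by rewrite le_max lexx.
have qq2 : q2 <= q by rewrite !le_max lexx orbT.
have qq3 : q3 <= q by rewrite !le_max lexx !orbT.
apply: le_trans (_ : (_ <= (q ^+ n + (q ^+ n + q ^+ n))%:E)%E) _; last by rewrite lee_fin; lra.
apply: (gauss_union _ mD1 mD23) => //; first exact: measurableU.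
  by apply: le_trans (hq1 n D1 mD1 _) _ => //; rewrite lee_fin le_q.
apply: (gauss_union _ mD2 mD3) => //.
  by apply: le_trans (hq2 n D2 mD2 _) _ => //; rewrite lee_fin le_q.
apply: le_trans (hq3 n D3 mD3 _) _; last by rewrite lee_fin le_q.
by move=> G; rewrite /D3 /= sumrN.
Qed.

Lemma measurable_avgL n k (kn : (k <= n)%N) (theta : 'cV[R]_k) (s r : R) :
  measurable_fun setT (fun a : borel (stiefel R kn) => avgL s (r *: (stiefel_mx kn a *m theta))).
Proof.
apply: measurable_funM => //; apply: measurable_sum => i; apply: measurableT_comp => //.
apply: measurable_funM => //; under eq_fun do rewrite mxE.
apply: measurable_funM => //; apply: measurable_coord; exact: measurable_stiefel_mul.
Qed.

(** Replacing the random point by a nearby [G] costs a factor [1 - t] in [s], absorbed by continuity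
    of [phi]. Upper deviations use [s / (1 - t)]; lower ones use [s (1 - t)] with the two points
    exchanged. *)
Lemma avgL_concentration (s e : R) : 0 < e ->
  exists2 q : R, 0 <= q < 1 & forall n k (kn : (k <= n)%N) (mu : probability (borel (stiefel R kn)) R) (theta : 'cV[R]_k),
    is_haar mu -> (0 < n)%N -> sqn theta = 1 ->
    (mu [set a | (phi s + e < avgL s (Num.sqrt n%:R *: (stiefel_mx kn a *m theta)))%R] <= (3 * q ^+ n)%:E)%E /\
    (mu [set a | (avgL s (Num.sqrt n%:R *: (stiefel_mx kn a *m theta)) < phi s - e)%R] <= (3 * q ^+ n)%:E)%E.
Proof.
move=> e0.
have [dl dl0 hdl] := phi_cont s (divr_gt0 e0 (ltr0n R 4)).
pose A := C + K * s ^+ 2; have A0 : 0 <= A by rewrite addr_ge0// mulr_ge0// sqr_ge0.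
(* The second bound makes the additive error at most [e / 4]; the others keep both modified
   parameters within [dl] of [s]. *)
pose t := Num.min (1 / 2) (Num.min (e / (4 * (A + 1))) (dl / (2 * (`|s| + 1)))).
have s1 : 0 < `|s| + 1 by rewrite ltr_wpDl.
have t0 : 0 < t by rewrite !lt_min divr_gt0//= !divr_gt0// mulr_gt0// ?ltr_wpDl.
have t1 : t <= 1 / 2 by rewrite ge_min lexx.
have t2 : t * A <= e / 4.
  have : t <= e / (4 * (A + 1)) by rewrite !ge_min lexx orbT.
  move=> h; apply: le_trans (ler_wpM2r A0 h) _.
  have -> : e / (4 * (A + 1)) * A = (e / 4) * (A / (A + 1)) by field; rewrite gt_eqF//; lra.
  rewrite ler_piMr//; first by lra.
  by rewrite ler_pdivrMr//; lra.
have t3 : t * `|s| <= dl / 2.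
  have : t <= dl / (2 * (`|s| + 1)) by rewrite !ge_min lexx !orbT.
  move=> h; apply: le_trans (ler_wpM2r (normr_ge0 s) h) _.
  have -> : dl / (2 * (`|s| + 1)) * `|s| = (dl / 2) * (`|s| / (`|s| + 1)) by field; rewrite gt_eqF.
  rewrite ler_piMr//; first by lra.
  by rewrite ler_pdivrMr//; lra.
pose h := t / 3; have h01 : 0 < h <= 1 by rewrite /h; apply/andP; split; lra.
have th : 3 * h = t by rewrite /h; field.
have t01 : 0 < t < 1 by rewrite t0 /=; lra.
have tn0 : 1 - t != 0 by rewrite gt_eqF//; lra.
pose s1' := s / (1 - t); pose s2' := s * (1 - t).
have d1 : `|phi s1' - phi s| <= e / 4.
  apply: hdl; have -> : s1' - s = s * t / (1 - t) by rewrite /s1'; field.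
  rewrite normrM normfV [X in _ / X]gtr0_norm ?ler_pdivrMr; [|lra|lra].
  rewrite normrM (gtr0_norm t0) mulrC; apply: le_trans t3 _; rewrite ler_pM2l//; lra.
have d2 : `|phi s2' - phi s| <= e / 4.
  apply: hdl; have -> : s2' - s = - (t * s) by rewrite /s2'; ring.
  by rewrite normrN normrM (gtr0_norm t0); apply: le_trans t3 _; lra.
move: d1 d2; rewrite !ler_norml => /andP[d1 d1'] /andP[d2 d2'].
have e4 : 0 < e / 4 by rewrite divr_gt0.
have I1 := phiE s1'.
have I2 : (\int[gamma]_x (- L (s2' * x))%:E = (- phi s2')%:E)%E.
  under eq_integral do rewrite EFinN.
  by rewrite integral_ge0N ?(phiE s2')// => x _; rewrite lee_fin.
have [q1 /andP[q10 q11] hq1] := haar_tail (L_scale_measurable s1') (L_quad_bound s1') I1 e4 h01.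
have m2 : measurable_fun setT (fun x : R => - L (s2' * x)) by apply: measurableT_comp => //; exact: L_scale_measurable.
have b2 x : `|- L (s2' * x)| <= (C + K * s2' ^+ 2) * (1 + x ^+ 2) by rewrite normrN; exact: L_quad_bound.
have [q2 /andP[q20 q21] hq2] := haar_tail m2 b2 I2 e4 h01.
exists (Num.max q1 q2); first by rewrite le_max q10 gt_max q11.
move=> n k kn mu theta haarmu n0 th1.
have N0 : 0 < n%:R :> R by rewrite ltr0n.
have mf := measurable_avgL (kn := kn) theta s (Num.sqrt n%:R).
have mono (q' : R) : 0 <= q' -> q' <= Num.max q1 q2 -> ((3 * q' ^+ n)%:E <= (3 * Num.max q1 q2 ^+ n)%:E)%E.
  by move=> *; rewrite lee_fin ler_pM2l// lerXn2r// nnegrE le_max q10.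
split.
- apply: le_trans (mono q1 q10 _); last by rewrite le_max lexx.
  apply: (hq1 n k kn mu theta) => //.
    exact: measurable_ltr.
  move=> a G /= Ba; rewrite th => hG; have := avgL_perturb s n0 t01 hG.
  rewrite -/s1' -/A => hp; rewrite -ler_pdivlMl//.
  by move: Ba hp; rewrite /avgL; lra.
- apply: le_trans (mono q2 q20 _); last by rewrite le_max lexx orbT.
  apply: (hq2 n k kn mu theta) => //.
    exact: measurable_ltr.
  move=> a G /= Ba; rewrite th => hG.
  have hG' : sqn (G - Num.sqrt n%:R *: (stiefel_mx kn a *m theta)) <= t ^+ 2 * n%:R by rewrite -sqnN opprB.
  have := avgL_perturb s2' n0 t01 hG'.
  have -> : s2' / (1 - t) = s by rewrite /s2'; field.
  have A2 : t * (C + K * s2' ^+ 2) <= t * A.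
    rewrite ler_pM2l// lerD2l ler_wpM2l// /s2' exprMn ler_piMr ?sqr_ge0//.
    by rewrite expr_le1//; lra.
  move=> hp; rewrite sumrN -ler_pdivlMl// mulrN.
  by move: Ba hp; rewrite /avgL; lra.
Qed.
Context (k : nat -> nat) (k_le : forall n, (k n <= n.+1)%N).
Hypotheses (k_gt0 : forall n, (0 < k n)%N).
Local Notation A a n w := (Num.sqrt n.+1%:R *: (stiefel_mx (k_le n) (a n) *m w)).

Definition subexponential (N : nat -> nat) := forall c : R, 0 < c ->
  \forall n \near \oo, (N n)%:R <= expR (c * n.+1%:R).

(** All that the deterministic part retains of the random frames. The quantifiers over [e], [s] and
    [d] are inside, so that a single null set serves all of them. *)
Definition typical (a : stiefel_prod R k_le) : Prop := forall e : R, 0 < e < 1 ->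
  exists N : forall n, seq 'cV[R]_(k n), [/\ subexponential (fun n => size (N n)),
    forall n w, w \in N n -> sqn w = 1,
    forall n (v : 'cV_(k n)), exists2 w, w \in N n & (1 - e) * enorm v <= dot w v &
    forall s d : R, 0 < d -> \forall n \near \oo, forall w, w \in N n ->
      `|avgL s (A a n w) - phi s| <= d].

Lemma avgL_mono n (x : 'cV[R]_n) (s t : R) : `|s| <= `|t| -> avgL s x <= avgL t x.
Proof.
move=> st; rewrite /avgL ler_wpM2l ?invr_ge0//; apply: ler_sum => i _.
by apply: L_mono; rewrite !normrM ler_wpM2r.
Qed.

Hypothesis k_ratio : (k n)%:R / n.+1%:R @[n --> \oo] --> (0 : R).

Lemma subexponential_exp (D : nat) (N : nat -> nat) : (forall n, (N n <= D ^ k n)%N) -> subexponential N.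
Proof.
move=> hN c c0; pose l := ln D.+1%:R : R.
have l0 : 0 <= l by rewrite ln_ge0// ler1n.
have d0 : 0 < c / (l + 1) by rewrite divr_gt0// ltr_wpDl.
near=> n.
have n0 : 0 < n.+1%:R :> R by rewrite ltr0n.
have h : (k n)%:R / n.+1%:R <= c / (l + 1).
  near: n; move/cvgr0Pnorm_le : k_ratio => /(_ _ d0); apply: filterS => n.
  by rewrite ger0_norm.
apply: (@le_trans _ _ (D.+1%:R ^+ k n)).
  by rewrite -natrX ler_nat; apply: leq_trans (hN n) _; rewrite leq_exp2r.
rewrite -[D.+1%:R]lnK ?posrE ?ltr0n// -/l -expRM_natl ler_expR.
move: h; rewrite ler_pdivrMr// => h.
apply: (@le_trans _ _ (c / (l + 1) * n.+1%:R * (l + 1))).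
  by apply: ler_pM => //; rewrite lerDl ler01.
by rewrite mulrAC divfK// gt_eqF// ltr_wpDl.
Unshelve. all: end_near. Qed.

Context (sigma_ : forall n, probability (borel (stiefel R (k_le n))) R)
  (sigma_haar : forall n, is_haar (sigma_ n))
  (sigma : probability (stiefel_prod R k_le) R)
  (sigma_marginals : has_marginals sigma sigma_).

Lemma measurable_marginal n (B : set (borel (stiefel R (k_le n)))) : measurable B ->
  measurable [set a : stiefel_prod R k_le | B (a n)].
Proof.
move=> mB; apply: sub_gen_smallest; exists n => //; exists B => //.
by rewrite setTI.
Qed.

Lemma ae_avgL_near (N : forall n, seq 'cV[R]_(k n)) (s d : R) : subexponential (fun n => size (N n)) ->
  (forall n w, w \in N n -> sqn w = 1) -> 0 < d ->
  {ae sigma, forall a, \forall n \near \oo, forall w, w \in N n -> `|avgL s (A a n w) - phi s| <= d}.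
Proof.
move=> sN N1 d0.
have [q /andP[q0 q1] hq] := avgL_concentration s d0.
pose B1 n w : set (borel (stiefel R (k_le n))) :=
  [set a | (phi s + d < avgL s (Num.sqrt n.+1%:R *: (stiefel_mx (k_le n) a *m w)))%R].
pose B2 n w : set (borel (stiefel R (k_le n))) :=
  [set a | (avgL s (Num.sqrt n.+1%:R *: (stiefel_mx (k_le n) a *m w)) < phi s - d)%R].
have mB1 n w : measurable (B1 n w) by apply: measurable_ltr => //; exact: measurable_avgL.
have mB2 n w : measurable (B2 n w) by apply: measurable_ltr => //; exact: measurable_avgL.
pose B n w := B1 n w `|` B2 n w.
have mB n w : measurable (B n w) by exact: measurableU.
pose F n : set (stiefel_prod R k_le) := [set a | (\big[setU/set0]_(w <- N n) B n w) (a n)].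
have mBU n : measurable (\big[setU/set0]_(w <- N n) B n w) by exact: bigsetU_measurable.
(* The net eventually has at most [z ^+ n.+1] points, so the union bound remains a summable multiple
   of [(z q)^n]. *)
have [z [z1 zq]] : exists z : R, 1 < z /\ z * q < 1.
  exists (2 / (1 + q)); split; first by rewrite ltr_pdivlMr; lra.
  by rewrite mulrAC ltr_pdivrMr; lra.
have lz : 0 < ln z by rewrite ln_gt0.
have [n0 _ hn0] := sN _ lz.
have := @borel_cantelli_geometric _ _ R sigma F 6 (z * q) n0 => bc.
have : {ae sigma, forall a, \forall n \near \oo, ~ F n a}.
  apply: bc => [n| | |n n0n] //.
  - exact: measurable_marginal.
  - by rewrite mulr_ge0//; lra.
  apply: (@le_trans _ _ (sigma_ n (\big[setU/set0]_(w <- N n) B n w))).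
    by rewrite le_eqVlt; apply/orP; left; apply/eqP; exact: (sigma_marginals (mBU n)).
  apply: (@le_trans _ _ ((size (N n))%:R * (6 * q ^+ n.+1))%:E).
    apply: measure_bigsetU_le => [w|w wN]; first exact: mB.
    have [h1 h2] := hq n.+1 (k n) (k_le n) (sigma_ n) w (@sigma_haar n) (ltn0Sn n) (N1 n w wN).
    apply: le_trans (measureU2 _ (mB1 n w) (mB2 n w)) _.
    by apply: le_trans (leeD h1 h2) _; rewrite -EFinD lee_fin; lra.
  have := hn0 n n0n; rewrite /= mulrC expRM_natl lnK ?posrE ?(lt_trans _ z1)// => hz.
  have qn : 0 <= q ^+ n.+1 by exact: exprn_ge0.
  rewrite lee_fin mulrCA ler_pM2l//; apply: le_trans (ler_wpM2r qn hz) _.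
  rewrite -exprMn exprS ler_piMl ?(ltW zq)// exprn_ge0// mulr_ge0//; lra.
apply: filterS => a; apply: filterS => n nF w wN; apply: contrapT => /negP; rewrite -ltNge => hd.
apply: nF; rewrite /F /= -bigcup_seq; exists w => //=.
move: hd; rewrite ltr_normr => /orP[h|h]; first by left; rewrite /B1 /= -ltrBrDl.
by right; rewrite /B2 /= ltrBrDr -ltrBrDl -opprB.
Qed.

Lemma sphere_nets (m : nat) : exists N : forall n, seq 'cV[R]_(k n), [/\ subexponential (fun n => size (N n)),
    forall n w, w \in N n -> sqn w = 1 &
    forall n (v : 'cV_(k n)), exists2 w, w \in N n & (1 - m.+2%:R^-1) * enorm v <= dot w v].
Proof.
have m01 : 0 < (m.+2%:R^-1 : R) < 1 by rewrite invr_gt0 ltr0n/= invf_lt1 ?ltr0n// ltr1n.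
have [D hD] := sphere_net m01.
exists (fun n => sval (cid (hD (k n) (k_gt0 n)))); split.
- apply: (@subexponential_exp D) => n; by case: cid => /= s [].
- by move=> n; case: cid => /= s [].
- by move=> n; case: cid => /= s [].
Qed.

(** Almost sure statements are combined only for the countably many parameters [m], [i / M.+1] and
    [1 / j.+1]. A general [|s|] lies between two consecutive grid points, at which [phi] is close to
    [phi s]. *)
Lemma ae_typical : {ae sigma, forall a, typical a}.
Proof.
pose N m := sval (cid (sphere_nets m)).
have [N1 N2 N3] : [/\ forall m, subexponential (fun n => size (N m n)), forall m n w, w \in N m n -> sqn w = 1 &
    forall m n (v : 'cV_(k n)), exists2 w, w \in N m n & (1 - m.+2%:R^-1) * enorm v <= dot w v].
  by split => m; rewrite /N; case: cid => /= s [].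
have d0 (j : nat) : 0 < j.+1%:R^-1 :> R by rewrite invr_gt0.
pose E m i M j (a : stiefel_prod R k_le) := \forall n \near \oo, forall w, w \in N m n ->
   `|avgL (i%:R / M.+1%:R) (A a n w) - phi (i%:R / M.+1%:R)| <= j.+1%:R^-1.
have : {ae sigma, forall a, forall m i M j, E m i M j a}.
  apply: ae_foralln => m; apply: ae_foralln => i; apply: ae_foralln => M; apply: ae_foralln => j.
  exact: (ae_avgL_near _ (N1 m) (N2 m) (d0 j)).
apply: filterS => a Ea e /andP[e0 e1].
have small (x : R) : 0 < x -> exists j : nat, j.+1%:R^-1 <= x.
  move=> x0; exists (Num.truncn x^-1); rewrite -[leRHS]invrK lef_pV2 ?posrE ?invr_gt0 ?ltr0n//.
  by apply: ltW; exact: truncnS_gt.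
have [m hm] := small e e0.
exists (N m); split => //; first exact: N2.
  move=> n v; have [w wN hw] := N3 m n v; exists w => //; apply: le_trans hw.
  rewrite ler_wpM2r ?enorm_ge0// lerD2l lerN2; apply: le_trans hm.
  by rewrite lef_pV2 ?posrE ?ltr0n// ler_nat.
move=> s d d0'; have d2 : 0 < d / 2 by rewrite divr_gt0.
have [dl dl0 hdl] := phi_cont `|s| d2.
have [M hM] := small dl dl0; have [j hj] := small _ d2.
have M0 : 0 < M.+1%:R :> R by rewrite ltr0n.
pose i := Num.truncn (`|s| * M.+1%:R).
have /andP[i1 i2] : i%:R <= `|s| * M.+1%:R < i.+1%:R by apply: truncn_itv; rewrite mulr_ge0.
have lo : i%:R / M.+1%:R <= `|s| by rewrite ler_pdivrMr.
have hi : `|s| <= i.+1%:R / M.+1%:R by rewrite ler_pdivlMr// ltW.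
have gap : i.+1%:R / M.+1%:R = i%:R / M.+1%:R + M.+1%:R^-1 :> R by rewrite -natr1 mulrDl mul1r.
have aux (x y z u : R) : x <= u -> u <= y -> y = x + z -> z <= dl -> `|x - u| <= dl /\ `|y - u| <= dl.
  by move=> *; split; rewrite ler_norml; apply/andP; split; lra.
have [a1 a2] := aux _ _ _ _ lo hi gap hM.
have p1 : `|phi (i%:R / M.+1%:R) - phi `|s| | <= d / 2.
  exact: hdl.
have p2 : `|phi (i.+1%:R / M.+1%:R) - phi `|s| | <= d / 2.
  exact: hdl.
have ps : phi `|s| = phi s by case: (ger0P s) => // _; exact: phiN.
rewrite ps in p1 p2; move: p1 p2; rewrite !ler_norml => /andP[p1 p1'] /andP[p2 p2'].
have i0 : 0 <= i%:R / M.+1%:R :> R by rewrite divr_ge0.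
have i0' : 0 <= i.+1%:R / M.+1%:R :> R by rewrite divr_ge0.
have h1 := Ea m i M j; have h2 := Ea m i.+1 M j.
near=> n => w wN.
have g1 : `|avgL (i%:R / M.+1%:R) (A a n w) - phi (i%:R / M.+1%:R)| <= j.+1%:R^-1.
  by move: w wN; near: n.
have g2 : `|avgL (i.+1%:R / M.+1%:R) (A a n w) - phi (i.+1%:R / M.+1%:R)| <= j.+1%:R^-1.
  by move: w wN {g1}; near: n.
have m1 : avgL (i%:R / M.+1%:R) (A a n w) <= avgL s (A a n w).
  by apply: avgL_mono; rewrite ger0_norm.
have m2 : avgL s (A a n w) <= avgL (i.+1%:R / M.+1%:R) (A a n w).
  by apply: avgL_mono; rewrite [leRHS]ger0_norm.
move: g1 g2; rewrite !ler_norml => /andP[g1 g1'] /andP[g2 g2'].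
have aux2 (x x1 x2 f f1 f2 z : R) : x1 <= x -> x <= x2 -> - z <= x1 - f1 -> x2 - f2 <= z -> z <= d / 2 ->
  - (d / 2) <= f1 - f -> f2 - f <= d / 2 -> - d <= x - f <= d.
  by move=> *; apply/andP; split; lra.
exact: (aux2 _ _ _ _ _ _ _ m1 m2 g1 g2' hj p1 p2').
Unshelve. all: end_near. Qed.
End averages.

(** * Exponential tilting *)

Section gaussian_mean.
Context (R : realType) (p : R) (hp : 2 <= p).
Context d (T : measurableType d) (P : probability T R) (Z : {RV P >-> R}).
Hypothesis Zd : has_density_p p Z.

Local Notation L := (cgf Z).
Let C : R := projT1 (cid2 (cgf_bound hp Zd)).
Let C0 : 0 <= C. Proof. by rewrite /C; case: cid2. Qed.
Let Cub : forall s, L s <= C + p / 2 * s ^+ 2. Proof. by rewrite /C; case: cid2. Qed.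
Let p0 : 0 <= p / 2. Proof. by rewrite divr_ge0//; exact: le_trans hp. Qed.

Definition gphi := phi (cgf Z).

Lemma gphi_ge0 s : 0 <= gphi s.
Proof. exact: (phi_ge0 (measurable_cgf Z) (cgf_ge0 hp Zd) C0 p0 Cub). Qed.

Lemma gphiN s : gphi (- s) = gphi s.
Proof. exact: (phiN (measurable_cgf Z) (cgf_ge0 hp Zd) (cgfN hp Zd) C0 p0 Cub). Qed.

Lemma gphi0 : gphi 0 = 0.
Proof. exact: (phi0 (measurable_cgf Z) (cgf_ge0 hp Zd) (cgf0 hp Zd) C0 p0 Cub). Qed.

Lemma gphiE s : (\int[normal_prob 0 1]_x (L (s * x))%:E = (gphi s)%:E)%E.
Proof. exact: (phiE (measurable_cgf Z) (cgf_ge0 hp Zd) C0 p0 Cub). Qed.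

Lemma gphi_cont (s e : R) : 0 < e ->
  exists2 dl : R, 0 < dl & forall t : R, `|t - s| <= dl -> `|gphi t - gphi s| <= e.
Proof.
exact: (phi_cont (measurable_cgf Z) (cgf_ge0 hp Zd) (cgfN hp Zd) (fun x y l h => cgf_convex hp Zd x y h) C0 p0 Cub).
Qed.

Lemma gphi_second_diff (s : R) : exists2 Q : R, 0 <= Q & exists2 a : R, 0 < a &
  forall e : R, `|e| <= a -> gphi (s + e) + gphi (s - e) - 2 * gphi s <= Q * e ^+ 2.
Proof.
exact: (phi_second_diff (measurable_cgf Z) (cgf_ge0 hp Zd) (fun x y l h => cgf_convex hp Zd x y h) C0 p0 Cub
  (fun x g a e h => @cgf_second_diff _ _ hp _ _ _ _ Zd x g a e h)).
Qed.

Lemma ae_typical_cgf (k : nat -> nat) (k_le : forall n, (k n <= n.+1)%N) (k_gt0 : forall n, (0 < k n)%N)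
  (k_ratio : (k n)%:R / n.+1%:R @[n --> \oo] --> (0 : R))
  (sigma_ : forall n, probability (borel (stiefel R (k_le n))) R)
  (sigma_haar : forall n, is_haar (sigma_ n))
  (sigma : probability (stiefel_prod R k_le) R)
  (sigma_marginals : has_marginals sigma sigma_) : {ae sigma, forall a, typical L a}.
Proof.
exact: (ae_typical (measurable_cgf Z) (cgf_ge0 hp Zd) (cgfN hp Zd) (fun x y l h => cgf_convex hp Zd x y h) C0 p0 Cub k_gt0 k_ratio sigma_haar sigma_marginals).
Qed.
End gaussian_mean.

Section weights.
Context (R : realType) (p : R) (hp : 2 <= p).
Context d (T : measurableType d) (P : probability T R) (Z : {RV P >-> R}).
Hypothesis Zd : has_density_p p Z.
Local Notation L := (cgf Z).
Local Notation c0 := (dens_cst p).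
Let p0 : 0 < p. Proof. exact: lt_le_trans hp. Qed.

Definition psum n (y : 'cV[R]_n) : R := \sum_i `|y i ord0| `^ p.

Definition wexp n (u : 'cV[R]_n) (s l : R) (y : 'cV[R]_n) : R :=
  s * expR l * dot u y - expR (p * l) / p * psum y.

(** The substitution [x -> e^l x] turns the integral into [c0] times the moment generating function
    at [s v]; its Jacobian is the term [- l]. *)
Lemma integral_tilt (v s l : R) :
  (\int[lebesgue_measure]_x (expR (s * expR l * (v * x) - expR (p * l) / p * `|x| `^ p))%:E =
   (expR (ln c0 - l + L (s * v)))%:E)%E.
Proof.
have cg := dens_cst_gt0 Zd.
pose f (x : R) : \bar R := (expR (s * v * x) * expR (- (`|x| `^ p / p)))%:E.
have mf : measurable_fun setT f.
  by apply/measurable_EFinP; apply: measurable_funM; [exact: measurable_expR_lin|exact: measurable_expR_powR].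
have -> : (fun x : R => (expR (s * expR l * (v * x) - expR (p * l) / p * `|x| `^ p))%:E) =
  (fun x => f (expR l * x + 0)).
  apply/funext => x; rewrite /f -expRD addr0; congr (expR _)%:E; congr (_ + - _); first by ring.
  rewrite normrM (gtr0_norm (expR_gt0 l)) powRM ?normr_ge0 ?expR_ge0// -expRM mulrC (mulrC p).
  by rewrite mulrCA mulrA.
rewrite ge0_integral_affine//; [|by rewrite gt_eqF ?expR_gt0|by move=> x; rewrite lee_fin mulr_ge0 ?expR_ge0].
rewrite /f (integral_density Zd (f := fun x => expR (s * v * x))); [|exact: measurable_expR_lin|by move=> x; exact: expR_ge0].
rewrite (mgfE hp Zd) -(expR_cgf hp Zd) gtr0_norm ?expR_gt0// -expRN -!EFinM; congr EFin.
by rewrite !expRD lnK ?posrE//; ring.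
Qed.

Lemma wexpE n (u : 'cV[R]_n) s l y : expR (wexp u s l y) =
  \prod_i expR (s * expR l * (u i ord0 * y i ord0) - expR (p * l) / p * `|y i ord0| `^ p).
Proof. by rewrite -expR_sum big_split /= sumrN -!mulr_sumr. Qed.

Lemma measurable_dot n (u : 'cV[R]_n) : measurable_fun setT (fun y : borel 'cV[R]_n => dot u y).
Proof.
apply: measurable_sum => i; apply: measurable_funM => //.
exact: (measurable_coord i (@measurable_id _ (borel 'cV[R]_n) setT)).
Qed.

Lemma measurable_psum n : measurable_fun setT (fun y : borel 'cV[R]_n => psum y).
Proof.
apply: measurable_sum => i; apply: measurableT_comp (measurable_powR_norm p) _.
exact: (measurable_coord i (@measurable_id _ (borel 'cV[R]_n) setT)).
Qed.

Lemma measurable_wexp n (u : 'cV[R]_n) s l :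
  measurable_fun setT (fun y : borel 'cV[R]_n => wexp u s l y).
Proof.
by apply: measurable_funB; apply: measurable_funM => //; [exact: measurable_dot|exact: measurable_psum].
Qed.

Lemma measurable_expR_wexp n (u : 'cV[R]_n) s l :
  measurable_fun setT (fun y : borel 'cV[R]_n => (expR (wexp u s l y))%:E).
Proof. by apply/measurable_EFinP; apply: measurableT_comp => //; exact: measurable_wexp. Qed.

Lemma integral_weight n (u : 'cV[R]_n.+1) s l :
  (\int[volm R n.+1]_y (expR (wexp u s l y))%:E =
   (expR (n.+1%:R * (ln c0 - l + avgL L s u)))%:E)%E.
Proof.
under eq_integral do rewrite wexpE.
rewrite (integral_volm_prod (h := fun i x => expR (s * expR l * (u i ord0 * x) - expR (p * l) / p * `|x| `^ p))
  (c := fun i => expR (ln c0 - l + L (s * u i ord0)))).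
- rewrite -expR_sum; congr (expR _)%:E; rewrite big_split /= sumr_const card_ord /avgL mulrDr mulrA mulfV ?mul1r ?pnatr_eq0//.
  by rewrite mulr_natl.
- move=> i; apply: measurableT_comp => //; apply: measurable_funB.
    by apply: measurable_funM => //; exact: measurable_funM.
  by apply: measurable_funM => //; exact: measurable_powR_norm.
- by move=> i x; exact: expR_ge0.
- by move=> i; rewrite integral_tilt.
Qed.

(** Markov's inequality with a weight as test function. Besides [f = 1], it is applied with [f]
    another weight, which compares two tilts. *)
Lemma chernoff_volm n (D : set (borel 'cV[R]_n.+1)) (f : borel 'cV[R]_n.+1 -> R) (u : 'cV[R]_n.+1) (s l x : R) : measurable D ->
  measurable_fun setT f -> (forall y, 0 <= f y) ->
  (forall y, D y -> f y <= expR (wexp u s l y - n.+1%:R * x)) ->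
  (\int[volm R n.+1]_(y in D) (f y)%:E <= (expR (n.+1%:R * (ln c0 - l + avgL L s u - x)))%:E)%E.
Proof.
move=> mD mf f0 hD; rewrite mulrBr expRD EFinM -integral_weight muleC.
have me := measurable_expR_wexp u s l.
have mce : measurable_fun setT (fun y : borel 'cV[R]_n.+1 => ((expR (- (n.+1%:R * x)))%:E * (expR (wexp u s l y))%:E)%E).
  exact: emeasurable_funM.
rewrite -ge0_integralZl//.
apply: (@le_trans _ _ (\int[volm R n.+1]_(y in D) ((expR (- (n.+1%:R * x)))%:E * (expR (wexp u s l y))%:E))%E).
  apply: ge0_le_integral => //.
  - by move=> y _; rewrite lee_fin.
  - by apply/measurable_EFinP; exact: measurable_funTS.
  - exact: measurable_funTS.
  - by move=> y Dy; rewrite -EFinM lee_fin -expRD addrC hD.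
exact: ge0_subset_integral.
Qed.

Lemma chernoff_volume n (D : set (borel 'cV[R]_n.+1)) (u : 'cV[R]_n.+1) (s l x : R) : measurable D ->
  (forall y, D y -> n.+1%:R * x <= wexp u s l y) ->
  (volm R n.+1 D <= (expR (n.+1%:R * (ln c0 - l + avgL L s u - x)))%:E)%E.
Proof.
move=> mD hD; rewrite -[leLHS]mul1e -integral_cst//.
apply: (chernoff_volm (f := cst 1)) => //= y /hD h.
by rewrite -[leLHS]expR0 ler_expR subr_ge0.
Qed.
End weights.

Lemma avgL0 (R : realType) (L : R -> R) n (x : 'cV[R]_n) : L 0 = 0 -> avgL L 0 x = 0.
Proof. by move=> L0; rewrite /avgL big1 ?mulr0// => i _; rewrite mul0r. Qed.

Lemma wexpB (R : realType) (p : R) n (u : 'cV[R]_n) (s l s' l' : R) y : wexp p u s' l' y - wexp p u s l y =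
  (s' * expR l' - s * expR l) * dot u y - (expR (p * l') - expR (p * l)) / p * psum p y.
Proof. by rewrite /wexp; ring. Qed.

Lemma wexpD (R : realType) (p : R) n (u : 'cV[R]_n) (s l : R) y :
  wexp p u s l y = s * expR l * dot u y - expR (p * l) / p * psum p y.
Proof. by []. Qed.

Opaque avgL wexp psum dot dens_cst cgf.

(** * Strict gains from small changes of scale *)

Section dilation_slack.
Context (R : realType) (phi : R -> R) (p s m Q a : R).
Hypotheses (p0 : 2 <= p) (s0 : 0 <= s) (m0 : 0 <= m) (Q0 : 0 <= Q) (a0 : 0 < a).
Hypothesis hphi : forall e, `|e| <= a -> phi (s + e) <= phi s + m * e + Q * e ^+ 2.

(** To first order in [e] the two sides are [(1 + s m) e] and [B e]. The gain makes a large [psum]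
    unlikely under a weight with [expR (p l) = B]. *)
Lemma contraction_slack (B : R) : 1 + s * m < B -> exists2 e : R, 0 < e &
  e + phi (s * expR e) - phi s < B * (1 - expR (- (p * e))) / p.
Proof.
move=> Bl; have pp : 0 < p by exact: lt_le_trans p0.
have sm0 : 0 <= s * m by exact: mulr_ge0.
have B0 : 0 < B by lra.
have a1 : 0 < Num.min (a / (4 * s + 1)) (1 / (2 * p)).
  by rewrite lt_min !divr_gt0// ?mulr_gt0// ltr_wpDl// mulr_ge0.
(* The coefficient of [e^2] collects the errors of [k1], [k2] and [k3]. *)
have c10 : 0 <= 2 * (m * s) + 9 * Q * s ^+ 2 + 2 * p * B.
  by rewrite !addr_ge0 ?mulr_ge0 ?sqr_ge0 ?(ltW pp) ?(ltW B0).
have [e /andP[e0 ea] he] := small_step Bl c10 a1; exists e => //.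
move: ea; rewrite le_min => /andP[ea1 ea2].
have pe : p * e <= 1 / 2 by move: ea2; rewrite ler_pdivlMr ?mulr_gt0//; lra.
have e12 : e <= 1 / 2 by apply: le_trans pe; rewrite ler_peMl ?(ltW e0)//; apply: le_trans p0; lra.
have /andP[b1 b2] := @expR_bounds _ e ltac:(by rewrite gtr0_norm).
have /andP[b3 b4] := @expR_bounds _ (- (p * e)) ltac:(by rewrite normrN gtr0_norm ?mulr_gt0).
pose y := expR e - 1; have y0 : 0 <= y by rewrite /y; lra.
have y1 : y <= e + 2 * e ^+ 2 by rewrite /y; lra.
have y2 : y <= 3 * e by nra.
have := hphi (e := s * y).
have -> : s + s * y = s * expR e by rewrite /y; ring.
have sy : `|s * y| <= a.
  rewrite ger0_norm ?mulr_ge0//; move: ea1; rewrite ler_pdivlMr ?ltr_wpDl ?mulr_ge0// => ea1.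
  by have := ler_wpM2l s0 y2; nra.
move=> /(_ sy) hy.
have k1 : m * (s * y) <= m * s * (e + 2 * e ^+ 2) by rewrite mulrA ler_wpM2l// mulr_ge0.
have k2 : Q * (s * y) ^+ 2 <= Q * (s ^+ 2 * (9 * e ^+ 2)).
  rewrite ler_wpM2l// exprMn ler_wpM2l ?sqr_ge0//.
  by rewrite (_ : 9 * e ^+ 2 = (3 * e) ^+ 2); [rewrite lerXn2r// nnegrE; lra|ring].
have k3 : B * (e - 2 * p * e ^+ 2) <= B * (1 - expR (- (p * e))) / p.
  rewrite -[leRHS]mulrA; apply: (ler_wpM2l (ltW B0)); rewrite ler_pdivlMr//; lra.
lra.
Qed.

(** The same expansion with the opposite sign of [e]: the gain is [g e] to first order, and it makes
    a small [psum] unlikely. *)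
Lemma dilation_slack (g : R) : 0 < g -> exists2 e : R, 0 < e &
  - e + phi (s * expR (- e)) - phi s < - ((1 + s * m - g) * ((expR (p * e) - 1) / p)).
Proof.
move=> g0; have pp : 0 < p by exact: lt_le_trans p0.
have sm0 : 0 <= s * m by exact: mulr_ge0.
have a1 : 0 < Num.min (a / (s + 1)) (1 / (2 * p)).
  by rewrite lt_min !divr_gt0// ?mulr_gt0// ltr_wpDl.
have c10 : 0 <= 2 * (m * s) + Q * s ^+ 2 + 2 * p * (1 + s * m).
  by rewrite !addr_ge0 ?mulr_ge0 ?sqr_ge0 ?(ltW pp)// addr_ge0.
have [e /andP[e0 ea] he] := small_step g0 c10 a1; exists e => //.
move: ea; rewrite le_min => /andP[ea1 ea2].
have pe : p * e <= 1 / 2 by move: ea2; rewrite ler_pdivlMr ?mulr_gt0//; lra.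
have e12 : e <= 1 / 2 by apply: le_trans pe; rewrite ler_peMl ?(ltW e0)//; apply: le_trans p0; lra.
have /andP[b1 b2] := @expR_bounds _ (- e) ltac:(by rewrite normrN gtr0_norm).
have /andP[b3 b4] := @expR_bounds _ (p * e) ltac:(by rewrite gtr0_norm ?mulr_gt0).
pose y := 1 - expR (- e); have y1 : y <= e by rewrite /y; lra.
have y0 : 0 <= y by rewrite /y subr_ge0 -[leRHS]expR0 ler_expR oppr_le0 ltW.
have y2 : e - 2 * e ^+ 2 <= y by rewrite /y; lra.
have := hphi (e := - (s * y)).
have -> : s - s * y = s * expR (- e) by rewrite /y; ring.
have sy : `|- (s * y)| <= a.
  rewrite normrN ger0_norm ?mulr_ge0//; move: ea1; rewrite ler_pdivlMr ?ltr_wpDl// => ea1.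
  by have := ler_wpM2l s0 y1; nra.
move=> /(_ sy) hy.
have k1 : m * s * (e - 2 * e ^+ 2) <= m * (s * y) by rewrite [leRHS]mulrA ler_wpM2l// mulr_ge0.
have k2 : Q * (- (s * y)) ^+ 2 <= Q * (s ^+ 2 * e ^+ 2).
  rewrite ler_wpM2l// sqrrN exprMn ler_wpM2l ?sqr_ge0//.
  by rewrite lerXn2r// nnegrE; lra.
pose z := (expR (p * e) - 1) / p.
have z1 : e <= z by rewrite /z ler_pdivlMr//; lra.
have z2 : z <= e + 2 * p * e ^+ 2 by rewrite /z ler_pdivrMr//; lra.
have k3 : (1 + s * m) * z <= (1 + s * m) * (e + 2 * p * e ^+ 2) by rewrite ler_wpM2l// addr_ge0.
have k4 : g * e <= g * z by rewrite ler_pM2l.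
rewrite -/z; lra.
Qed.
End dilation_slack.

(* The weight is contracted by [expR (- si)], so that [psum p y / n] concentrates near
   [expR (- (p * si)) < 1]; each of the four complementary events is exponentially
   unlikely, by comparison with a weight of slightly different parameters. *)
Section tilt.
Context (R : realType) (p : R) (hp : 2 <= p).
Context d (T : measurableType d) (P : probability T R) (Z : {RV P >-> R}).
Hypothesis Zd : has_density_p p Z.
Local Notation L := (cgf Z).
Local Notation c0 := (dens_cst p).
Context (phi : R -> R) (u : forall n, 'cV[R]_n.+1).
Hypothesis hu : forall s e : R, 0 < e -> \forall n \near \oo, `|avgL L s (u n) - phi s| <= e.

Local Notation q n s l := (fun y : borel 'cV[R]_n.+1 => (expR (wexp p (u n) s l y))%:E).

(** On [D n] the first weight is at most [expR (- n.+1 x)] times the second, whose mass is explicit;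
    the gap makes the quotient of masses exponentially small. With 1/8 each, four such events take
    at most half of the mass. *)
Lemma bad_event_near (s l s' l' x : R) (D : forall n, set (borel 'cV[R]_n.+1)) :
  (forall n, measurable (D n)) ->
  (forall n y, D n y -> n.+1%:R * x <= wexp p (u n) s' l' y - wexp p (u n) s l y) ->
  l + phi s' - x - l' < phi s ->
  \forall n \near \oo, (\int[volm R n.+1]_(y in D n) q n s l y <=
    (expR (n.+1%:R * (ln c0 - l + avgL L s (u n))) / 8)%:E)%E.
Proof.
move=> mD hD gap; pose g := phi s - (l + phi s' - x - l'); have g0 : 0 < g by rewrite subr_gt0.
have g4 : 0 < g / 4 by rewrite divr_gt0.
have n8 : \forall n \near \oo, ln 8 <= n.+1%:R * (g / 2).
  exists (Num.truncn (ln 8 / (g / 2))) => // n /= hn; rewrite -ler_pdivrMr ?divr_gt0//.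
  by apply/ltW/(lt_le_trans (truncnS_gt _)); rewrite ler_nat ltnS.
have [/= hs hs'] := (hu s g4, hu s' g4); move: hs hs' n8; apply: filterS3 => n.
move=> /dist_bounds[a1 _] /dist_bounds[_ a2] n8.
have mq (a b : R) : measurable_fun setT (fun y : borel 'cV[R]_n.+1 => expR (wexp p (u n) a b y)).
  by apply: measurableT_comp => //; exact: measurable_wexp.
apply: le_trans (chernoff_volm hp Zd (s := s') (l := l') (x := x) (u := u n) (mD n) (mq s l) _ _) _.
- by move=> y; exact: expR_ge0.
- by move=> y /hD h; rewrite ler_expR lerBrDr addrC -lerBrDr.
have e8 : 8 = expR (ln 8) :> R by rewrite lnK ?posrE.
rewrite lee_fin ler_pdivlMr// [X in _ * X]e8 -expRD ler_expR.
apply: le_trans (lerD (lexx _) n8) _; rewrite -mulrDr ler_pM2l ?ltr0n//.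
by move: a1 a2; rewrite /g; move: (avgL L s (u n)) (avgL L s' (u n)) => A B; lra.
Qed.

(** At least half of the mass of the weight lies on the good event, where the weight is at most a
    known constant; dividing one by the other bounds the volume from below. *)
Lemma tilt_volume (s l m r1 eps Q a : R) : 0 <= s -> 0 <= m -> 0 <= Q -> 0 < a ->
  (forall e, `|e| <= a -> phi (s + e) <= phi s + m * e + Q * e ^+ 2) ->
  expR (p * l) = 1 + s * m -> r1 < m * expR (- l) -> 0 < eps ->
  \forall n \near \oo, ((expR (n.+1%:R * (ln c0 - (s * m - expR (p * l) / p + l - phi s) - eps)))%:E <=
    volm R n.+1 [set y : borel 'cV[R]_n.+1 | (n.+1%:R * r1 < dot (u n) y /\ psum p y <= n.+1%:R)%R])%E.
Proof.
move=> s0 m0 Q0 a0 hphi hl hr1 eps0.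
have p0 : 0 < p by apply: lt_le_trans hp.
have quarter (x : R) : x / 8 + (x / 8 + (x / 8 + x / 8)) = x / 2 by field.
have r1l : r1 * expR l < m by rewrite -ltr_pdivlMr ?expR_gt0// -expRN.
pose w := `|r1 * expR l|; have w0 : 0 <= w by exact: normr_ge0.
(* The contraction must cost at most [eps / 8], stay in the range of [expR_bounds], and keep the
   tilted mean [m e^-(l + si)] of [dot / n.+1] above [r1]. *)
pose si : R := Num.min (Num.min (eps / 8) (1 / 2)) ((m - r1 * expR l) / (4 * (w + 1))).
have si0 : 0 < si.
  by rewrite !lt_min !divr_gt0 ?subr_gt0// mulr_gt0// ltr_wpDl.
have si1 : si <= eps / 8 by rewrite !ge_min lexx.
have si2 : si <= 1 / 2 by rewrite !ge_min lexx orbT.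
have hsi : r1 * expR (l + si) < m.
  have : si <= (m - r1 * expR l) / (4 * (w + 1)) by rewrite ge_min lexx orbT.
  rewrite ler_pdivlMr ?mulr_gt0 ?ltr_wpDl// => h.
  have /andP[e1 e2] := @expR_bounds _ si ltac:(by rewrite gtr0_norm).
  have h1 : r1 * expR l * (expR si - 1) <= w * (2 * si).
    apply: le_trans (ler_norm _) _; rewrite normrM -/w ler_wpM2l// ger0_norm; last by lra.
    by nra.
  rewrite expRD mulrA; have := mulr_gt0 si0 (ltr_wpDl w0 ltr01); lra.
pose l' := l + si; pose B := expR (p * l').
have B0 : 0 < B by exact: expR_gt0.
have Bl : 1 + s * m < B by rewrite -hl /B ltr_expR ltr_pM2l// /l' ltrDl.
have el0 : 0 < expR l' by exact: expR_gt0.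
have sm0 : 0 <= s * m by exact: mulr_ge0.
(* [h1] and [h2] are the widths allowed beyond the tilted means of [dot / n.+1] and [psum / n.+1];
   each costs at most [eps / 8] in the exponent. *)
pose h1 : R := eps / (8 * (s * expR l' + 1)).
have sl0 : 0 <= s * expR l' by rewrite mulr_ge0 ?(ltW el0).
have h10 : 0 < h1 by rewrite divr_gt0// mulr_gt0// ltr_wpDl.
pose h2 : R := eps / (8 * (B / p + 1)).
have Bp0 : 0 < B / p by rewrite divr_gt0.
have h20 : 0 < h2 by rewrite divr_gt0// mulr_gt0// ltr_wpDl// ltW.
have sh1 : s * expR l' * h1 <= eps / 8.
  rewrite /h1 mulrA ler_pdivrMr ?mulr_gt0 ?ltr_wpDl//; nra.
have Bh2 : B / p * h2 <= eps / 8.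
  rewrite /h2 mulrA ler_pdivrMr ?mulr_gt0 ?ltr_wpDl// ?(ltW Bp0)//; nra.
pose xhi : R := m * expR (- l') + h1; pose tlo : R := expR (- (p * si)) - h2.
have xhiE : expR l' * xhi = m + expR l' * h1.
  by rewrite /xhi mulrDr mulrCA -expRD subrr expR0 mulr1.
have tloE : B * tlo = 1 + s * m - B * h2.
  have -> : 1 + s * m = B * expR (- (p * si)) by rewrite -hl /B -expRD; congr expR; rewrite /l'; ring.
  by rewrite /tlo mulrBr.
pose D1 n := [set y : borel 'cV[R]_n.+1 | (n.+1%:R * xhi <= dot (u n) y)%R].
pose D2 n := [set y : borel 'cV[R]_n.+1 | (dot (u n) y <= n.+1%:R * r1)%R].
pose D3 n := [set y : borel 'cV[R]_n.+1 | (n.+1%:R <= psum p y)%R].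
pose D4 n := [set y : borel 'cV[R]_n.+1 | (psum p y <= n.+1%:R * tlo)%R].
have mD1 n : measurable (D1 n) by apply: measurable_ler => //; exact: measurable_dot.
have mD2 n : measurable (D2 n) by apply: measurable_ler => //; exact: measurable_dot.
have mD3 n : measurable (D3 n) by apply: measurable_ler => //; exact: measurable_psum.
have mD4 n : measurable (D4 n) by apply: measurable_ler => //; exact: measurable_psum.
pose A n := expR (n.+1%:R * (ln c0 - l' + avgL L s (u n))).
have near1 : \forall n \near \oo, (\int[volm R n.+1]_(y in D1 n) q n s l' y <= (A n / 8)%:E)%E.
  have [e /andP[e0 ea] he] := small_step (x := m) (z := m + expR l' * h1) (ltr_pwDr (mulr_gt0 el0 h10) (lexx m)) Q0 a0.
  apply: (bad_event_near (s' := s + e) (l' := l') (x := e * expR l' * xhi) mD1) => [n y|].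
    rewrite /D1 /= => h; rewrite wexpB subrr !mul0r subr0 -mulrBl addrAC subrr add0r.
    by rewrite mulrCA ler_pM2l// mulr_gt0.
  have := hphi e; rewrite (gtr0_norm e0) => /(_ ea).
  by rewrite -mulrA xhiE; lra.
have near2 : \forall n \near \oo, (\int[volm R n.+1]_(y in D2 n) q n s l' y <= (A n / 8)%:E)%E.
  have [e /andP[e0 ea] he] := small_step (x := - m) (z := - (r1 * expR l')) (eq_ind_r is_true hsi (ltrN2 _ _)) Q0 a0.
  apply: (bad_event_near (s' := s - e) (l' := l') (x := - (e * expR l' * r1)) mD2) => [n y|].
    rewrite /D2 /= => h; rewrite wexpB subrr !mul0r subr0 -mulrBl addrAC subrr add0r !mulNr.
    by rewrite mulrN lerN2 mulrCA ler_pM2l// mulr_gt0.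
  have := hphi (- e); rewrite normrN (gtr0_norm e0) sqrrN => /(_ ea).
  by lra.
(* The parameters [(s e^e, l' - e)] leave the coefficient of [dot] unchanged, so the two weights
   differ through [psum] alone. *)
have near3 : \forall n \near \oo, (\int[volm R n.+1]_(y in D3 n) q n s l' y <= (A n / 8)%:E)%E.
  have [e e0 he] := contraction_slack hp s0 m0 Q0 a0 hphi Bl.
  apply: (bad_event_near (s' := s * expR e) (l' := l' - e) (x := B * (1 - expR (- (p * e))) / p) mD3) => [n v|].
    have E1 : s * expR e * expR (l' - e) = s * expR l' by rewrite -mulrA -expRD addrC subrK.
    have E2 : expR (p * (l' - e)) = B * expR (- (p * e)) by rewrite mulrBr expRD.
    rewrite /D3 /= wexpB E1 E2 -/B subrr mul0r sub0r => h.
    rewrite [leRHS](_ : _ = B * (1 - expR (- (p * e))) / p * psum p v); last by ring.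
    rewrite mulrC ler_wpM2l//; rewrite divr_ge0 ?mulr_ge0 ?(ltW B0) ?(ltW p0)// subr_ge0.
    by rewrite -[leRHS]expR0 ler_expR oppr_le0 mulr_ge0 ?(ltW p0) ?(ltW e0).
  rewrite -subr_lt0; move: he; rewrite -subr_lt0; congr (_ < _); ring.
have near4 : \forall n \near \oo, (\int[volm R n.+1]_(y in D4 n) q n s l' y <= (A n / 8)%:E)%E.
  have [e e0 he] := dilation_slack hp s0 m0 Q0 a0 hphi (mulr_gt0 B0 h20).
  apply: (bad_event_near (s' := s * expR (- e)) (l' := l' + e) (x := - (B * (expR (p * e) - 1) / p * tlo)) mD4) => [n v|].
    have E1 : s * expR (- e) * expR (l' + e) = s * expR l' by rewrite -mulrA -expRD addrC addrK.
    have E2 : expR (p * (l' + e)) = B * expR (p * e) by rewrite mulrDr expRD.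
    rewrite /D4 /= wexpB E1 E2 -/B subrr mul0r sub0r => h.
    rewrite [leRHS](_ : _ = - (B * (expR (p * e) - 1) / p * psum p v)); last by ring.
    rewrite mulrN lerN2 mulrCA ler_wpM2l//; rewrite divr_ge0 ?mulr_ge0 ?(ltW B0) ?(ltW p0)// subr_ge0.
    by rewrite -[leLHS]expR0 ler_expR mulr_ge0 ?(ltW p0) ?(ltW e0).
  have -> : B * (expR (p * e) - 1) / p * tlo = B * tlo * ((expR (p * e) - 1) / p) by ring.
  rewrite tloE -subr_lt0; move: he; rewrite -subr_lt0; congr (_ < _); ring.
have mq n : measurable_fun setT (q n s l') by exact: measurable_expR_wexp.
have q0 n y : (0 <= q n s l' y)%E by rewrite lee_fin expR_ge0.
pose E n := [set y : borel 'cV[R]_n.+1 | n.+1%:R * r1 < dot (u n) y /\ psum p y <= n.+1%:R].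
have mE n : measurable (E n).
  apply: measurableI; first by apply: measurable_ltr => //; exact: measurable_dot.
  by apply: measurable_ler => //; exact: measurable_psum.
pose G n := E n `&` ([set y : borel 'cV[R]_n.+1 | dot (u n) y < n.+1%:R * xhi] `&`
   [set y : borel 'cV[R]_n.+1 | n.+1%:R * tlo < psum p y]).
have mG n : measurable (G n).
  apply: measurableI => //; apply: measurableI; first by apply: measurable_ltr => //; exact: measurable_dot.
  by apply: measurable_ltr => //; exact: measurable_psum.
pose W n := expR (n.+1%:R * (s * expR l' * xhi - B / p * tlo)).
have hG n : (\int[volm R n.+1]_(y in G n) q n s l' y <= (W n)%:E * volm R n.+1 (E n))%E.
  apply: (@le_trans _ _ (\int[volm R n.+1]_(y in G n) (W n)%:E)%E).
    apply: ge0_le_integral => //; first by apply: measurable_funTS.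
    move=> y [_ [/ltW /= g1 /ltW /= g2]]; rewrite lee_fin ler_expR /W mulrBr.
    rewrite wexpD -/B; apply: lerB.
      by rewrite mulrCA; apply: ler_wpM2l.
    by rewrite mulrCA; apply: ler_wpM2l => //; exact: ltW.
  rewrite integral_cst//; apply: lee_wpmul2l; first by rewrite lee_fin expR_ge0.
  by apply: le_measure; rewrite ?inE//; apply: subIsetl.
have cover n : G n `|` (D1 n `|` (D2 n `|` (D3 n `|` D4 n))) = setT.
  apply/seteqP; split => // y _; rewrite /G /E /D1 /D2 /D3 /D4 /=.
  have [h|h] := leP (n.+1%:R * xhi) (dot (u n) y); first by right; left.
  have [h'|h'] := leP (dot (u n) y) (n.+1%:R * r1); first by right; right; left.
  have [g|g] := leP n.+1%:R (psum p y); first by right; right; right; left.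
  have [g'|g'] := leP (psum p y) (n.+1%:R * tlo); first by right; right; right; right.
  by left; split; [split => //; exact: ltW|].
have sumq n : ((A n)%:E <= (W n)%:E * volm R n.+1 (E n) + (\int[volm R n.+1]_(y in D1 n) q n s l' y +
   (\int[volm R n.+1]_(y in D2 n) q n s l' y + (\int[volm R n.+1]_(y in D3 n) q n s l' y + \int[volm R n.+1]_(y in D4 n) q n s l' y))))%E.
  rewrite /A -(integral_weight hp Zd (u n) s l') -(cover n).
  have mU4 : measurable (D3 n `|` D4 n) by exact: measurableU.
  have mU3 : measurable (D2 n `|` (D3 n `|` D4 n)) by exact: measurableU.
  have mU2 : measurable (D1 n `|` (D2 n `|` (D3 n `|` D4 n))) by exact: measurableU.
  apply: le_trans (ge0_le_integral_setU _ (mG n) mU2 (mq n) (q0 n)) _; apply: leeD; first exact: hG.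
  apply: le_trans (ge0_le_integral_setU _ (mD1 n) mU3 (mq n) (q0 n)) _; rewrite leeD2l//.
  apply: le_trans (ge0_le_integral_setU _ (mD2 n) mU4 (mq n) (q0 n)) _; rewrite leeD2l//.
  exact: (ge0_le_integral_setU _ (mD3 n) (mD4 n) (mq n) (q0 n)).
have e8 : 0 < eps / 8 by rewrite divr_gt0.
have n2 : \forall n \near \oo, ln 2 <= n.+1%:R * (eps / 8).
  exists (Num.truncn (ln 2 / (eps / 8))) => // n /= hn; rewrite -ler_pdivrMr//.
  by apply/ltW/(lt_le_trans (truncnS_gt _)); rewrite ler_nat ltnS.
have nn := near_and (near_and (near_and near1 near2) (near_and near3 near4)) (near_and (hu s e8) n2).
move: nn; apply: filterS => n [[[b1 b2] [b3 b4]] [/dist_bounds[k1 _] k2]].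
rewrite -[X in volm R n.+1 X]/(E n).
have A0 : 0 < A n by exact: expR_gt0.
have half : ((A n / 2)%:E <= (W n)%:E * volm R n.+1 (E n))%E.
  have : ((A n)%:E <= (W n)%:E * volm R n.+1 (E n) + (A n / 2)%:E)%E.
    apply: le_trans (sumq n) _; rewrite leeD2l//.
    apply: le_trans (leeD b1 (leeD b2 (leeD b3 b4))) _.
    by rewrite -!EFinD lee_fin quarter.
  by rewrite -leeBlDr// -EFinB {1}(splitr (A n)) addrK.
have W0 : 0 < W n by exact: expR_gt0.
rewrite -(@lee_pmul2l _ (W n)%:E)//.
apply: le_trans half; rewrite -EFinM lee_fin ler_pdivlMr//.
have e2 : 2 = expR (ln 2) :> R by rewrite lnK ?posrE.
rewrite [X in _ * X]e2 /W -!expRD ler_expR.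
rewrite -mulrDr; apply: le_trans (lerD (lexx _) k2) _; rewrite -mulrDr ler_pM2l ?ltr0n//.
(* Five errors of at most [eps / 8] remain: the average of [L], the factor 2, the two windows, and
   the change from [l] to [l']. *)
have r1' : s * expR l' * xhi = s * m + s * expR l' * h1 by rewrite -mulrA xhiE; ring.
have r2' : B / p * tlo = expR (p * l) / p - B / p * h2.
  by rewrite hl mulrAC tloE mulrBl; congr (_ - _); rewrite mulrAC.
have ll : l' <= l + eps / 8 by rewrite /l' lerD2l.
rewrite r1' r2'; move: k1 sh1 Bh2 ll.
move: (avgL L s (u n)) (s * expR l' * h1) (B / p * h2) (expR (p * l) / p) => x1 x2 x3 x4 *.
lra.
Qed.
End tilt.

(** * The rate function *)

Section optimum.
Context (R : realType) (p : R) (hp : 2 <= p) (phi : R -> R).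
Hypotheses (phi_ge0 : forall s, 0 <= phi s) (phiN : forall s : R, phi (- s) = phi s) (phi0 : phi 0 = 0).
Hypothesis phi_cont : forall s e : R, 0 < e ->
  exists2 dl : R, 0 < dl & forall t : R, `|t - s| <= dl -> `|phi t - phi s| <= e.
Hypothesis phi_second_diff : forall s : R, exists2 Q : R, 0 <= Q & exists2 a : R, 0 < a &
  forall e : R, `|e| <= a -> phi (s + e) + phi (s - e) - 2 * phi s <= Q * e ^+ 2.

(* Parametrized by [l = log (1 - p t2) / p] and [s = t1 e^-l]. *)
Definition objective (phi : R -> R) (rho s l : R) : R := s * expR l * rho - expR (p * l) / p + l - phi s.
Local Notation G := (objective phi).
Let p0 : 0 < p. Proof. exact: lt_le_trans hp. Qed.

Lemma objective0 rho : G rho 0 0 = - p^-1.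
Proof. by rewrite /objective phi0 !mul0r mulr0 expR0 div1r; ring. Qed.

Lemma continuous_phi : continuous phi.
Proof.
move=> s; apply/cvgrPdist_le => e /(phi_cont s)[dl dl0 h].
near=> t; rewrite distrC; apply: h; rewrite distrC.
by near: t; apply: (@cvgr_dist_le _ _ _ _ _ id).
Unshelve. all: end_near. Qed.

Lemma continuous_objective rho : continuous (fun z : R * R => G rho z.1 z.2).
Proof.
move=> z; have c1 : (fst : R * R -> R) x @[x --> z] --> z.1 by exact: cvg_fst.
have c2 : (snd : R * R -> R) x @[x --> z] --> z.2 by exact: cvg_snd.
apply: cvgB; last by apply: cvg_comp c1 _; exact: continuous_phi.
apply: cvgD => //; apply: cvgB.
  apply: cvgMl; apply: cvgM => //; apply: cvg_comp c2 _; exact: continuous_expR.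
have ce : continuous (fun y : R => expR (p * y)).
  by move=> y; apply: continuous_comp; [exact: mulrl_continuous|exact: continuous_expR].
have cc : (fun x : R * R => expR (p * x.2)) x @[x --> z] --> expR (p * z.2) := cvg_comp _ _ c2 (ce z.2).
by apply: cvgMl; exact: cc.
Qed.

(** [expR (p l) / p - l] grows without bound at both ends, so a value at least that of the origin,
    [- 1 / p], confines [l]. *)
Lemma objective_bounded (rho M s l : R) : 0 <= M -> 0 <= s -> s * expR l * rho <= M -> - p^-1 <= G rho s l ->
  `|l| <= 1 + 2 * (M + p^-1).
Proof.
move=> M0 s0 hM hG; have pV : 0 < p^-1 by rewrite invr_gt0.
have h1 : expR (p * l) / p - l <= M + p^-1.
  by move: hG; rewrite /objective; have := phi_ge0 s; lra.
have h2 : 0 < expR (p * l) / p by rewrite divr_gt0 ?expR_gt0.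
have [l0|l0] := leP l 0; first by rewrite ler0_norm//; lra.
rewrite gtr0_norm//; have [l1|l1] := leP l 1; first by lra.
have h3 : (1 + p * l / 2) ^+ 2 <= expR (p * l).
  have e1 := expR_ge1Dx (p * l / 2).
  have -> : expR (p * l) = expR (p * l / 2) ^+ 2 by rewrite expr2 -expRD -splitr.
  by rewrite lerXn2r// nnegrE ?expR_ge0// addr_ge0// divr_ge0// mulr_ge0 ?(ltW p0) ?(ltW l0).
have h4 : l + l ^+ 2 / 2 <= expR (p * l) / p.
  rewrite ler_pdivlMr//; apply: le_trans h3.
  have : 0 <= (p - 2) * p * l ^+ 2.
    by apply: mulr_ge0; rewrite ?sqr_ge0//; apply: mulr_ge0; rewrite ?subr_ge0// ltW.
  by lra.
have : l <= l ^+ 2 by rewrite expr2 ler_peMl ?(ltW l0)// ltW.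
lra.
Qed.

(** The objectives at [r] and [rho] differ by [s e^l (r - rho)]. Where the one at [rho] is at least
    [- 1 / p], this bounds [s e^l], then [l], then [s]; compactness gives a maximizer for [s >= 0],
    and evenness of [phi] covers the other sign. *)
Lemma objective_max (rho r C : R) : 0 <= rho < r -> (forall s l, G r s l <= C) ->
  exists s l : R, 0 <= s /\ forall s' l', G rho s' l' <= G rho s l.
Proof.
move=> /andP[rho0 rr] hC; have pV : 0 < p^-1 by rewrite invr_gt0.
have C0 : 0 <= C + p^-1 by have := hC 0 0; rewrite objective0; lra.
have d0 : 0 < r - rho by rewrite subr_gt0.
pose B := (C + p^-1) / (r - rho); have B0 : 0 <= B by rewrite divr_ge0// ltW.
pose La := 1 + 2 * (B * rho + p^-1); pose S := B * expR La.
have Br0 : 0 <= B * rho by rewrite mulr_ge0.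
have La0 : 0 <= La by rewrite /La; lra.
have S0 : 0 <= S by rewrite mulr_ge0 ?expR_ge0.
have box s l : 0 <= s -> - p^-1 <= G rho s l -> s <= S /\ `|l| <= La.
  move=> s0 hG; have sB : s * expR l <= B.
    by rewrite ler_pdivlMr//; have := hC s l; move: hG; rewrite /objective; lra.
  have hl : `|l| <= La by apply: (@objective_bounded rho (B * rho) s) => //; rewrite ler_wpM2r.
  split=> //; rewrite -[s](mulfK (lt0r_neq0 (expR_gt0 l))) -expRN.
  apply: ler_pM => //; first by rewrite mulr_ge0 ?expR_ge0.
  by rewrite ler_expR; move: hl; rewrite ler_norml; lra.
have cK : compact (`[0, S] `*` `[- La, La] : set (R * R)) by apply: compact_setX; exact: segment_compact.
have [] := @compact_EVT_max _ R (fun z : R * R => G rho z.1 z.2) _ _ cK.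
- by exists (0, 0); split; rewrite /= in_itv /=; apply/andP; split; lra.
- exact/continuous_subspaceT/continuous_objective.
move=> [s l] /set_mem[/= s1 l1] hmax; exists s, l.
move: s1; rewrite in_itv /= => /andP[s0 sS]; split=> //.
have base : - p^-1 <= G rho s l.
  rewrite -(objective0 rho); apply: (hmax (0, 0)).
  by apply/mem_set; split; rewrite /= in_itv /=; apply/andP; split; lra.
have pos s' l' : 0 <= s' -> G rho s' l' <= G rho s l.
  move=> s'0; have [h|h] := leP (- p^-1) (G rho s' l'); last by apply: le_trans base; exact: ltW.
  have [b1 b2] := box _ _ s'0 h; apply: (hmax (s', l')); apply/mem_set; split; rewrite /= in_itv /=.
    by rewrite s'0.
  by rewrite -ler_norml.
move=> s' l'; have [h|h] := leP 0 s'; first exact: pos.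
apply: le_trans (pos (- s') l' _); last by rewrite oppr_ge0 ltW.
rewrite /objective phiN; have := mulr_ge0 (mulr_ge0 (_ : 0 <= - s') (expR_ge0 l')) rho0.
rewrite oppr_ge0 (ltW h) => /(_ isT); lra.
Qed.

Lemma quadratic_zero (x c a : R) : 0 < a -> (forall e, `|e| <= a -> e * x <= c * e ^+ 2) -> x = 0.
Proof.
move=> a0 h.
have key (y : R) : (forall e, 0 < e <= a -> e * y <= c * e ^+ 2) -> y <= 0.
  move=> hy; rewrite leNgt; apply/negP => y0.
  have [e /andP[e0 ea]] := small_step y0 (normr_ge0 c) a0.
  have := hy e; rewrite e0 ea => /(_ isT).
  have : c * e ^+ 2 <= `|c| * e ^+ 2 by rewrite ler_wpM2r ?sqr_ge0 ?ler_norm.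
  lra.
apply/eqP; rewrite eq_le -oppr_le0; apply/andP; split; apply: key => e /andP[e0 ea].
  by apply: h; rewrite gtr0_norm.
have := h (- e); rewrite normrN gtr0_norm// sqrrN => /(_ ea); lra.
Qed.

(** Stationarity in [l] is the identity. Maximality at [s - e] bounds [phi (s - e)] from below, and
    the second difference turns this into an upper bound at [s + e]. *)
Lemma objective_max_tilt (rho s l : R) : 0 <= rho -> 0 <= s -> (forall s' l', G rho s' l' <= G rho s l) ->
  [/\ expR (p * l) = 1 + s * (rho * expR l) & exists2 Q : R, 0 <= Q & exists2 a : R, 0 < a &
    forall e, `|e| <= a -> phi (s + e) <= phi s + (rho * expR l) * e + Q * e ^+ 2].
Proof.
move=> rho0 s0 hmax; pose m := rho * expR l; have m0 : 0 <= m by rewrite mulr_ge0 ?expR_ge0.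
split; last first.
  have [Q Q0 [a a0 h]] := phi_second_diff s; exists Q => //; exists a => // e ea.
  have := h e ea; have := hmax (s - e) l; rewrite /objective; lra.
apply/eqP; rewrite -subr_eq0 -oppr_eq0; apply/eqP.
have a0 : 0 < 1 / (2 * p) by rewrite divr_gt0// mulr_gt0.
apply: (@quadratic_zero _ (expR (p * l) * 2 * p) _ a0) => e he.
have pe : `|p * e| <= 1 / 2.
  by rewrite normrM gtr0_norm//; move: he; rewrite ler_pdivlMr ?mulr_gt0//; lra.
have /andP[_ b2] := expR_bounds pe; have b1 := expR_ge1Dx e.
have := hmax s (l + e); rewrite /objective mulrDr !expRD.
have k1 : s * m * (1 + e) <= s * m * expR e by rewrite ler_wpM2l// mulr_ge0.
have k2 : expR (p * l) * expR (p * e) / p <= expR (p * l) * (1 + p * e + 2 * (p * e) ^+ 2) / p.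
  by rewrite ler_pM2r ?invr_gt0// ler_pM2l ?expR_gt0.
have k3 : expR (p * l) * (1 + p * e + 2 * (p * e) ^+ 2) / p = expR (p * l) / p + expR (p * l) * e + 2 * p * expR (p * l) * e ^+ 2.
  by field; rewrite gt_eqF.
rewrite k3 in k2; move: k1; rewrite /m; lra.
Qed.
End optimum.

Section rplus.
Context (R : realType).

(** The retraction of the line onto the half-line. Being continuous, it carries compact sets and
    neighbourhoods to the subspace. *)
Definition rplus (x : R) : Rplus R := exist _ `|x| (mem_set (normr_ge0 x : [set y : R | 0 <= y] `|x|)).

Lemma rplus_val (x : Rplus R) : rplus (\val x) = x.
Proof. by apply: val_inj; rewrite /= ger0_norm//; exact: (set_mem (valP x)). Qed.

Lemma rplus_ge0 (x : Rplus R) : 0 <= \val x.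
Proof. exact: (set_mem (valP x)). Qed.

Lemma continuous_rplus : continuous rplus.
Proof.
apply/continuousP => U [V oV <-].
have -> : rplus @^-1` (set_val @^-1` V) = (fun x : R => `|x|) @^-1` V by [].
by move/continuousP: (@norm_continuous R R); exact.
Qed.
End rplus.

Section rate.
Context (R : realType) (p : R) (hp : 2 <= p).
Context d (T : measurableType d) (P : probability T R) (Z : {RV P >-> R}).
Hypothesis Zd : has_density_p p Z.
Context d' (T' : measurableType d') (P' : probability T' R) (g0 : {RV P' >-> R}).
Hypothesis gd : standard_gaussian g0.
Local Notation L := (cgf Z).
Local Notation phi := (gphi Z).
Local Notation c0 := (dens_cst p).
Let p0 : 0 < p. Proof. exact: lt_le_trans hp. Qed.

Lemma gaussian_expectation (f : R -> \bar R) : measurable_fun setT f -> (forall x, 0 <= f x)%E ->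
  (\int[P']_w f (g0 w) = \int[normal_prob 0 1]_x f x)%E.
Proof.
move=> mf f0; rewrite ge0_integral_normal//.
apply: (ge0_integral_rv_density (g := normal_pdf 0 1)) => //.
- exact: measurable_normal_pdf.
- by move=> x; exact: normal_pdf_ge0.
Qed.

Lemma gaussian_expectation_cgf (s : R) : (\int[P']_w (L (s * g0 w))%:E = (phi s)%:E)%E.
Proof.
rewrite -(gphiE hp Zd); apply: (gaussian_expectation (f := fun x => (L (s * x))%:E)).
  by apply/measurable_EFinP; apply: measurableT_comp; [exact: measurable_cgf|exact: measurable_funM].
by move=> x; rewrite lee_fin (cgf_ge0 hp Zd).
Qed.

Lemma expectation_tilt (t1 t2 : R) : ('E_P[fun w => expR (t1 * Z w + t2 * `|Z w| `^ p)] =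
  (c0^-1)%:E * \int[lebesgue_measure]_x (expR (t1 * x + (t2 - p^-1) * `|x| `^ p))%:E)%E.
Proof.
have cg := dens_cst_gt0 Zd.
have mf : measurable_fun setT (fun x : R => expR (t1 * x + t2 * `|x| `^ p)).
  apply: measurableT_comp => //; apply: measurable_funD; first exact: measurable_funM.
  by apply: measurable_funM => //; exact: measurable_powR_norm.
rewrite unlock; have := integral_density Zd mf (fun x => expR_ge0 _) => h.
rewrite (_ : (\int[lebesgue_measure]_x _)%E = (c0%:E * \int[P]_w (expR (t1 * Z w + t2 * `|Z w| `^ p))%:E)%E).
  by rewrite muleA -EFinM mulVf ?gt_eqF// mul1e.
rewrite -h; apply: eq_integral => x _; congr EFin; rewrite -expRD; congr expR; ring.
Qed.

Lemma Lambda_log (s l : R) : Lambda p Z (s * expR l) ((1 - expR (p * l)) / p) = (L s - l)%:E.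
Proof.
have cg := dens_cst_gt0 Zd.
rewrite /Lambda expectation_tilt.
under eq_integral.
  move=> x _.
  have -> : s * expR l * x + ((1 - expR (p * l)) / p - p^-1) * `|x| `^ p =
    s * expR l * (1 * x) - expR (p * l) / p * `|x| `^ p by field; rewrite gt_eqF.
  over.
rewrite (integral_tilt hp Zd) mulr1 -EFinM lne_EFin ?mulr_gt0 ?invr_gt0 ?expR_gt0//; congr EFin.
by rewrite lnM ?posrE ?invr_gt0 ?expR_gt0// expRK lnV ?posrE//; ring.
Qed.

(** The exponent is nonnegative on the half-line where [t1 x >= 0], which has infinite measure. *)
Lemma Lambda_pinfty (t1 t2 : R) : p^-1 <= t2 -> Lambda p Z t1 t2 = +oo%E.
Proof.
move=> ht; have cg := dens_cst_gt0 Zd.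
rewrite /Lambda expectation_tilt (_ : (\int[lebesgue_measure]_x _)%E = +oo%E).
  by rewrite gt0_muley// lte_fin invr_gt0.
pose D := [set x : R | 0 <= t1 * x].
have mD : measurable D by apply: measurable_ler => //; exact: measurable_funM.
apply/eqP; rewrite -leye_eq.
have half : exists2 I : set R, lebesgue_measure I = +oo%E & measurable I /\ I `<=` D.
  have [h|h] := leP 0 t1.
    exists `[0, +oo[%classic; first by rewrite lebesgue_measure_itv /= ltry.
    by split => // x /=; rewrite in_itv /= andbT => x0; rewrite /D /= mulr_ge0.
  exists `]-oo, 0]%classic; first by rewrite lebesgue_measure_itv /= ltNyr.
  by split => // x /=; rewrite in_itv /= => x0; rewrite /D /= mulr_le0// ltW.
have [I I1 [mI ID]] := half.
rewrite -I1 -[leLHS]mul1e -integral_cst//.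
have mf : measurable_fun setT (fun x : R => (expR (t1 * x + (t2 - p^-1) * `|x| `^ p))%:E).
  apply/measurable_EFinP; apply: measurableT_comp => //; apply: measurable_funD; first exact: measurable_funM.
  by apply: measurable_funM => //; exact: measurable_powR_norm.
apply: (@le_trans _ _ (\int[lebesgue_measure]_(x in I) (expR (t1 * x + (t2 - p^-1) * `|x| `^ p))%:E)%E).
  apply: ge0_le_integral => //.
    exact: measurable_funTS.
  move=> x /ID xD; rewrite lee_fin -[leLHS]expR0 ler_expR addr_ge0// mulr_ge0 ?subr_ge0// powR_ge0//.
by apply: ge0_subset_integral => // x _; rewrite lee_fin expR_ge0.
Qed.

Lemma bracketE (r s l : R) : (((s * expR l * r + (1 - expR (p * l)) / p)%:E -
    \int[P']_w Lambda p Z (s * expR l * g0 w) ((1 - expR (p * l)) / p)) = (p^-1 + objective p phi r s l)%:E)%E.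
Proof.
have mL : measurable_fun setT (fun w => (L (s * g0 w))%:E).
  by apply/measurable_EFinP; apply: measurableT_comp; [exact: measurable_cgf|exact: measurable_funM].
have -> : (\int[P']_w Lambda p Z (s * expR l * g0 w) ((1 - expR (p * l)) / p) = (phi s - l)%:E)%E.
  have -> : (fun w => Lambda p Z (s * expR l * g0 w) ((1 - expR (p * l)) / p)) =
    (fun w => (L (s * g0 w))%:E + (- l)%:E)%E.
    by apply/funext => w; rewrite -EFinD -Lambda_log (mulrAC s (expR l)).
  rewrite integralD//.
  - by rewrite gaussian_expectation_cgf integral_cst// [X in (_ * X)%E]probability_setT mule1 -EFinD.
  - apply/integrableP; split => //.
    under eq_integral do rewrite gee0_abs ?lee_fin ?(cgf_ge0 hp Zd)//.
    by rewrite gaussian_expectation_cgf ltry.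
  - exact: finite_measure_integrable_cst.
by rewrite -EFinB /objective; congr EFin; move: (phi s) => v; field; rewrite gt_eqF.
Qed.

Lemma rate_ge (r s l : R) : ((p^-1 + objective p phi r s l)%:E <= rate p Z g0 r)%E.
Proof.
rewrite -bracketE; apply: ereal_sup_ubound.
by exists (s * expR l, (1 - expR (p * l)) / p).
Qed.

Lemma rate_le (r x : R) : (forall s l, p^-1 + objective p phi r s l <= x) -> (rate p Z g0 r <= x%:E)%E.
Proof.
move=> h; apply: ge_ereal_sup => _ [[t1 t2] _ <-] /=.
have [ht|ht] := leP p^-1 t2.
  under eq_integral do rewrite Lambda_pinfty//.
  by rewrite integral_cst// [X in (_ * X)%E]probability_setT mule1 /= leNye.
have k0 : 0 < 1 - p * t2 by rewrite subr_gt0 mulrC -ltr_pdivlMr// div1r.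
pose l := ln (1 - p * t2) / p.
have el : expR (p * l) = 1 - p * t2 by rewrite /l mulrC divfK ?gt_eqF// lnK.
have -> : t2 = (1 - expR (p * l)) / p by rewrite el; field; rewrite gt_eqF.
have -> : t1 = (t1 * expR (- l)) * expR l by rewrite -mulrA -expRD addNr expR0 mulr1.
by rewrite bracketE lee_fin.
Qed.

Lemma rate_leP (r x : R) : (rate p Z g0 r <= x%:E)%E <-> forall s l, p^-1 + objective p phi r s l <= x.
Proof.
split=> [h s l|]; last exact: rate_le.
by rewrite -lee_fin; apply: le_trans h; exact: rate_ge.
Qed.

Lemma rate_ge0 r : (0 <= rate p Z g0 r)%E.
Proof.
apply: le_trans (rate_ge r 0 0); rewrite (objective0 p (gphi0 hp Zd)) subrr//.
Qed.

Lemma rate_convex (x y t : R) : 0 <= t <= 1 ->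
  (rate p Z g0 (t * x + (1 - t) * y)%R <= t%:E * rate p Z g0 x + (1 - t)%:E * rate p Z g0 y)%E.
Proof.
(* The endpoints of [[0, 1]] are settled at once, with the convention [0 * +oo = 0]; afterwards an
   infinite value on the right makes the claim trivial. *)
move=> /andP[]; rewrite le_eqVlt => /orP[/eqP <-|t0].
  by rewrite mul0r mul0e !add0r subr0 mul1r mul1e.
rewrite le_eqVlt => /orP[/eqP ->|t1].
  by rewrite subrr mul0r mul0e addr0 adde0 mul1r mul1e.
have t1' : 0 < 1 - t by rewrite subr_gt0.
have := rate_ge0 x; have := rate_ge0 y.
case Ex : (rate p Z g0 x) => [a| |] //; last first.
  move=> y0 _; rewrite gt0_muley ?lte_fin// addye ?leey//.
  by rewrite gt_eqF// (lt_le_trans _ (mule_ge0 _ y0))// ?ltNy0// lee_fin ltW.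
case Ey : (rate p Z g0 y) => [b| |] //; last first.
  by move=> _ a0; rewrite gt0_muley ?lte_fin// addey ?leey.
move=> _ _; rewrite -!EFinM -EFinD; apply: rate_le => s l.
have ha : p^-1 + objective p phi x s l <= a by apply: (rate_leP _ _).1; rewrite Ex.
have hb : p^-1 + objective p phi y s l <= b by apply: (rate_leP _ _).1; rewrite Ey.
have := lerD (ler_wpM2l (ltW t0) ha) (ler_wpM2l (ltW t1') hb); rewrite /objective; lra.
Qed.

Lemma rate_coercive (r x : R) : (rate p Z g0 r <= x%:E)%E -> r <= x + phi 1.
Proof.
move/(rate_leP _ _).1 => /(_ 1 0); rewrite /objective mulr0 !expR0 div1r; lra.
Qed.

(** A sublevel set is an intersection of closed conditions, affine in [r], and is bounded by the
    bracket at [s = 1], [l = 0]. *)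
Lemma good_rate : good_rate_function (fun r : Rplus R => rate p Z g0 (\val r)).
Proof.
split=> [r|al al0]; first exact: rate_ge0.
pose C := [set r : R | 0 <= r /\ (rate p Z g0 r <= al%:E)%E].
have cC : compact C.
  apply: (@subclosed_compact _ _ `[0, al + phi 1]%classic).
  - have -> : C = [set r | 0 <= r] `&` \bigcap_(z : R * R) [set r | p^-1 + objective p phi r z.1 z.2 <= al].
      apply/seteqP; split => [r [r0 /rate_leP h]|r [r0 h]]; split => //; first by move=> z _; exact: h.
      by apply/rate_leP => s l; exact: (h (s, l)).
    apply: closedI; first exact: closed_ge.
    apply: closed_bigI => z _.
    rewrite (_ : [set r | _] = (fun r : R => p^-1 + objective p phi r z.1 z.2) @^-1` [set x | x <= al])//.
    apply: closed_comp => [r _|]; last exact: closed_le.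
    apply: cvgD; first exact: cvg_cst.
    by apply: cvgB; [apply: cvgD; [apply: cvgB; [apply: cvgMr; exact: cvg_id|exact: cvg_cst]|exact: cvg_cst]|exact: cvg_cst].
  - exact: segment_compact.
  - by move=> r [r0 /rate_coercive h]; rewrite /= in_itv /= r0.
rewrite [X in compact X](_ : _ = @rplus R @` C).
  by apply: continuous_compact => //; apply: continuous_subspaceT; exact: continuous_rplus.
apply/seteqP; split => [x Ix|_ [r [r0 Ir] <-]] /=; last by rewrite ger0_norm.
by exists (\val x); [split => //; exact: rplus_ge0|exact: rplus_val].
Qed.
End rate.

(** * The large deviation principle *)

Opaque gphi.

Section tails.
Context (R : realType) (p : R) (hp : 2 <= p).
Context d (T : measurableType d) (P : probability T R) (Z : {RV P >-> R}).
Hypothesis Zd : has_density_p p Z.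
Context (k : nat -> nat) (k_le : forall n, (k n <= n.+1)%N).
Context (a : stiefel_prod R k_le).
Hypothesis typ : typical (cgf Z) a.
Local Notation L := (cgf Z).
Local Notation phi := (gphi Z).
Local Notation c0 := (dens_cst p).
Local Notation obj := (objective p phi).
Local Notation K n := (lp_ball p n.+1).
Local Notation A n w := (Num.sqrt n.+1%:R *: (stiefel_mx (k_le n) (a n) *m w)).
Let p0 : 0 < p. Proof. exact: lt_le_trans hp. Qed.

Definition rproj n (y : 'cV[R]_n.+1) : 'cV[R]_(k n) := (Num.sqrt n.+1%:R)^-1 *: ((stiefel_mx (k_le n) (a n))^T *m y).

(** Scalar products with the projection become linear functionals of [y], to which the weights
    apply. *)
Lemma dot_rproj n w y : dot (A n w) y = n.+1%:R * dot w (rproj y).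
Proof.
have s0 : Num.sqrt n.+1%:R != 0 :> R by rewrite gt_eqF// sqrtr_gt0 ltr0n.
rewrite /rproj dotZr [LHS]dotC dotZr mulrA -{2}(@sqr_sqrtr R n.+1%:R) ?ler0n// expr2 mulfK//; congr (_ * _).
by rewrite [RHS]dotC dot_mulmx.
Qed.

Lemma measurable_lp_ball n : measurable (K n : set (borel 'cV[R]_n.+1)).
Proof. by apply: measurable_ler => //; exact: measurable_psum. Qed.

Lemma measurable_rproj n : measurable_fun setT (@rproj n : borel 'cV[R]_n.+1 -> borel 'cV[R]_(k n)).
Proof.
apply: measurable_cV => i; under eq_fun do rewrite mxE.
apply: measurable_funM => //; apply: measurable_coord; apply: measurable_mulmxcV; exact: measurable_id.
Qed.

Lemma measurable_enorm_rproj n : measurable_fun setT (fun y : borel 'cV[R]_n.+1 => enorm (rproj y)).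
Proof.
apply: (measurableT_comp (f := @Num.sqrt R)); last by apply: measurable_sqn; exact: measurable_rproj.
by apply: continuous_measurable_fun; exact: sqrt_continuous.
Qed.

(** For the lower bounds one net vector per dimension suffices, since the norm dominates the scalar
    product with any unit vector. *)
Lemma typical_direction : exists u : forall n, 'cV[R]_n.+1,
  (forall s e : R, 0 < e -> \forall n \near \oo, `|avgL L s (u n) - phi s| <= e) /\
  forall n y, dot (u n) y <= n.+1%:R * enorm (rproj y).
Proof.
(* The fineness 1/2 is arbitrary; approximating the vector 0 merely yields an element of the net. *)
have h2 : 0 < (1 / 2 : R) < 1 by apply/andP; split; lra.
have [N [_ N1 N2 N3]] := typ h2.
have hw n : {w | w \in N n} by have [w wN _] := cid2 (N2 n 0); exists w.
exists (fun n => A n (sval (hw n))); split => [s e e0|n y].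
  by move: (N3 s e e0); apply: filterS => n; apply; exact: (svalP (hw n)).
rewrite dot_rproj ler_pM2l ?ltr0n//; apply: le_trans (cauchy_schwarz _ _) _.
by rewrite {1}/enorm (N1 n) ?sqrtr1 ?mul1r//; exact: (svalP (hw n)).
Qed.

Lemma ball_le n : (volm R n.+1 (K n) <= (expR (n.+1%:R * (ln c0 + p^-1)))%:E)%E.
Proof.
have := @chernoff_volume _ _ hp _ _ _ _ Zd n (K n) 0 0 0 (- p^-1) (@measurable_lp_ball n).
move=> h; apply: le_trans (h _) _.
  move=> y; rewrite /lp_ball /= -[\sum_i _]/(psum p y) => hK.
  rewrite wexpD !mul0r mulr0 expR0 sub0r mulrN lerN2 div1r mulrC ler_pM2r ?invr_gt0//.
by rewrite (avgL0 _ (cgf0 hp Zd)) subr0 addr0 opprK.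
Qed.

(** The case of no tilt, [s = m = l = 0]. The quadratic bound at 0 comes from evenness and
    positivity of [phi], and [r1 = -1] only has to be negative. *)
Lemma ball_ge (e : R) : 0 < e -> \forall n \near \oo,
  ((expR (n.+1%:R * (ln c0 + p^-1 - e)))%:E <= volm R n.+1 (K n))%E.
Proof.
move=> e0; have [u [hu _]] := typical_direction.
have [Q Q0 [b b0 hQ]] := gphi_second_diff hp Zd 0.
have hphi : forall t : R, `|t| <= b -> phi (0 + t) <= phi 0 + 0 * t + Q * t ^+ 2.
  move=> t /hQ; rewrite sub0r (gphiN hp Zd) (gphi0 hp Zd) !add0r mul0r; have := gphi_ge0 hp Zd t; lra.
have hl : expR (p * 0) = 1 + 0 * 0 by rewrite mulr0 expR0 mul0r addr0.
have hr : - 1 < 0 * expR (- 0) :> R by rewrite mul0r; lra.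
have := tilt_volume hp Zd hu (lexx 0) (lexx 0) Q0 b0 hphi hl hr e0.
apply: filterS => n h; apply: le_trans (le_trans _ h) _.
  rewrite (gphi0 hp Zd) !mulr0 expR0 addr0 subr0 sub0r div1r opprK//.
apply: le_measure; rewrite ?inE; last 2 first.
- exact: measurable_lp_ball.
- by move=> y [].
apply: measurableI; last exact: measurable_lp_ball.
by apply: measurable_ltr => //; exact: measurable_dot.
Qed.

Lemma upper_tail_volume (r s l eps : R) : 0 <= r -> 0 <= s -> 0 < eps -> \forall n \near \oo,
  (volm R n.+1 (K n `&` [set y | (r <= enorm (rproj y))%R]) <= (expR (n.+1%:R * (ln c0 - obj r s l + eps)))%:E)%E.
Proof.
move=> r0 s0 eps0.
pose m := s * expR l * r; have m0 : 0 <= m by rewrite !mulr_ge0 ?expR_ge0.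
(* The net lowers the norm by a factor [1 - e], at a cost of [m e <= eps / 4] in the exponent. *)
pose e : R := Num.min (1 / 2) (eps / (4 * (m + 1))).
have e01 : 0 < e < 1.
  rewrite lt_min gt_min !divr_gt0 ?mulr_gt0 ?ltr_wpDl//=.
  by apply/orP; left; lra.
have /andP[e0 e1] := e01.
have em : m * e <= eps / 4.
  have : e <= eps / (4 * (m + 1)) by rewrite ge_min lexx orbT.
  rewrite ler_pdivlMr ?mulr_gt0 ?ltr_wpDl//; nra.
have [N [N0 N1 N2 N3]] := typ e01.
have eps4 : 0 < eps / 4 by rewrite divr_gt0.
move: (near_and (N0 _ eps4) (N3 s _ eps4)); apply: filterS => n [n1 n2].
pose D (w : 'cV[R]_(k n)) : set (borel 'cV[R]_n.+1) :=
  K n `&` [set y | n.+1%:R * ((1 - e) * r) <= dot (A n w) y].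
have mD w : measurable (D w).
  apply: measurableI; first exact: measurable_lp_ball.
  by apply: measurable_ler => //; exact: measurable_dot.
have mE : measurable (K n `&` [set y : 'cV[R]_n.+1 | r <= enorm (rproj y)] : set (borel 'cV[R]_n.+1)).
  apply: measurableI; first exact: measurable_lp_ball.
  by apply: measurable_ler => //; exact: measurable_enorm_rproj.
pose x := s * expR l * ((1 - e) * r) - expR (p * l) / p.
have step w : w \in N n -> (volm R n.+1 (D w) <= (expR (n.+1%:R * (ln c0 - l + (phi s + eps / 4) - x)))%:E)%E.
  move=> wN; apply: le_trans (chernoff_volume hp Zd (u := A n w) (s := s) (l := l) (x := x) (mD w) _) _.
    move=> y [Ky hy]; rewrite wexpD /x mulrBr; apply: lerB.
      by rewrite mulrCA; apply: ler_wpM2l hy; rewrite mulr_ge0 ?expR_ge0.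
    rewrite [leRHS]mulrC; apply: ler_wpM2l; last exact: Ky.
    by rewrite divr_ge0 ?expR_ge0// ltW.
  rewrite lee_fin ler_expR ler_pM2l ?ltr0n// lerD2r lerD2l.
  by have [_] := dist_bounds (n2 w wN).
apply: (@le_trans _ _ (volm R n.+1 (\big[setU/set0]_(w <- N n) D w))).
  apply: le_measure; rewrite ?inE//; first by apply: bigsetU_measurable => w _.
  move=> y [Ky hy]; have [w wN hw] := N2 n (rproj y).
  rewrite -bigcup_seq; exists w => //; split => //=; rewrite dot_rproj ler_pM2l ?ltr0n//.
  by apply: le_trans hw; rewrite ler_pM2l// subr_gt0.
apply: le_trans (measure_bigsetU_le mD step) _.
rewrite lee_fin; apply: le_trans (ler_wpM2r (expR_ge0 _) n1) _.
rewrite -expRD ler_expR mulrC -mulrDr ler_pM2l ?ltr0n//.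
rewrite /objective /x (_ : s * expR l * ((1 - e) * r) = m - m * e); last by rewrite /m; ring.
by rewrite -/m; move: em; move: (expR (p * l) / p) (m * e) (ln c0) (phi s) => x1 x2 x3 x4; lra.
Qed.

Lemma lower_tail_volume (r r1 C eps : R) : 0 < r -> r1 < r -> (forall s l, obj r s l <= C) -> 0 < eps ->
  \forall n \near \oo,
  ((expR (n.+1%:R * (ln c0 - C - eps)))%:E <= volm R n.+1 (K n `&` [set y | (r1 < enorm (rproj y))%R]))%E.
Proof.
move=> r0 r1r hC eps0; have [u [hu hup]] := typical_direction.
(* The maximum with 0 keeps [rho] nonnegative when [r1] is negative. *)
pose rho := (Num.max r1 0 + r) / 2.
have M1 : r1 <= Num.max r1 0 by rewrite le_max lexx.
have M2 : 0 <= Num.max r1 0 by rewrite le_max lexx orbT.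
have M3 : Num.max r1 0 < r by rewrite gt_max r1r.
have rho0 : 0 <= rho < r by rewrite /rho; apply/andP; split; lra.
have r1rho : r1 < rho by rewrite /rho; lra.
have [s [l [s0 hmax]]] := objective_max hp (gphi_ge0 hp Zd) (gphiN hp Zd) (gphi0 hp Zd) (fun s e => @gphi_cont _ _ hp _ _ _ _ Zd s e) rho0 hC.
have /andP[rho0' rhor] := rho0.
have [hl [Q Q0 [b b0 hphi]]] := objective_max_tilt hp (gphi_second_diff hp Zd) rho0' s0 hmax.
have m0 : 0 <= rho * expR l by rewrite mulr_ge0 ?expR_ge0.
have hr : r1 < rho * expR l * expR (- l) by rewrite -mulrA -expRD subrr expR0 mulr1.
have := tilt_volume hp Zd hu s0 m0 Q0 b0 hphi hl hr eps0.
apply: filterS => n h; apply: le_trans (le_trans _ h) _.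
  rewrite lee_fin ler_expR ler_pM2l ?ltr0n// lerD2r lerD2l lerN2.
  (* As [s >= 0], the objective increases from [rho] to [r], so its value at the maximizer is at
     most [C]. *)
  apply: le_trans (hC s l); rewrite /objective.
  rewrite (_ : s * (rho * expR l) = s * expR l * rho); last by ring.
  by rewrite !lerD2r; apply: ler_wpM2l; [rewrite mulr_ge0 ?expR_ge0|exact: ltW].
have mE : measurable [set y : borel 'cV[R]_n.+1 | r1 < enorm (rproj y)].
  by apply: measurable_ltr => //; exact: measurable_enorm_rproj.
apply: le_measure; rewrite ?inE.
- apply: measurableI; last exact: measurable_lp_ball.
  by apply: measurable_ltr => //; exact: measurable_dot.
- by apply: measurableI => //; exact: measurable_lp_ball.
move=> y [hy Ky]; split => //=.
by rewrite -(ltr_pM2l (ltr0Sn R n)); apply: lt_le_trans hy (hup n y).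
Qed.
End tails.

Section limits.
Context (R : realType).

Lemma limn_esup_le_near (u : nat -> \bar R) (M : \bar R) :
  (\forall n \near \oo, (u n <= M)%E) -> (limn_esup u <= M)%E.
Proof.
move=> h; rewrite /limn_esup limf_esupE.
apply: (@le_trans _ _ (ereal_sup (u @` [set n | (u n <= M)%E]))).
  by apply: ereal_inf_lbound; exists [set n | (u n <= M)%E].
by apply: ge_ereal_sup => _ [n un <-].
Qed.

Lemma limn_einf_ge_near (u : nat -> \bar R) (M : \bar R) :
  (\forall n \near \oo, (M <= u n)%E) -> (M <= limn_einf u)%E.
Proof.
move=> h; rewrite /limn_einf leeNr; apply: limn_esup_le_near.
by move: h; apply: filterS => n; rewrite leeN2.
Qed.

Lemma lee_dense (x y : \bar R) : (forall r : R, (r%:E < x)%E -> (r%:E <= y)%E) -> (x <= y)%E.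
Proof.
move=> h; rewrite leNgt; apply/negP; case: x y h => [b| |] [c| |] //= h.
- rewrite lte_fin => cb; have := h ((b + c) / 2); rewrite lte_fin lee_fin.
  by have [|] := ltP ((b + c) / 2) b => h1; [move=> /(_ isT)|move=> _]; lra.
- by move=> _; have := h (b - 1); rewrite lte_fin ltrBlDr ltrDl ltr01 leeNy_eq => /(_ isT).
- by move=> _; have := h (c + 1); rewrite ltry lee_fin => /(_ isT); lra.
- by move=> _; have := h 0; rewrite ltry leeNy_eq => /(_ isT).
Qed.

Lemma log_rate_le n (v c : R) : v <= expR (- (n.+1%:R * c)) ->
  ((n.+1%:R^-1)%:E * lne v%:E <= (- c)%:E)%E.
Proof.
move=> h; have n0 : 0 < n.+1%:R^-1 :> R by rewrite invr_gt0.
(* Here [lne v] is [-oo], so a vanishing probability satisfies every upper bound. *)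
have [v0|v0] := leP v 0.
  by rewrite /lne v0 gt0_muleNy ?leNye.
rewrite lne_EFin// -EFinM lee_fin mulrC ler_pdivrMr ?ltr0n// -ler_expR lnK ?posrE//.
by apply: le_trans h _; rewrite mulNr mulrC.
Qed.

Lemma log_rate_ge n (v c : R) : expR (- (n.+1%:R * c)) <= v ->
  ((- c)%:E <= (n.+1%:R^-1)%:E * lne v%:E)%E.
Proof.
move=> h; have v0 : 0 < v by apply: lt_le_trans h; exact: expR_gt0.
rewrite lne_EFin// -EFinM lee_fin mulrC ler_pdivlMr ?ltr0n// -ler_expR lnK ?posrE//.
by apply: le_trans h; rewrite mulNr mulrC.
Qed.

Lemma near_exp_le_half (c : R) : 0 < c -> \forall n \near \oo, expR (- (n.+1%:R * c)) <= 1 / 2.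
Proof.
move=> c0; exists (Num.truncn (ln 2 / c)) => // n /= hn.
have e2 : 1 / 2 = expR (- ln 2) :> R by rewrite expRN lnK ?posrE// div1r.
rewrite e2 ler_expR lerN2 -ler_pdivrMr//.
by apply/ltW/(lt_le_trans (truncnS_gt _)); rewrite ler_nat ltnS.
Qed.
End limits.

Section rate_increasing.
Context (R : realType) (p : R) (hp : 2 <= p).
Context d (T : measurableType d) (P : probability T R) (Z : {RV P >-> R}).
Hypothesis Zd : has_density_p p Z.
Context d' (T' : measurableType d') (P' : probability T' R) (g0 : {RV P' >-> R}).
Hypothesis gd : standard_gaussian g0.
Local Notation phi := (gphi Z).
Local Notation J := (rate p Z g0).
Let p0 : 0 < p. Proof. exact: lt_le_trans hp. Qed.

Lemma rate0 : J 0 = 0%E.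
Proof.
apply/eqP; rewrite eq_le (rate_ge0 hp Zd gd) andbT; apply: (rate_le hp Zd gd) => s l.
rewrite /objective mulr0 sub0r.
have h1 := expR_ge1Dx (p * l); have h2 := gphi_ge0 hp Zd s.
have h3 : p^-1 + l <= expR (p * l) / p by rewrite ler_pdivlMr// mulrDl mulVf ?gt_eqF// mulrC.
by move: h2 h3; move: (gphi Z s) (expR (p * l) / p) => x y; lra.
Qed.

(** Since [r >= 0] and [phi] is even, changing the sign of a negative [s] can only help; the upper
    tail bound requires [s >= 0]. *)
Lemma rate_gt (r x : R) : 0 <= r -> (x%:E < J r)%E -> exists s l : R, 0 <= s /\ x < p^-1 + objective p phi r s l.
Proof.
move=> r0; rewrite ltNge => /negP h.
have [s [l hsl]] : exists s l, x < p^-1 + objective p phi r s l.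
  apply: contrapT => hn; apply: h; apply: (rate_le hp Zd gd) => s l; rewrite leNgt; apply/negP => hx.
  by apply: hn; exists s, l.
have [s0|s0] := leP 0 s; first by exists s, l.
exists (- s), l; split; first by rewrite oppr_ge0 ltW.
apply: lt_le_trans hsl _; rewrite lerD2l /objective (gphiN hp Zd) !lerD2r.
by rewrite ler_wpM2r// ler_wpM2r ?expR_ge0//; lra.
Qed.

(** Near 0 the gain [s r] is linear, whereas [phi s] is at most quadratic. *)
Lemma rate_gt0 (r : R) : 0 < r -> (0 < J r)%E.
Proof.
move=> r0; have [Q Q0 [b b0 hQ]] := gphi_second_diff hp Zd 0.
have [s /andP[s0 sb] hs] := small_step r0 Q0 b0.
apply: lt_le_trans (rate_ge hp Zd gd r s 0); rewrite lte_fin.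
have := hQ s; rewrite gtr0_norm// => /(_ sb); rewrite sub0r (gphiN hp Zd) (gphi0 hp Zd) add0r mulr0 subr0.
have h := gphi_ge0 hp Zd s; rewrite /objective mulr0 !expR0 div1r => h2.
by move: h h2; move: (gphi Z s) (Q * s ^+ 2) hs => x y hs; rewrite mul0r add0r in hs; lra.
Qed.

(** Convexity between 0, where [J] vanishes, and [r'] gives [J r <= (r / r') J r'], and [J r] is
    positive unless [r = 0]. *)
Lemma rate_increasing (r r' C : R) : 0 <= r < r' -> J r = C%:E -> (C%:E < J r')%E.
Proof.
move=> /andP[r0 rr'] JC; have r'0 : 0 < r' by exact: le_lt_trans rr'.
have [r00|r00] := eqVneq r 0.
  by rewrite -JC r00 rate0 rate_gt0.
have rp : 0 < r by rewrite lt_neqAle eq_sym r00.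
have C0 : 0 < C by rewrite -lte_fin -JC rate_gt0.
case E : (J r') => [c| |]; last 2 first.
- exact: ltry.
- by have := rate_ge0 hp Zd gd r'; rewrite E.
have t01 : 0 <= r / r' <= 1 by rewrite divr_ge0 ?(ltW rp) ?(ltW r'0)//= ler_pdivrMr// mul1r ltW.
have := rate_convex hp Zd gd r' 0 t01; rewrite mulr0 addr0 divfK ?gt_eqF// JC E rate0 mule0 adde0 -EFinM lee_fin lte_fin.
rewrite mulrAC ler_pdivlMr// => h; rewrite -(ltr_pM2l rp); apply: lt_le_trans h.
by rewrite mulrC ltr_pM2l.
Qed.
End rate_increasing.

Section ldp.
Context (R : realType) (p : R) (hp : 2 <= p).
Context dZ (TZ : measurableType dZ) (PZ : probability TZ R) (Z : {RV PZ >-> R}).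
Hypothesis Zd : has_density_p p Z.
Context dg (Tg : measurableType dg) (Pg : probability Tg R) (g0 : {RV Pg >-> R}).
Hypothesis gd : standard_gaussian g0.
Context (k : nat -> nat) (k_le : forall n, (k n <= n.+1)%N) (a : stiefel_prod R k_le).
Hypothesis typ : typical (cgf Z) a.
Context (d : nat -> measure_display) (Omega : forall n, measurableType (d n))
  (P : forall n, probability (Omega n) R)
  (Y : forall n, {RV (P n) >-> borel 'cV[R]_n.+1})
  (Y_unif : forall n, uniform_on (lp_ball p n.+1) (Y n)).
Local Notation phi := (gphi Z).
Local Notation obj := (objective p phi).
Local Notation J := (rate p Z g0).
Local Notation c0 := (dens_cst p).
Local Notation K n := (lp_ball p n.+1).
Local Notation X n w := (enorm (rproj a (Y n w : 'cV[R]_n.+1))).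

Lemma prob_volm n (D : set (borel 'cV[R]_n.+1)) : measurable D ->
  P n (Y n @^-1` D) = (fine (volm R n.+1 (K n `&` D)) / fine (volm R n.+1 (K n)))%:E.
Proof.
move=> mD; have mK := @measurable_lp_ball R p n.
by rewrite Y_unif// !volmE//; [rewrite setIC|exact: measurableI].
Qed.

Lemma volm_ball_fin n (D : set (borel 'cV[R]_n.+1)) : measurable D ->
  volm R n.+1 (K n `&` D) \is a fin_num.
Proof.
move=> mD; rewrite ge0_fin_numE//; apply: (@le_lt_trans _ _ (volm R n.+1 (K n))).
  by apply: le_measure; rewrite ?inE//; [apply: measurableI => //; exact: measurable_lp_ball|exact: measurable_lp_ball].
by apply: le_lt_trans (ball_le hp Zd n) _; rewrite ltry.
Qed.

Lemma upper_tail (r s l eps : R) : 0 <= r -> 0 <= s -> 0 < eps -> \forall n \near \oo,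
  (P n [set w | (r <= X n w)%R] <= (expR (- (n.+1%:R * (p^-1 + obj r s l - eps))))%:E)%E.
Proof.
move=> r0 s0 e0; have e2 : 0 < eps / 2 by rewrite divr_gt0.
move: (near_and (upper_tail_volume hp Zd typ l r0 s0 e2) (ball_ge hp Zd typ e2)); apply: filterS => n [h1 h2].
have mD : measurable [set y : borel 'cV[R]_n.+1 | r <= enorm (rproj a y)].
  by apply: measurable_ler => //; exact: measurable_enorm_rproj.
have := prob_volm mD; rewrite [_ @^-1` _](_ : _ = [set w | r <= X n w])// => ->.
have f1 := volm_ball_fin mD; have := volm_ball_fin (@measurableT _ (borel 'cV[R]_n.+1)); rewrite setIT => f2.
rewrite -(fineK f1) lee_fin in h1; rewrite -(fineK f2) lee_fin in h2.
rewrite lee_fin ler_pdivrMr; last by apply: lt_le_trans h2; exact: expR_gt0.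
apply: le_trans h1 (le_trans _ (ler_wpM2l (expR_ge0 _) h2)).
rewrite -expRD ler_expR -mulrN -mulrDr ler_pM2l ?ltr0n//.
by move: (ln c0) (obj r s l) => x y; lra.
Qed.

Lemma lower_tail (r r1 C eps : R) : 0 < r -> r1 < r -> J r = C%:E -> 0 < eps -> \forall n \near \oo,
  ((expR (- (n.+1%:R * (C + eps))))%:E <= P n [set w | (r1 < X n w)%R])%E.
Proof.
move=> r0 r1r JC e0; have hC s l : obj r s l <= C - p^-1.
  by rewrite lerBrDl; apply: ((rate_leP hp Zd gd r C).1 _ s l); rewrite JC.
have := lower_tail_volume hp Zd typ r0 r1r hC e0; apply: filterS => n h1.
have mD : measurable [set y : borel 'cV[R]_n.+1 | r1 < enorm (rproj a y)].
  by apply: measurable_ltr => //; exact: measurable_enorm_rproj.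
have := prob_volm mD; rewrite [_ @^-1` _](_ : _ = [set w | r1 < X n w])// => ->.
have f1 := volm_ball_fin mD; have := volm_ball_fin (@measurableT _ (borel 'cV[R]_n.+1)); rewrite setIT => f2.
have h2 := ball_le hp Zd n.
rewrite -(fineK f1) lee_fin in h1; rewrite -(fineK f2) lee_fin in h2.
have v0 : 0 < fine (volm R n.+1 (K n)).
  apply: (@lt_le_trans _ _ (fine (volm R n.+1 (K n `&` [set y : borel 'cV[R]_n.+1 | r1 < enorm (rproj a y)])))).
    by apply: lt_le_trans h1; exact: expR_gt0.
  apply: fine_le => //; apply: le_measure; rewrite ?inE//; [apply: measurableI => //; exact: measurable_lp_ball|exact: measurable_lp_ball].
rewrite lee_fin ler_pdivlMr//; apply: le_trans (ler_wpM2l (expR_ge0 _) h2) (le_trans _ h1).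
rewrite -expRD ler_expR -mulrN -mulrDr ler_pM2l ?ltr0n//.
by move: (ln c0) => x; lra.
Qed.

Lemma measurable_X n : measurable_fun setT (fun w => X n w).
Proof.
have h := @measurable_enorm_rproj _ _ _ a n.
exact: (measurableT_comp h (@measurable_funPT _ _ _ _ (Y n))).
Qed.

Lemma interval_lower (r dl C e : R) : 0 <= r -> 0 < dl -> J r = C%:E -> 0 < e -> \forall n \near \oo,
  ((expR (- (n.+1%:R * (C + e))))%:E <= P n [set w | (r - dl < X n w)%R /\ (X n w < r + dl)%R])%E.
Proof.
move=> r0 dl0 JC e0.
have low e' : 0 < e' -> \forall n \near \oo, ((expR (- (n.+1%:R * (C + e'))))%:E <= P n [set w | (r - dl < X n w)%R])%E.
  (* [lower_tail] requires [0 < r]; for [r = 0] the event is certain, as norms are nonnegative. *)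
  move=> e'0; have [r00|r00] := eqVneq r 0; last first.
    by apply: (lower_tail (r := r)) => //; [rewrite lt_neqAle eq_sym r00|rewrite ltrBlDr ltrDl].
  have C0 : C = 0 by apply: EFin_inj; rewrite -JC r00 (rate0 hp Zd gd).
  apply: nearW => n; rewrite [S in P n S](_ : _ = setT).
    by rewrite probability_setT lee_fin -[leRHS]expR0 ler_expR oppr_le0 mulr_ge0// C0 add0r ltW.
  by apply/seteqP; split => // w _ /=; apply: lt_le_trans (enorm_ge0 _); rewrite r00; lra.
have r2 : 0 <= r < r + dl by rewrite r0 ltrDl.
have [s [l [s0 hsl]]] := rate_gt hp Zd gd (addr_ge0 r0 (ltW dl0)) (rate_increasing hp Zd gd r2 JC).
pose g := p^-1 + obj (r + dl) s l - C; have g0' : 0 < g by rewrite subr_gt0.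
(* The margin [h] is spent twice, in the lower tail and to absorb a factor 2; [2 h <= g / 2] keeps
   the upper tail at [r + dl] below half of the lower one. *)
pose h : R := Num.min (e / 2) (g / 4).
have h0 : 0 < h by rewrite lt_min !divr_gt0.
have he : h <= e / 2 by rewrite ge_min lexx.
have hg : h <= g / 4 by rewrite ge_min lexx orbT.
have g4 : 0 < g / 4 by rewrite divr_gt0.
have n1 := low _ h0; have n2 := upper_tail l (addr_ge0 r0 (ltW dl0)) s0 g4; have n3 := near_exp_le_half h0.
move: (near_and n1 (near_and n2 n3)); apply: filterS => n [{}n1 [{}n2 {}n3]].
have mX := @measurable_X n.
pose x := expR (- (n.+1%:R * (C + h))); have x0 : 0 < x by exact: expR_gt0.
pose M := [set w | (r - dl < X n w)%R /\ (X n w < r + dl)%R].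
pose U := [set w | (r + dl <= X n w)%R].
have mM : measurable M.
  apply: (@measurableI _ _ [set w | r - dl < X n w] [set w | X n w < r + dl]).
    exact: measurable_ltr.
  exact: measurable_ltr.
have mU : measurable U by exact: measurable_ler.
have mA : measurable [set w | r - dl < X n w] by exact: measurable_ltr.
have key : (x%:E <= P n M + (x / 2)%:E)%E.
  apply: le_trans n1 _; apply: (@le_trans _ _ (P n (M `|` U))).
    apply: le_measure; rewrite ?inE//; first exact: measurableU.
    move=> w /= hw; have [h1|h1] := ltP (X n w) (r + dl); [by left|by right].
  apply: le_trans (measureU2 _ mM mU) _; apply: leeD => //.
  apply: le_trans n2 _; rewrite lee_fin.
  apply: (@le_trans _ _ (x * expR (- (n.+1%:R * h)))); last first.
    by apply: (ler_wpM2l (ltW x0)); move: n3; rewrite div1r.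
  rewrite /x -expRD ler_expR -opprD lerN2 -mulrDr ler_pM2l ?ltr0n//.
  by move: hg; rewrite /g; move: (obj (r + dl) s l) => y; lra.
have : ((x / 2)%:E <= P n M)%E.
  by move: key; rewrite -leeBlDr// -EFinB {1}(splitr x) addrK.
apply: le_trans; rewrite lee_fin.
apply: (@le_trans _ _ (x * expR (- (n.+1%:R * h)))); last first.
  by apply: (ler_wpM2l (ltW x0)); move: n3; rewrite div1r.
rewrite /x -expRD ler_expR -opprD lerN2 -mulrDr ler_pM2l ?ltr0n//; lra.
Qed.

Lemma measurable_norm2_rproj n (B : set (Rplus R)) : <<s @open (Rplus R) >> B ->
  measurable [set w | B (norm2 (rproj a (Y n w : 'cV[R]_n.+1)))].
Proof.
move: B; apply: smallest_sub; last first.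
  move=> _ [V oV <-] /=.
  have mX : measurable_fun setT (fun w => X n w) by exact: measurable_X.
  by have := mX measurableT _ (open_measurable oV); rewrite setTI.
have := @sigma_algebra_image _ _ setT (fun w => norm2 (rproj a (Y n w : 'cV[R]_n.+1))) _ (@sigma_algebra_measurable _ (Omega n)).
rewrite /image_set_system; under eq_set do rewrite setTI; exact.
Qed.

Lemma near_rplus (B : set (Rplus R)) (y : Rplus R) : nbhs y B ->
  exists2 dl : R, 0 < dl & forall x : Rplus R, `|\val y - \val x| < dl -> B x.
Proof.
rewrite -{1}(rplus_val y) => /(@continuous_rplus R (\val y)) /nbhs_ballP[dl /= dl0 h].
by exists dl => // x hx; rewrite -(rplus_val x); exact: (h (\val x)).
Qed.

Lemma ldp_lower (B : set (Rplus R)) : <<s @open (Rplus R) >> B ->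
  (- ereal_inf ((fun r : Rplus R => J (\val r)) @` B°) <=
   limn_einf (fun n => (n.+1%:R^-1)%:E * lne (P n [set w | B (norm2 (rproj a (Y n w : 'cV[R]_n.+1)))])))%E.
Proof.
move=> mB; rewrite leeNl; apply: le_ereal_inf_tmp => _ [y By <-].
have r0 := rplus_ge0 y.
case E : (J (\val y)) => [C| |]; last 2 first.
- exact: leey.
- by have := rate_ge0 hp Zd gd (\val y); rewrite E.
have [dl dl0 hdl] := near_rplus By.
rewrite leeNl; apply/lee_addgt0Pr => e e0; rewrite -leeBlDr//.
apply: limn_einf_ge_near; have := interval_lower r0 dl0 E e0; apply: filterS => n hn.
have mX := @measurable_X n.
rewrite -EFinN -EFinB -opprD.
have : ((expR (- (n.+1%:R * (C + e))))%:E <= P n [set w | B (norm2 (rproj a (Y n w : 'cV[R]_n.+1)))])%E.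
  apply: le_trans hn _; apply: le_measure; rewrite ?inE.
  - apply: (@measurableI _ _ [set w | \val y - dl < X n w] [set w | X n w < \val y + dl]); exact: measurable_ltr.
  - exact: measurable_norm2_rproj.
  move=> w [h1 h2] /=; apply: hdl.
  suff : `|\val y - enorm (rproj a (Y n w : 'cV[R]_n.+1))| < dl by [].
  by rewrite ltr_norml; apply/andP; split; lra.
have := fin_num_measure (P n) _ (@measurable_norm2_rproj n B mB); move/fineK => <-.
by rewrite lee_fin => /log_rate_ge.
Qed.

(** The infimum [r] of [B] belongs to its closure, and the event is contained in the tail beyond
    [r]; so the tail bound at this single point suffices. *)
Lemma ldp_upper (B : set (Rplus R)) : <<s @open (Rplus R) >> B ->
  (limn_esup (fun n => (n.+1%:R^-1)%:E * lne (P n [set w | B (norm2 (rproj a (Y n w : 'cV[R]_n.+1)))])) <=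
   - ereal_inf ((fun r : Rplus R => J (\val r)) @` closure B))%E.
Proof.
move=> mB; set I := ereal_inf _.
rewrite leeNr; apply: lee_dense => x xI; rewrite leeNr; apply: limn_esup_le_near.
have fP n := fin_num_measure (P n) _ (@measurable_norm2_rproj n B mB).
(* The empty set has no infimum in the reals and is treated apart. *)
have [->|/set0P [y0 By0]] := eqVneq B set0.
  by apply: nearW => n; rewrite (_ : [set w | _] = set0)// measure0; apply: log_rate_le; exact: expR_ge0.
pose V := [set \val y | y in B].
have V0 : lbound V 0 by move=> _ [y _ <-]; exact: rplus_ge0.
have hV : has_inf V by split; [exists (\val y0), y0|exists 0].
pose r := inf V; have r0 : 0 <= r by apply: lb_le_inf => //; exact: hV.1.
have clr : closure B (rplus r).
  move=> U /near_rplus[dl dl0 hdl]; have [_ [y By <-] hy] := inf_adherent dl0 hV.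
  exists y; split => //; apply: hdl; have -> : \val (rplus r) = r by rewrite /= ger0_norm.
  rewrite distrC ger0_norm ?ltrBlDl//.
  by rewrite subr_ge0; apply: ge_inf; [exists 0|exists y].
have Jr : (x%:E < J r)%E.
  apply: lt_le_trans xI _; apply: ereal_inf_lbound; exists (rplus r) => //=.
  by rewrite ger0_norm.
have [s [l [s0 hsl]]] := rate_gt hp Zd gd r0 Jr.
have e0 : 0 < p^-1 + obj r s l - x by rewrite subr_gt0.
move: (upper_tail l r0 s0 e0); apply: filterS => n hn.
have : (P n [set w | B (norm2 (rproj a (Y n w : 'cV[R]_n.+1)))] <= (expR (- (n.+1%:R * x)))%:E)%E.
  apply: le_trans (le_trans _ hn) _; last by rewrite opprB addrCA subrr addr0.
  apply: le_measure; rewrite ?inE.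
  - exact: measurable_norm2_rproj.
  - by have mX := @measurable_X n; exact: measurable_ler.
  by move=> w Bw /=; apply: ge_inf; [exists 0|exists (norm2 (rproj a (Y n w)))].
by rewrite -(fineK (fP n)) lee_fin => /log_rate_le.
Qed.

Lemma ldp : LDP P (fun n w => norm2 (rproj a (Y n w : 'cV[R]_n.+1))) (fun n => n.+1%:R) (fun r : Rplus R => J (\val r)).
Proof.
split=> [n B mB|B mB u]; first exact: measurable_norm2_rproj.
by split; [exact: ldp_lower|exact: limn_einf_sup|exact: ldp_upper].
Qed.
End ldp.

Theorem corollary1p3 (R : realType) (p : R) (hp : 2 <= p)
  (k : nat -> nat)
  (k_gt0 : forall n, (0 < k n)%N)
  (k_le : forall n, (k n <= n.+1)%N)
  (k_incr : forall n, (k n <= k n.+1)%N)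
  (k_infty : k n @[n --> \oo] --> \oo)
  (k_ratio : (k n)%:R / n.+1%:R @[n --> \oo] --> (0 : R))
  (sigma_ : forall n, probability (borel (stiefel R (k_le n))) R)
  (sigma_haar : forall n, is_haar (sigma_ n))
  (sigma : probability (stiefel_prod R k_le) R)
  (sigma_marginals : has_marginals sigma sigma_)
  (d : nat -> measure_display) (Omega : forall n, measurableType (d n))
  (P : forall n, probability (Omega n) R)
  (Y : forall n, {RV (P n) >-> borel 'cV[R]_n.+1})
  (Y_unif : forall n, uniform_on (lp_ball p n.+1) (Y n))
  (dZ : measure_display) (OmegaZ : measurableType dZ)
  (PZ : probability OmegaZ R) (Z : {RV PZ >-> R}) (Z_density : has_density_p p Z)
  (dg : measure_display) (Omegag : measurableType dg)
  (Pg : probability Omegag R) (g0 : {RV Pg >-> R})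
  (g0_gaussian : standard_gaussian g0) :
  let I_p := rate p Z g0 in
  [/\ {ae sigma, forall a : stiefel_prod R k_le,
        LDP P
          (fun n w => norm2 ((Num.sqrt n.+1%:R)^-1 *: ((stiefel_mx (k_le n) (a n))^T *m Y n w)))
          (fun n => n.+1%:R)
          (fun r : Rplus R => I_p (\val r))},
      good_rate_function (fun r : Rplus R => I_p (\val r)) &
      convex_on [set r | 0 <= r] I_p].
Proof.
move=> I_p; split.
- have := ae_typical_cgf hp Z_density k_gt0 k_ratio sigma_haar sigma_marginals.
  by apply: filterS => a typ; exact: (ldp hp Z_density g0_gaussian typ Y_unif).
- exact: (good_rate hp Z_density g0_gaussian).
- by move=> x y t _ _ t01; exact: (rate_convex hp Z_density g0_gaussian x y t01).
Qed.
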